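(* Each of the following collections of sets of circles in the plane $\mathbb{R}^2$ (where lines are regarded as circles) contains a hexagonal $3$-web of circular arcs: (a) the set of tangent lines to a circle, counted twice, and a parabolic pencil of circles with the vertex at the center of the circle; (b) the set of tangent lines to a general conic, counted twice, and the hyperbolic pencil of circles with limiting points at the foci of the conic; (c) the set of tangent lines to a general conic (counted once), the pencil of lines with the vertex at a focus of the conic, and the set of circles doubly tangent to the conic such that their centers lie on the minor axis of the conic; (d) the set of tangent lines to a parabola, counted twice, and the hyperbolic pencil of circles with limiting points at the focus of the parabola and at an arbitrary point on the directrix; (e) the set of circles doubly tangent to an ellipse with eccentricity $\frac{1}{\sqrt{2}}$ such that their centers lie on the major axis of the ellipse, counted twice, and the elliptic pencil of circles with vertices at the foci of the ellipse.
   Context: A *circular arc* is either an arc of a circle, or a line segment, or a ray, or a line; circular arcs do not contain their endpoints. A *domain* is a nonempty connected open subset of $\mathbb{R}^2$. *Hexagonal $3$-web.* Three sets of circular arcs in a domain $\Omega\subset\mathbb{R}^2$ form a *hexagonal $3$-web of circular arcs* if there is a real analytic diffeomorphism $f\colon\Omega\to\Omega'\subset\mathbb{R}^2$ which takes the three sets of arcs, respectively, to the three sets of intersections with $\Omega'$ of the lines parallel to the first, second and third side of a fixed triangle, and all the nonempty intersections of these lines with $\Omega'$ are connected. Three sets of circles *contain a hexagonal $3$-web* if appropriate (possibly empty) arcs of the circles of the three sets form a hexagonal $3$-web in an appropriate domain. Two of the three sets of circles are allowed to coincide; in this case one takes two disjoint arcs from each circle of that set (one for each of the two corresponding sets of arcs),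 and the set is said to be *counted twice*. *Pencils.* Let $c_1(x,y)=0$ and $c_2(x,y)=0$ be equations of degree $2$ or $1$ of two distinct circles $c_1$ and $c_2$ (a circle with an equation of degree $1$ is a line). A *pencil of circles* is the set of all circles having an equation of the form $\alpha c_1(x,y)+\beta c_2(x,y)=0$, where $\alpha,\beta$ are real numbers not vanishing simultaneously. A *pencil of lines* with vertex at a point is the set of all lines passing through that point. If $c_1$ and $c_2$ have two distinct common points (the *vertices* of the pencil), the pencil is *elliptic*; all its circles pass through these two points. If $c_1$ and $c_2$ are tangent (the tangency point is the *vertex* of the pencil), the pencil is *parabolic*; it consists of circles tangent to $c_1$ and $c_2$ at that same point. If $c_1$ and $c_2$ have no common points, the pencil is *hyperbolic*; it contains ''circles'' degenerating to points, called the *limiting points* of the pencil. A *general conic* is either an ellipse distinct from a circle or a hyperbola. The minor axis of a conic with foci $F_1,F_2$ is its axis of symmetry perpendicular to $F_1F_2$ (the perpendicular bisector of $F_1F_2$); the major axis is the axis of symmetry containing the foci. A circle is *doubly tangent* to a conic if it is tangent to the conic at two points. *)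

(* Defs.v *)
From HB Require Import structures.
From mathcomp Require Import all_boot all_order all_algebra.
From mathcomp Require Import all_classical all_reals all_analysis.

Set Implicit Arguments.
Unset Strict Implicit.
Unset Printing Implicit Defensive.

Import Order.TTheory GRing.Theory Num.Theory.
Import numFieldNormedType.Exports.

Local Open Scope classical_set_scope.
Local Open Scope ring_scope.

Notation plane R := (R * R)%type.

Section Plane.
Context {R : realType}.
Implicit Types (p q c v F V : plane R) (A S K L axis : set (plane R)).
Implicit Types (C P : set (set (plane R))).

(* The library norm on [R * R] is the max norm, hence an explicit Euclidean
   distance; the topology is the same. *)
Definition edist p q : R :=
  Num.sqrt ((p.1 - q.1) ^+ 2 + (p.2 - q.2) ^+ 2).

Definition set_dist p A : R := inf [set edist p q | q in A].

Definition line p v : set (plane R) :=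
  [set q | exists t : R, q = (p.1 + t * v.1, p.2 + t * v.2)].

Definition is_line L := exists p v, v != 0 /\ L = line p v.

Definition circle c (r : R) : set (plane R) := [set p | edist p c = r].

Definition is_proper_circle S := exists c (r : R), 0 < r /\ S = circle c r.

Definition is_circle S := is_proper_circle S \/ is_line S.

(* Endpoints are excluded.  The case [b = a + 2 * pi] is a circle without one
   point. *)
Definition circle_arc A := exists c (r a b : R),
  [/\ 0 < r, a < b, b <= a + 2 * pi
    & A = [set (c.1 + r * cos t, c.2 + r * sin t) | t in `]a, b[ ]].

Definition segment A := exists p v, v != 0 /\
  A = [set (p.1 + t * v.1, p.2 + t * v.2) | t in `]0, 1[ ].

Definition ray A := exists p v, v != 0 /\
  A = [set (p.1 + t * v.1, p.2 + t * v.2) | t in `]0, +oo[ ].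

Definition circular_arc A := [\/ circle_arc A, segment A, ray A | is_line A].

Definition domain (Omega : set (plane R)) :=
  [/\ Omega !=set0, open Omega & connected Omega].

(* The double series is absolutely convergent, so its sum does not depend on
   the order of summation; it is computed along square partial sums. *)
Definition power_series2_sum (a : nat -> nat -> R) (x y l : R) :=
  summable [set: nat * nat]
    (fun k => (a k.1 k.2 * x ^+ k.1 * y ^+ k.2)%:E) /\
  (fun n : nat => \sum_(i < n) \sum_(j < n) a i j * x ^+ i * y ^+ j)
    @ \oo --> l.

Definition analytic_at (h : plane R -> R) p :=
  exists (a : nat -> nat -> R) (r : R), 0 < r /\
    forall q, `|q.1 - p.1| < r -> `|q.2 - p.2| < r ->
      power_series2_sum a (q.1 - p.1) (q.2 - p.2) (h q).

Definition analytic_on (Omega : set (plane R)) (f : plane R -> plane R) :=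
  forall p, Omega p ->
    analytic_at (fun q => (f q).1) p /\ analytic_at (fun q => (f q).2) p.

Definition analytic_diffeo (Omega Omega' : set (plane R))
    (f : plane R -> plane R) :=
  [/\ open Omega, open Omega', set_bij Omega Omega' f, analytic_on Omega f
    & exists g : plane R -> plane R,
        (forall p, Omega p -> g (f p) = p) /\ analytic_on Omega' g].

Definition vec p q : plane R := (q.1 - p.1, q.2 - p.2).

Definition triangle p q c :=
  (q.1 - p.1) * (c.2 - p.2) - (q.2 - p.2) * (c.1 - p.1) != 0.

Definition parallel_leaves (Omega : set (plane R)) v : set (set (plane R)) :=
  [set A | A !=set0 /\ exists p, A = line p v `&` Omega].

Definition hexagonal_web (Omega : set (plane R))
    (S1 S2 S3 : set (set (plane R))) :=
  (forall A, S1 A \/ S2 A \/ S3 A -> circular_arc A /\ A `<=` Omega) /\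
  exists (a b c : plane R) (Omega' : set (plane R)) (f : plane R -> plane R),
    [/\ triangle a b c, analytic_diffeo Omega Omega' f,
        [/\ [set f @` A | A in S1] = parallel_leaves Omega' (vec a b),
            [set f @` A | A in S2] = parallel_leaves Omega' (vec b c)
          & [set f @` A | A in S3] = parallel_leaves Omega' (vec c a)]
      & forall A, parallel_leaves Omega' (vec a b) A \/
                  parallel_leaves Omega' (vec b c) A \/
                  parallel_leaves Omega' (vec c a) A -> connected A].

(* [s] chooses one possibly empty arc on each circle of [C]. *)
Definition arc_choice (Omega : set (plane R)) C
    (s : set (plane R) -> set (plane R)) :=
  forall S, C S ->
    s S = set0 \/ (circular_arc (s S) /\ s S `<=` S `&` Omega).

Definition chosen_arcs C (s : set (plane R) -> set (plane R)) :
    set (set (plane R)) :=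
  [set A | A !=set0 /\ exists S, C S /\ A = s S].

Definition web_from_choices (Omega : set (plane R))
    (C1 C2 C3 : set (set (plane R)))
    (s1 s2 s3 : set (plane R) -> set (plane R)) :=
  [/\ domain Omega,
      [/\ arc_choice Omega C1 s1, arc_choice Omega C2 s2
        & arc_choice Omega C3 s3]
    & hexagonal_web Omega (chosen_arcs C1 s1) (chosen_arcs C2 s2)
        (chosen_arcs C3 s3)].

Definition contains_hexagonal_web (C1 C2 C3 : set (set (plane R))) :=
  exists Omega s1 s2 s3, web_from_choices Omega C1 C2 C3 s1 s2 s3.

Definition contains_hexagonal_web_twice (C C3 : set (set (plane R))) :=
  exists Omega s1 s2 s3,
    web_from_choices Omega C C C3 s1 s2 s3 /\
    (forall S, C S -> s1 S `&` s2 S = set0).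

(* [L] is spanned by a nonzero velocity at [p] of a curve lying in [K]. *)
Definition tangent_line_at K p L :=
  exists (x y : R -> R) (v : plane R),
    [/\ x 0 = p.1 /\ y 0 = p.2, \forall t \near (0 : R), K (x t, y t),
        is_derive (0 : R) (1 : R) x v.1 /\ is_derive (0 : R) (1 : R) y v.2,
        v != 0 & L = line p v].

Definition tangent_lines K : set (set (plane R)) :=
  [set L | exists p, tangent_line_at K p L].

Definition tangent_at S K p :=
  exists L, tangent_line_at S p L /\ tangent_line_at K p L.

Definition doubly_tangent S K :=
  exists p q, [/\ p <> q, tangent_at S K p & tangent_at S K q].

Definition doubly_tangent_circles K axis : set (set (plane R)) :=
  [set S | exists c (r : R),
    [/\ 0 < r, S = circle c r, axis c & doubly_tangent S K]].

Definition circle_polynomial (e : plane R -> R) := exists a b c d : R,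
  e = fun p => a * (p.1 ^+ 2 + p.2 ^+ 2) + b * p.1 + c * p.2 + d.

Definition zeros (e : plane R -> R) : set (plane R) := [set p | e p = 0].

Definition circle_equation (e : plane R -> R) S :=
  [/\ circle_polynomial e, is_circle S & S = zeros e].

(* All zero loci of nontrivial combinations, including those that are points or
   empty. *)
Definition pencil_loci (e1 e2 : plane R -> R) : set (set (plane R)) :=
  [set S | exists alpha beta : R, (alpha, beta) != 0 /\
     S = zeros (fun p => alpha * e1 p + beta * e2 p)].

Definition pencil (e1 e2 : plane R -> R) : set (set (plane R)) :=
  [set S | is_circle S /\ pencil_loci e1 e2 S].

Definition line_pencil V : set (set (plane R)) :=
  [set L | is_line L /\ L V].

Definition elliptic_pencil P p q := exists e1 e2 S1 S2,
  [/\ circle_equation e1 S1, circle_equation e2 S2, P = pencil e1 e2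
    & p <> q /\ S1 `&` S2 = [set p; q]].

Definition parabolic_pencil P p := exists e1 e2 S1 S2,
  [/\ circle_equation e1 S1, circle_equation e2 S2, P = pencil e1 e2
    & S1 <> S2 /\ tangent_at S1 S2 p].

(* [p] and [q] are the limiting points. *)
Definition hyperbolic_pencil P p q := exists e1 e2 S1 S2,
  [/\ circle_equation e1 S1, circle_equation e2 S2, P = pencil e1 e2,
      S1 <> S2 /\ S1 `&` S2 = set0
    & [/\ p <> q, pencil_loci e1 e2 [set p] & pencil_loci e1 e2 [set q]]].

(* [F1 = F2] gives a circle. *)
Definition is_ellipse K F1 F2 (a : R) :=
  edist F1 F2 < 2 * a /\ K = [set p | edist p F1 + edist p F2 = 2 * a].

Definition is_hyperbola K F1 F2 (a : R) :=
  [/\ 0 < a, 2 * a < edist F1 F2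
    & K = [set p | `|edist p F1 - edist p F2| = 2 * a]].

Definition eccentricity F1 F2 (a : R) : R := edist F1 F2 / (2 * a).

Definition general_conic K F1 F2 :=
  (exists a, is_ellipse K F1 F2 a /\ ~ is_proper_circle K) \/
  (exists a, is_hyperbola K F1 F2 a).

Definition minor_axis F1 F2 : set (plane R) :=
  [set p | edist p F1 = edist p F2].

Definition major_axis F1 F2 : set (plane R) := line F1 (vec F1 F2).

Definition is_parabola K F D :=
  [/\ is_line D, ~ D F & K = [set p | edist p F = set_dist p D]].

End Plane.

(* Main.v *)
Require Import Defs.
From mathcomp Require Import all_boot all_order all_algebra.
From mathcomp Require Import all_classical all_reals all_analysis.
From mathcomp Require Import finmap zify ring lra.
Import Order.TTheory GRing.Theory Num.Theory.
Import numFieldNormedType.Exports.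
Local Open Scope classical_set_scope.
Local Open Scope ring_scope.

(** A web of three families is hexagonal as soon as there are local analytic
coordinates (u, v) in which the three families are u = const, v = const and
u + v = const.  For each of the five collections such coordinates exist in
closed form.

In four cases two of the families are the same one-parameter family, and a
point P lies on exactly two of its members, whose parameters t1 and t2 are the
roots of a quadratic equation with coefficients depending on P.  One then needs
a function h of the parameter such that h(t1) + h(t2) is constant along the
third family; u = h(t1) and v = h(t2) are the coordinates.

- Tangents of a circle with centre O: if the tangents at the angles x1 and x2
  meet in P, the inverse of P with respect to the circle is the midpoint of the
  two contact points, and inversion turns a parabolic pencil with vertex O into
  parallel lines.  So h is the cosine of the angle.
- Tangents of a conic with foci F1 and F2: the ratio of the distances from F1
  and F2 to the two tangents through P has product PF1^2 / PF2^2, which is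
  constant on Apollonius circles.  So h is the logarithm of that ratio.
- Tangents of a parabola with focus F: a tangent is the perpendicular bisector
  of F and of a point T of the directrix, and P is equidistant from F and its
  two points T1, T2.  The power of Q with respect to the circle with centre P
  through F is PQ^2 - PF^2 = QT1 . QT2, while 4 p^2 PF^2 = FT1^2 . FT2^2.  So h
  is the logarithm of QT / FT^2.
- Doubly tangent circles of the ellipse with a^2 = 2 c^2, b = c: the circle with
  centre (k, 0) has squared radius c^2 - k^2.  If P = (x, y) lies on the circles
  with parameters k1 and k2 then x = k1 + k2 and x^2 + y^2 - c^2 = 2 k1 k2, and
  the quotient of x^2 + y^2 - c^2 by y is a function of the product of the
  k^2 / (c^2 - k^2).  So h is the logarithm of that expression.

In the remaining case let F be the focus, let th be the direction of the normal
of a tangent line and ph the direction of a line through F, and let P be their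
common point.  The distance d from F to the tangent satisfies
d^2 + 2 c d cos(th) = b^2.  The circle with centre (0, c tan(ka)) of the third
family passes through P exactly when PF cos(ka) satisfies the same equation with
th = ph + ka.  As d = PF cos(th - ph), the circle through P is the one with
ka = th - ph, so th and -ph are the coordinates.

The first half of the file provides the analysis: real analytic functions of two
variables are handled through double series with a weighted l^1 bound
([expandsM], [germ_comp]), local analytic isomorphisms are composed
([local_iso_comp]), and [web_of_chart] produces the domain and the arcs from a
chart.  The second half describes pencils by equations, and computes. *)

Set Implicit Arguments.
Unset Strict Implicit.
Unset Printing Implicit Defensive.

Local Notation edist := Defs.edist.

(** * Absolutely convergent double series *)

Section DoubleSeries.
Context {R : realType}.
Implicit Types (a b c : nat -> nat -> R) (x y : R) (n : nat).

Definition box_sum a n : R := \sum_(i < n) \sum_(j < n) a i j.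

Definition cauchy_prod a b i j : R :=
  \sum_(k < i.+1) \sum_(l < j.+1) a k l * b (i - k)%N (j - l)%N.

Definition at_point a x y i j : R := a i j * x ^+ i * y ^+ j.

Definition abs_coef a i j : R := `|a i j|.

Lemma sum_ord_monotone (F : nat -> R) m n :
  (forall i, 0 <= F i) -> (m <= n)%N -> \sum_(i < m) F i <= \sum_(i < n) F i.
Proof.
move=> F0 /subnKC <-; rewrite big_split_ord /= lerDl.
by apply: sumr_ge0 => i _.
Qed.

Lemma box_sum_monotone a m n :
  (forall i j, 0 <= a i j) -> (m <= n)%N -> box_sum a m <= box_sum a n.
Proof.
move=> a0 mn; rewrite /box_sum.
apply: (@le_trans _ _ (\sum_(i < m) \sum_(j < n) a i j)).
  by apply: ler_sum => i _; apply: (@sum_ord_monotone (a i)).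
apply: (@sum_ord_monotone (fun i => \sum_(j < n) a i j)) => // i.
by apply: sumr_ge0 => j _.
Qed.

Lemma sum_antidiagonals (F : nat -> nat -> R) n :
  \sum_(m < n) \sum_(k < m.+1) F k (m - k)%N =
  \sum_(k < n) \sum_(l < n) F k l *+ (k + l < n)%N.
Proof.
elim: n => [|n IH]; first by rewrite !big_ord0.
rewrite big_ord_recr /= IH.
have -> : \sum_(k < n.+1) \sum_(l < n.+1) F k l *+ (k + l < n.+1)%N =
   \sum_(k < n.+1) \sum_(l < n.+1) F k l *+ (k + l < n)%N +
   \sum_(k < n.+1) \sum_(l < n.+1) F k l *+ (k + l == n)%N.
  rewrite -big_split; apply: eq_bigr => k _ /=.
  rewrite -big_split; apply: eq_bigr => l _ /=.
  by rewrite -mulrnDr ltnS leq_eqVlt; case: eqP => [->|]; rewrite ?ltnn ?addn0.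
congr (_ + _).
  rewrite [RHS]big_ord_recr /= [X in _ = _ + X]big1 ?addr0; last first.
    by move=> l _; rewrite ltnNge leq_addr.
  apply: eq_bigr => k _; rewrite [RHS]big_ord_recr /=.
  by rewrite ltnNge leq_addl addr0.
apply: eq_bigr => k _.
have lt : (n - k < n.+1)%N by rewrite ltnS leq_subr.
rewrite (bigD1 (Ordinal lt)) //= subnKC -1?ltnS // eqxx mulr1n big1 ?addr0 //.
move=> l /eqP H; case: eqP => // E; case: H; apply: val_inj => /=.
by rewrite -(addKn k l) E.
Qed.

(** Summation along antidiagonals in both indices: the square partial sum of a
    Cauchy product collects the products whose first indices and whose second
    indices add up to less than n. *)
Lemma box_sum_prod a b n :
  box_sum (cauchy_prod a b) n =
  \sum_(k < n) \sum_(k' < n) \sum_(l < n) \sum_(l' < n)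
     (a k l * b k' l') *+ ((k + k' < n)%N && (l + l' < n)%N).
Proof.
rewrite /box_sum /cauchy_prod.
under eq_bigr do rewrite exchange_big /=.
pose G k k' := \sum_(l < n) \sum_(l' < n) (a k l * b k' l') *+ (l + l' < n)%N.
transitivity (\sum_(i < n) \sum_(k < i.+1) G k (i - k)%N).
  apply: eq_bigr => i _; apply: eq_bigr => k _.
  exact: (@sum_antidiagonals (fun l l' => a k l * b (i - k)%N l')).
rewrite sum_antidiagonals; apply: eq_bigr => k _; apply: eq_bigr => k' _.
rewrite /G -sumrMnl; apply: eq_bigr => l _; rewrite -sumrMnl.
by apply: eq_bigr => l' _; rewrite -mulrnA mulnb andbC.
Qed.

Lemma box_sumM a b n :
  box_sum a n * box_sum b n =
  \sum_(k < n) \sum_(k' < n) \sum_(l < n) \sum_(l' < n) a k l * b k' l'.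
Proof.
rewrite /box_sum mulr_suml; apply: eq_bigr => k _.
rewrite mulr_sumr; apply: eq_bigr => k' _.
rewrite mulr_suml; apply: eq_bigr => l _.
by rewrite mulr_sumr.
Qed.

Lemma box_sum_prod_le a b n :
  (forall i j, 0 <= a i j) -> (forall i j, 0 <= b i j) ->
  box_sum (cauchy_prod a b) n <= box_sum a n * box_sum b n.
Proof.
move=> a0 b0; rewrite box_sumM box_sum_prod.
do 4 (apply: ler_sum => ? _).
by case: (_ && _); rewrite ?mulr1n ?mulr0n // mulr_ge0.
Qed.

(** Two indices below n add up to less than 2 n.  Together with
    [box_sum_prod_le] this squeezes the product of two partial sums between two
    partial sums of the Cauchy product. *)
Lemma box_sumM_le a b n :
  (forall i j, 0 <= a i j) -> (forall i j, 0 <= b i j) ->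
  box_sum a n * box_sum b n <= box_sum (cauchy_prod a b) (n + n).
Proof.
move=> a0 b0; rewrite box_sumM box_sum_prod.
pose T k k' l l' := (a k l * b k' l') *+
  ((k + k' < n + n)%N && (l + l' < n + n)%N).
have T0 k k' l l' : 0 <= T k k' l l' by rewrite mulrn_wge0 // mulr_ge0.
pose m := (n + n)%N.
apply: (@le_trans _ _ (\sum_(k < n) \sum_(k' < n) \sum_(l < n) \sum_(l' < n)
   T k k' l l')).
  apply: ler_sum => k _; apply: ler_sum => k' _.
  apply: ler_sum => l _; apply: ler_sum => l' _; rewrite /T.
  suff H (i j : 'I_n) : (i + j < n + n)%N by rewrite !H.
  by rewrite (ltn_trans (n := n + j)) // ?ltn_add2r ?ltn_add2l.
have nm : (n <= m)%N by rewrite leq_addr.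
have S1 k k' l : 0 <= \sum_(l' < m) T k k' l l' by apply: sumr_ge0.
have S2 k k' : 0 <= \sum_(l < m) \sum_(l' < m) T k k' l l' by apply: sumr_ge0.
have S3 k : 0 <= \sum_(k' < m) \sum_(l < m) \sum_(l' < m) T k k' l l'.
  by apply: sumr_ge0.
apply: le_trans (@sum_ord_monotone
  (fun k => \sum_(k' < m) \sum_(l < m) \sum_(l' < m) T k k' l l') _ _ S3 nm).
apply: ler_sum => k _.
apply: le_trans (@sum_ord_monotone
  (fun k' => \sum_(l < m) \sum_(l' < m) T k k' l l') _ _ (S2 k) nm).
apply: ler_sum => k' _.
apply: le_trans (@sum_ord_monotone
  (fun l => \sum_(l' < m) T k k' l l') _ _ (S1 k k') nm).
apply: ler_sum => l _.
exact: (@sum_ord_monotone (fun l' => T k k' l l') _ _ (T0 k k' l) nm).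
Qed.

(** Both errors are sums over the same set of missing products. *)
Lemma box_sum_prod_error a b n :
  `|box_sum a n * box_sum b n - box_sum (cauchy_prod a b) n| <=
  box_sum (abs_coef a) n * box_sum (abs_coef b) n
    - box_sum (cauchy_prod (abs_coef a) (abs_coef b)) n.
Proof.
rewrite !box_sumM !box_sum_prod.
do 4 (rewrite -!sumrB; apply: le_trans (ler_norm_sum _ _ _) _;
      apply: ler_sum => ? _).
rewrite /abs_coef -normrM; case: (_ && _); rewrite ?mulr1n ?mulr0n ?subr0 //.
by rewrite !subrr normr0.
Qed.

Lemma nondecreasing_bounded_cvg (u : nat -> R) M :
  (forall m n, (m <= n)%N -> u m <= u n) -> (forall n, u n <= M) ->
  exists l : R, u @ \oo --> l /\ forall n, u n <= l.
Proof.
move=> ndu uM; exists (limn u).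
have cu : cvgn u.
  by apply: nondecreasing_is_cvgn => //; exists M => _ [n _ <-].
by split=> // n; exact: nondecreasing_cvgn_le.
Qed.

(** Mertens' theorem for double series.  For the absolute values, the product of
    the partial sums lies between two terms of a bounded monotone sequence, so
    the error in [box_sum_prod_error] tends to 0. *)
Lemma cvg_box_sum_prod a b (A B M N : R) :
  (forall n, box_sum (abs_coef a) n <= M) -> (forall n, box_sum (abs_coef b) n <= N) ->
  box_sum a @ \oo --> A -> box_sum b @ \oo --> B ->
  box_sum (cauchy_prod a b) @ \oo --> A * B.
Proof.
move=> aM bN cA cB.
have a0 i j : 0 <= abs_coef a i j by rewrite /abs_coef.
have b0 i j : 0 <= abs_coef b i j by rewrite /abs_coef.
have [A' [cA' leA']] := nondecreasing_bounded_cvg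
  (fun m n mn => box_sum_monotone a0 mn) aM.
have [B' [cB' leB']] := nondecreasing_bounded_cvg
  (fun m n mn => box_sum_monotone b0 mn) bN.
have s0 c n : (forall i j, 0 <= c i j) -> 0 <= box_sum c n.
  by move=> c0; apply: sumr_ge0 => i _; apply: sumr_ge0.
pose T := box_sum (cauchy_prod (abs_coef a) (abs_coef b)).
have cv0 i j : 0 <= cauchy_prod (abs_coef a) (abs_coef b) i j.
  by apply: sumr_ge0 => k _; apply: sumr_ge0 => l _; rewrite mulr_ge0.
have [t [cT leT]] : exists t, T @ \oo --> t /\ forall n, T n <= t.
  apply: (@nondecreasing_bounded_cvg _ (A' * B')).
    by move=> m n; exact: box_sum_monotone.
  move=> n; apply: le_trans (box_sum_prod_le n a0 b0) _.
  by apply: ler_pM; rewrite ?s0.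
have cT2 : (fun n => T (n + n)%N) @ \oo --> t.
  apply: cvg_comp cT => U [m _ mU]; exists m => // n /= mn.
  by apply: mU => /=; rewrite (leq_trans mn) // leq_addr.
have cAB : (fun n => box_sum (abs_coef a) n * box_sum (abs_coef b) n) @ \oo --> t.
  apply: (@squeeze_cvgr _ _ _ _ T (fun n => T (n + n)%N)) => //.
  by near=> n; rewrite box_sum_prod_le //= box_sumM_le.
have c0 : (fun n => box_sum (abs_coef a) n * box_sum (abs_coef b) n - T n) @ \oo --> 0.
  by rewrite -(subrr t); apply: cvgB.
have d0 : (fun n => box_sum a n * box_sum b n - box_sum (cauchy_prod a b) n)
    @ \oo --> 0.
  apply/norm_cvg0P; apply: squeeze_cvgr c0; last exact: cvg_cst.
  by near=> n; rewrite normr_ge0 /= box_sum_prod_error.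
have -> : box_sum (cauchy_prod a b) = (fun n => box_sum a n * box_sum b n -
   (box_sum a n * box_sum b n - box_sum (cauchy_prod a b) n)).
  by apply/funext => n; rewrite subKr.
rewrite -[A * B]subr0; apply: cvgB => //; exact: cvgM.
Unshelve. all: by end_near. Qed.

Lemma at_point_prod a b x y i j :
  at_point (cauchy_prod a b) x y i j = cauchy_prod (at_point a x y) (at_point b x y) i j.
Proof.
rewrite /at_point /cauchy_prod !mulr_suml; apply: eq_bigr => k _.
rewrite !mulr_suml; apply: eq_bigr => l _.
have -> : x ^+ i = x ^+ k * x ^+ (i - k) by rewrite -exprD subnKC // -ltnS.
have -> : y ^+ j = y ^+ l * y ^+ (j - l) by rewrite -exprD subnKC // -ltnS.
ring.
Qed.

End DoubleSeries.

(** * Germs of analytic functions of two variables *)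

Section Germs.
Context {R : realType}.
Implicit Types (a b : nat -> nat -> R) (h k : plane R -> R) (p q : plane R).

(** The bound M on a weighted l^1 norm of the coefficients is what is
    submultiplicative, and so survives products and substitutions.  It also
    bounds h on the closed square of half-side rho. *)
Definition expands a (rho M : R) h p :=
  [/\ 0 < rho, forall n, box_sum (at_point (abs_coef a) rho rho) n <= M
    & forall q, `|q.1 - p.1| <= rho -> `|q.2 - p.2| <= rho ->
        box_sum (at_point a (q.1 - p.1) (q.2 - p.2)) @ \oo --> h q].

Definition germ h p := exists a rho M, expands a rho M h p.

Lemma le_box_sum a b n : (forall i j, a i j <= b i j) ->
  box_sum a n <= box_sum b n.
Proof. by move=> ab; apply: ler_sum => i _; apply: ler_sum => j _. Qed.

Lemma ler_norm_box_sum a n : `|box_sum a n| <= box_sum (abs_coef a) n.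
Proof.
apply: le_trans (ler_norm_sum _ _ _) _; apply: ler_sum => i _.
exact: ler_norm_sum.
Qed.

Lemma abs_coef_at_point_le a (x y rho : R) i j : `|x| <= rho -> `|y| <= rho ->
  abs_coef (at_point a x y) i j <= at_point (abs_coef a) rho rho i j.
Proof.
move=> xr yr; rewrite /abs_coef /at_point !normrM !normrX.
by apply: ler_pM; rewrite ?mulr_ge0 ?exprn_ge0 ?ler_wpM2l ?lerXn2r ?nnegrE //
  (le_trans _ xr).
Qed.

Lemma expands_bound a rho M h p q : expands a rho M h p ->
  `|q.1 - p.1| <= rho -> `|q.2 - p.2| <= rho -> `|h q| <= M.
Proof.
move=> [r0 aM ah] q1 q2; have ch := ah q q1 q2.
have cn : (fun n => `|box_sum (at_point a (q.1 - p.1) (q.2 - p.2)) n|)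
    @ \oo --> `|h q| by exact: cvg_norm.
rewrite -(cvg_lim _ cn) //; apply: limr_le; first by apply/cvg_ex; exists `|h q|.
near=> n; apply: le_trans (aM n); apply: le_trans (ler_norm_box_sum _ _) _.
by apply: le_box_sum => i j; exact: abs_coef_at_point_le.
Unshelve. all: by end_near. Qed.

Lemma expands_shrink a rho rho' M h p : 0 < rho' -> rho' <= rho ->
  expands a rho M h p -> expands a rho' M h p.
Proof.
move=> r0 rr [_ aM ah]; split=> //.
  move=> n; apply: le_trans (aM n); apply: le_box_sum => i j.
  rewrite /at_point /abs_coef; apply: ler_pM; rewrite ?mulr_ge0 ?exprn_ge0 ?(ltW r0) //.
    by rewrite ler_wpM2l // lerXn2r ?nnegrE ?(le_trans _ rr) ?(ltW r0).
  by rewrite lerXn2r ?nnegrE ?(le_trans _ rr) ?(ltW r0).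
by move=> q q1 q2; apply: ah; apply: le_trans rr.
Qed.

Lemma expands_ext a rho M h k p :
  (forall q, `|q.1 - p.1| <= rho -> `|q.2 - p.2| <= rho -> h q = k q) ->
  expands a rho M h p -> expands a rho M k p.
Proof.
by move=> hk [r0 aM ah]; split=> // q q1 q2; rewrite -hk //; apply: ah.
Qed.

Lemma box_sumD a b n :
  box_sum (fun i j => a i j + b i j) n = box_sum a n + box_sum b n.
Proof.
by rewrite /box_sum -big_split; apply: eq_bigr => i _; rewrite big_split.
Qed.

Lemma expandsD a b rho M N h k p :
  expands a rho M h p -> expands b rho N k p ->
  expands (fun i j => a i j + b i j) rho (M + N) (fun q => h q + k q) p.
Proof.
move=> [r0 aM ah] [_ bN bk]; split=> //.
  move=> n; apply: le_trans (lerD (aM n) (bN n)); rewrite -box_sumD.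
  apply: le_box_sum => i j; rewrite /at_point /abs_coef -!mulrDl.
  by rewrite !ler_wpM2r ?exprn_ge0 ?(ltW r0) // ler_normD.
move=> q q1 q2.
rewrite [X in X @ _ --> _](_ : _ = (fun n =>
   box_sum (at_point a (q.1 - p.1) (q.2 - p.2)) n +
   box_sum (at_point b (q.1 - p.1) (q.2 - p.2)) n)); last first.
  apply/funext => n; rewrite -box_sumD; congr box_sum.
  by apply/funext => i; apply/funext => j; rewrite /at_point !mulrDl.
by apply: cvgD; [exact: ah|exact: bk].
Qed.

Lemma at_point_prod_fun a b (x y : R) :
  at_point (cauchy_prod a b) x y = cauchy_prod (at_point a x y) (at_point b x y).
Proof. by apply/funext => i; apply/funext => j; rewrite at_point_prod. Qed.

Lemma abs_coef_prod_le a b i j :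
  abs_coef (cauchy_prod a b) i j <= cauchy_prod (abs_coef a) (abs_coef b) i j.
Proof.
apply: le_trans (ler_norm_sum _ _ _) _; apply: ler_sum => k _.
apply: le_trans (ler_norm_sum _ _ _) _; apply: ler_sum => l _.
by rewrite normrM.
Qed.

(** The weighted norm is submultiplicative because the weights are. *)
Lemma expandsM a b rho M N h k p :
  expands a rho M h p -> expands b rho N k p ->
  expands (cauchy_prod a b) rho (M * N) (fun q => h q * k q) p.
Proof.
move=> [r0 aM ah] [_ bN bk].
have pos c i j : 0 <= at_point (abs_coef c) rho rho i j.
  by rewrite /at_point /abs_coef !mulr_ge0 ?exprn_ge0 ?(ltW r0).
split=> //.
  move=> n; apply: (@le_trans _ _
    (box_sum (at_point (cauchy_prod (abs_coef a) (abs_coef b)) rho rho) n)).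
    apply: le_box_sum => i j; rewrite /at_point.
    by rewrite !ler_wpM2r ?exprn_ge0 ?(ltW r0) ?abs_coef_prod_le.
  rewrite at_point_prod_fun; apply: le_trans (box_sum_prod_le _ _ _) _ => //.
  by apply: ler_pM; rewrite ?aM ?bN // /box_sum;
    apply: sumr_ge0 => i _; apply: sumr_ge0.
move=> q q1 q2; rewrite at_point_prod_fun.
apply: (@cvg_box_sum_prod _ _ _ _ _ M N); last 2 first; [exact: ah|exact: bk|..].
  move=> n; apply: le_trans (aM n); apply: le_box_sum => i j.
  exact: abs_coef_at_point_le.
move=> n; apply: le_trans (bN n); apply: le_box_sum => i j.
exact: abs_coef_at_point_le.
Qed.

Definition monomial (v : R) (m n i j : nat) : R := v *+ ((i == m) && (j == n)).

Lemma box_sum_monomial v m n N : (m < N)%N -> (n < N)%N ->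
  box_sum (monomial v m n) N = v.
Proof.
move=> mN nN; rewrite /box_sum (bigD1 (Ordinal mN)) //= [X in _ + X]big1 ?addr0.
  rewrite (bigD1 (Ordinal nN)) //= big1 ?addr0 /monomial ?eqxx //.
  by move=> j /negbTE jn; rewrite -val_eqE /= in jn; rewrite jn andbF.
move=> i /negbTE im; rewrite -val_eqE /= in im.
by apply: big1 => j _; rewrite /monomial im.
Qed.

Lemma at_point_monomial v m n (x y : R) :
  at_point (monomial v m n) x y = monomial (v * x ^+ m * y ^+ n) m n.
Proof.
apply/funext => i; apply/funext => j; rewrite /at_point /monomial.
case: (eqVneq i m) => [->|_]; last by rewrite !mul0r.
by case: (eqVneq j n) => [->|_]; rewrite ?mul0r.
Qed.

Lemma abs_coef_monomial v m n : abs_coef (monomial v m n) = monomial `|v| m n.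
Proof.
apply/funext => i; apply/funext => j; rewrite /abs_coef /monomial.
by case: (_ && _); rewrite ?mulr1n ?mulr0n ?normr0.
Qed.

Lemma expands_monomial v m n rho p : 0 < rho ->
  expands (monomial v m n) rho (`|v| * rho ^+ m * rho ^+ n)
    (fun q => v * (q.1 - p.1) ^+ m * (q.2 - p.2) ^+ n) p.
Proof.
move=> r0; split=> //.
  move=> N; rewrite abs_coef_monomial at_point_monomial; set V := (_ * _).
  have V0 i j : 0 <= monomial V m n i j.
    by rewrite mulrn_wge0 // !mulr_ge0 ?exprn_ge0 // ltW.
  apply: le_trans (box_sum_monotone V0 (leq_addr (maxn m n).+1 N)) _.
  by rewrite box_sum_monomial // ltn_addl // ltnS ?leq_maxl ?leq_maxr.
move=> q _ _; rewrite at_point_monomial; apply: cvg_near_cst.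
exists (maxn m n).+1 => // N /= mN.
by rewrite box_sum_monomial // (leq_trans _ mN) // ltnS ?leq_maxl ?leq_maxr.
Qed.

Definition cst_coef (v : R) := monomial v 0 0.

Lemma expands_cst c rho p : 0 < rho ->
  expands (cst_coef c) rho `|c| (fun=> c) p.
Proof.
move=> r0; have := expands_monomial c 0 0 p r0; rewrite !mulr1.
by apply: expands_ext => q _ _; rewrite !mulr1.
Qed.

Lemma germ_cst c p : germ (fun=> c) p.
Proof. by exists (cst_coef c), 1, `|c|; apply: expands_cst. Qed.

Lemma germ2 h k p : germ h p -> germ k p -> exists a b rho M N,
  expands a rho M h p /\ expands b rho N k p.
Proof.
move=> [a [r [M ea]]] [b [s [N eb]]]; exists a, b, (Num.min r s), M, N.
have [r0 _ _] := ea; have [s0 _ _] := eb.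
by split; [apply: expands_shrink ea|apply: expands_shrink eb];
  rewrite ?lt_min ?r0 ?s0 ?ge_min ?lexx ?orbT.
Qed.

Lemma germD h k p : germ h p -> germ k p -> germ (fun q => h q + k q) p.
Proof.
move=> gh gk; have [a [b [rho [M [N [ea eb]]]]]] := germ2 gh gk.
by exists (fun i j => a i j + b i j), rho, (M + N); apply: expandsD.
Qed.

Lemma germM h k p : germ h p -> germ k p -> germ (fun q => h q * k q) p.
Proof.
move=> gh gk; have [a [b [rho [M [N [ea eb]]]]]] := germ2 gh gk.
by exists (cauchy_prod a b), rho, (M * N); apply: expandsM.
Qed.

Lemma germ_ext h k p : (forall q, h q = k q) -> germ h p -> germ k p.
Proof. by move=> /funext ->. Qed.

Lemma germ_fst p : germ fst p.
Proof.
apply: (@germ_ext (fun q => 1 * (q.1 - p.1) ^+ 1 * (q.2 - p.2) ^+ 0 + p.1)).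
  by move=> q; rewrite mulr1 mul1r subrK.
apply: germD (germ_cst _ _); do 3 eexists; exact: (expands_monomial _ _ _ _ ltr01).
Qed.

Lemma germ_snd p : germ snd p.
Proof.
apply: (@germ_ext (fun q => 1 * (q.1 - p.1) ^+ 0 * (q.2 - p.2) ^+ 1 + p.2)).
  by move=> q; rewrite mulr1 mul1r subrK.
apply: germD (germ_cst _ _); do 3 eexists; exact: (expands_monomial _ _ _ _ ltr01).
Qed.

Lemma expands_center a rho M h p : expands a rho M h p -> a 0%N 0%N = h p.
Proof.
move=> [r0 _ /(_ p)]; rewrite !subrr normr0 (ltW r0) => /(_ isT isT) ch.
suff c0 : box_sum (at_point a 0 0) @ \oo --> a 0%N 0%N.
  by rewrite -(cvg_lim _ ch) // -(cvg_lim _ c0).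
have -> : at_point a 0 0 = monomial (a 0%N 0%N) 0 0.
  apply/funext => i; apply/funext => j; rewrite /at_point /monomial.
  by case: i j => [|i] [|j]; rewrite /= ?expr0 ?expr0n ?mulr1 ?mulr0 ?mul0r ?mulr1n.
by apply: cvg_near_cst; exists 1%N => // N /= N0; rewrite box_sum_monomial.
Qed.

(** Every monomial of positive degree gains a factor theta on the smaller square.
    This makes a series without constant term fit into the disc of convergence
    of another one. *)
Lemma expands_small a rho M h p (theta : R) : a 0%N 0%N = 0 ->
  0 < theta -> theta <= 1 -> expands a rho M h p ->
  expands a (theta * rho) (theta * M) h p.
Proof.
move=> a00 t0 t1 ea; have [r0 aM _] := ea.
have tr : 0 < theta * rho by rewrite mulr_gt0.
have tr' : theta * rho <= rho by rewrite ler_piMl // ltW.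
have [_ _ ah] := expands_shrink tr tr' ea.
split=> //.
move=> n; apply: le_trans (ler_wpM2l (ltW t0) (aM n)).
rewrite /box_sum mulr_sumr; apply: ler_sum => i _.
rewrite mulr_sumr; apply: ler_sum => j _.
rewrite /at_point /abs_coef.
have [/andP[/eqP -> /eqP ->]|ij] := boolP (((i : nat) == 0%N) && ((j : nat) == 0%N)).
  by rewrite a00 normr0 !mul0r mulr0.
rewrite !exprMn.
have -> : `|a i j| * (theta ^+ i * rho ^+ i) * (theta ^+ j * rho ^+ j) =
  theta ^+ (i + j) * (`|a i j| * rho ^+ i * rho ^+ j).
  by rewrite exprD; ring.
rewrite ler_wpM2r ?mulr_ge0 ?exprn_ge0 ?(ltW r0) //.
move: ij; rewrite -addn_eq0; case: (i + j)%N => [|m] // _.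
by rewrite exprS ler_piMr ?(ltW t0) // exprn_ile1 // ltW.
Qed.

Lemma germ_centered h p : germ h p -> exists a rho M,
  a 0%N 0%N = 0 /\ expands a rho M (fun q => h q - h p) p.
Proof.
move=> [a [rho [M ea]]]; have [r0 _ _] := ea.
have eb := expandsD ea (expands_cst (- h p) p r0).
exists (fun i j => a i j + cst_coef (- h p) i j), rho, (M + `|- h p|).
by split; [rewrite (expands_center eb) subrr|exact: eb].
Qed.

Lemma expands_ge0 a rho M h p : expands a rho M h p -> 0 <= M.
Proof. by move=> [_ /(_ 0%N) + _]; rewrite /box_sum big_ord0. Qed.

Lemma germ_continuous h p : germ h p -> {for p, continuous h}.
Proof.
move=> /germ_centered [a [rho [M [a00 ea]]]].
have [r0 _ _] := ea; have M0 := expands_ge0 ea.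
apply/cvgrPdist_le => e e0.
pose t := Num.min 1 (e / (M + 1)).
have M1 : 0 < M + 1 by rewrite ltr_wpDl.
have t0 : 0 < t by rewrite lt_min ltr01 divr_gt0.
have t1 : t <= 1 by rewrite ge_min lexx.
have et := expands_small a00 t0 t1 ea.
have tr : 0 < t * rho by rewrite mulr_gt0.
have : \forall q \near p, ball p (t * rho) q by exact: nbhsx_ballx.
apply: filterS => q [/= /ltW q1 /ltW q2].
rewrite distrC; apply: le_trans (expands_bound et _ _) _.
- by rewrite distrC.
- by rewrite distrC.
have : t <= e / (M + 1) by rewrite ge_min lexx orbT.
rewrite ler_pdivlMr // mulrDr mulr1 => H; apply: le_trans H.
by rewrite lerDl ltW.
Qed.

(** A finite set of indices lies in a square, so all finite sums are bounded by
    the weighted norm. *)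
Lemma germ_analytic h p : germ h p -> analytic_at h p.
Proof.
move=> [a [rho [M [r0 aM ah]]]]; exists a, rho; split=> // q q1 q2; split; last first.
  exact: (ah q (ltW q1) (ltW q2)).
apply: (@le_lt_trans _ _ M%:E); last exact: ltry.
rewrite /esum; apply: ub_ereal_sup => _ [A [finA _] <-].
pose b := at_point (abs_coef a) rho rho.
have b0 i j : 0 <= b i j.
  by rewrite /b /at_point /abs_coef !mulr_ge0 ?exprn_ge0 ?(ltW r0).
have [n An] : exists n, forall k : nat * nat, A k -> (k.1 < n)%N /\ (k.2 < n)%N.
  exists (\max_(k <- fset_set A) (maxn k.1 k.2)).+1 => k Ak.
  have : (maxn k.1 k.2 <= \max_(k <- fset_set A) maxn k.1 k.2)%N.
    apply: leq_bigmax_seq => //; rewrite in_fset_set //; exact/mem_set.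
  by rewrite geq_max !ltnS => /andP.
apply: (@le_trans _ _ (box_sum b n)%:E); last by rewrite lee_fin.
rewrite fsbig_finite //=.
apply: (@le_trans _ _ (\sum_(k <- fset_set A) (b k.1 k.2)%:E)%E).
  apply: lee_sum => k _; rewrite lee_fin.
  exact: (@abs_coef_at_point_le a _ _ _ k.1 k.2 (ltW q1) (ltW q2)).
rewrite sumEFin lee_fin.
have -> : box_sum b n = \sum_(k <- [seq (i, j) | i <- iota 0 n, j <- iota 0 n])
   b k.1 k.2.
  rewrite big_allpairs /box_sum -(big_mkord xpredT (fun i => \sum_(j < n) b i j)).
  rewrite /index_iota subn0; apply: eq_bigr => i _.
  by rewrite -(big_mkord xpredT (b i)) /index_iota subn0.
set S := [seq _ | _ <- _, _ <- _].
have uS : uniq S by rewrite allpairs_uniq ?iota_uniq // => -[? ?] [? ?].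
have pS : perm_eq (fset_set A) [seq k <- S | k \in fset_set A].
  apply: uniq_perm; rewrite ?filter_uniq // => k; rewrite mem_filter.
  case: (boolP (k \in fset_set A)) => //= kA; apply/esym.
  have [k1 k2] : (k.1 < n)%N /\ (k.2 < n)%N.
    by apply: An; move: kA; rewrite in_fset_set // => /set_mem.
  by apply/allpairsP; exists k; split; rewrite ?mem_iota //; case: (k).
rewrite (perm_big _ pS) big_filter big_mkcond; apply: ler_sum => k _.
by case: ifP.
Qed.

End Germs.

(** * Substitution and integration of power series *)

Section Composition.
Context {R : realType}.
Implicit Types (a b : nat -> nat -> R) (h k : plane R -> R) (p q : plane R).
Implicit Types (phi psi : R -> R) (c : nat -> R).

Definition power_series_at phi (z0 : R) := exists c (s C : R),
  [/\ 0 < s, forall N, \sum_(n < N) `|c n| * s ^+ n <= C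
    & forall z, `|z| <= s ->
        (fun N : nat => \sum_(n < N) c n * z ^+ n) @ \oo --> phi (z0 + z)].

Lemma cvg_ord_sum (u : nat -> nat -> R) (v : nat -> R) N :
  (forall n, u n @ \oo --> v n) ->
  (fun m => \sum_(n < N) u n m) @ \oo --> \sum_(n < N) v n.
Proof.
move=> uv; elim: N => [|N IH].
  rewrite big_ord0 (_ : (fun m => _) = fun=> 0); first exact: cvg_cst.
  by apply/funext => m; rewrite big_ord0.
rewrite big_ord_recr (_ : (fun m => _) =
  (fun m => \sum_(n < N) u n m + u N m)); first exact: cvgD.
by apply/funext => m; rewrite big_ord_recr.
Qed.

(** Tannery's theorem; the range of summation grows with m because only the
    coefficients of index below 2 m of a substituted series matter in the square
    of side m. *)
Lemma cvg_dominated_sum (u : nat -> nat -> R) (v w : nat -> R) (C V : R) :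
  (forall n, u n @ \oo --> v n) -> (forall n m, `|u n m| <= w n) ->
  (forall N, \sum_(n < N) w n <= C) ->
  (fun N : nat => \sum_(n < N) v n) @ \oo --> V ->
  (fun m : nat => \sum_(n < m + m) u n m) @ \oo --> V.
Proof.
move=> uv uw wC vV.
have w0 n : 0 <= w n by apply: le_trans (uw n 0%N).
have [W [cW leW]] := nondecreasing_bounded_cvg
  (fun m n mn => sum_ord_monotone w0 mn) wC.
apply/cvgrPdist_le => e e0.
have e3 : 0 < e / 3 by rewrite divr_gt0.
have [N [NV NW]] : exists N : nat, `|V - \sum_(n < N) v n| <= e / 3 /\
    `|W - \sum_(n < N) w n| <= e / 3.
  have /cvgrPdist_le /(_ _ e3) H1 := vV; have /cvgrPdist_le /(_ _ e3) H2 := cW.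
  have [N _ HN] := filterI H1 H2.
  by exists N; apply: (HN N) => /=.
have cN : (fun m => \sum_(n < N) u n m) @ \oo --> \sum_(n < N) v n.
  by apply: cvg_ord_sum => n; exact: uv.
have /cvgrPdist_le /(_ _ e3) H := cN.
have : \forall m \near \oo, (N <= m)%N by exists N.
apply: filterS2 H => m Hm Nm.
have NM : (N <= m + m)%N by rewrite (leq_trans Nm) // leq_addr.
have -> : \sum_(n < m + m) u n m = \sum_(n < N) u n m +
   \sum_(i < m + m - N) u (N + i)%N m.
  rewrite -(big_mkord xpredT (fun n => u n m)) (big_cat_nat (leq0n _) NM) //= big_mkord.
  congr (_ + _); rewrite -{1}[N]add0n big_addn big_mkord.
  by apply: eq_bigr => i _; rewrite addnC.
have T : `|\sum_(i < m + m - N) u (N + i)%N m| <= e / 3.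
  apply: le_trans (ler_norm_sum _ _ _) _.
  apply: (@le_trans _ _ (\sum_(i < m + m - N) w (N + i)%N)).
    by apply: ler_sum => i _; exact: uw.
  apply: le_trans NW; apply: le_trans (ler_norm _).
  rewrite lerBrDr; apply: le_trans (leW (m + m)%N).
  rewrite -!(big_mkord xpredT w) [X in _ <= X](big_cat_nat (leq0n _) NM) //=.
  rewrite [X in X <= _]addrC lerD2l -[X in \sum_(X <= _ < _) _]add0n big_addn big_mkord.
  by apply: ler_sum => i _; rewrite addnC.
set A := \sum_(n < N) u n m in Hm *; set B := \sum_(i < _) _ in T *.
have -> : V - (A + B) = (V - \sum_(n < N) v n) + ((\sum_(n < N) v n - A) - B).
  ring.
apply: le_trans (ler_normD _ _) _.
have -> : e = e / 3 + (e / 3 + e / 3) by field.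
by apply: lerD => //; apply: le_trans (ler_normB _ _) _; apply: lerD.
Qed.

Definition cauchy_pow a n := iter n (cauchy_prod a) (cst_coef 1).

(** Each coefficient of phi(h) therefore receives contributions from finitely
    many powers of h. *)
Lemma cauchy_pow_vanish a n i j : a 0%N 0%N = 0 -> (i + j < n)%N ->
  cauchy_pow a n i j = 0.
Proof.
move=> a00; elim: n i j => // n IH i j ij /=.
rewrite /cauchy_prod big1 // => k _; rewrite big1 // => l _.
case: (posnP (k + l)) => [/eqP|kl].
  by rewrite addn_eq0 => /andP[/eqP -> /eqP ->]; rewrite a00 mul0r.
rewrite IH ?mulr0 //.
have ki : (k <= i)%N by rewrite -ltnS.
have lj : (l <= j)%N by rewrite -ltnS.
by lia.
Qed.

Lemma expands_pow a rho M h p n : expands a rho M h p ->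
  expands (cauchy_pow a n) rho (M ^+ n) (fun q => h q ^+ n) p.
Proof.
move=> ea; have [r0 _ _] := ea; elim: n => [|n IH].
  by have := expands_cst 1 p r0; rewrite normr1.
have := expandsM ea IH; rewrite exprS.
by apply: expands_ext => q _ _; rewrite exprS.
Qed.

(** After subtracting its constant term and shrinking the square, h has a
    weighted norm M at most the radius s of phi.  Then the n-th power of h has norm
    at most M ^ n, the sum of the c_n h ^ n converges absolutely in the weighted
    norm, and summation may be exchanged. *)
Lemma germ_comp phi h p : germ h p -> power_series_at phi (h p) ->
  germ (phi \o h) p.
Proof.
move=> gh [c [s [C [s0 cC cphi]]]].
have [a [rho0 [M0 [a00 ea0]]]] := germ_centered gh.
have M0p := expands_ge0 ea0.
have M1 : 0 < M0 + 1 by rewrite ltr_wpDl.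
pose t := Num.min 1 (s / (M0 + 1)).
have t0 : 0 < t by rewrite lt_min ltr01 divr_gt0.
have t1 : t <= 1 by rewrite ge_min lexx.
have := expands_small a00 t0 t1 ea0.
set rho := t * rho0; set M := t * M0 => ea.
have Ms : M <= s.
  have : t <= s / (M0 + 1) by rewrite ge_min lexx orbT.
  rewrite ler_pdivlMr // mulrDr mulr1; apply: le_trans.
  by rewrite lerDl ltW.
have Mp : 0 <= M := expands_ge0 ea.
have [r0 _ _] := ea.
pose e i j := \sum_(n < (i + j).+1) c n * cauchy_pow a n i j.
have eE m i j : (i < m)%N -> (j < m)%N ->
    e i j = \sum_(n < m + m) c n * cauchy_pow a n i j.
  move=> im jm; have ijm : ((i + j).+1 <= m + m)%N by lia.
  rewrite /e -(big_mkord xpredT (fun n => c n * cauchy_pow a n i j)).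
  rewrite -(big_mkord xpredT (fun n => c n * cauchy_pow a n i j)).
  rewrite [RHS](big_cat_nat (leq0n _) ijm) //= [X in _ = _ + X]big_nat_cond.
  rewrite [X in _ = _ + X]big1 ?addr0 // => n /andP[/andP[n1 _] _].
  by rewrite cauchy_pow_vanish ?mulr0.
have boxE (x y : R) m : box_sum (at_point e x y) m =
    \sum_(n < m + m) c n * box_sum (at_point (cauchy_pow a n) x y) m.
  rewrite /box_sum; under [RHS]eq_bigr do rewrite mulr_sumr.
  rewrite [RHS]exchange_big /=; apply: eq_bigr => i _.
  under [RHS]eq_bigr do rewrite mulr_sumr.
  rewrite [RHS]exchange_big /=; apply: eq_bigr => j _.
  rewrite /at_point (@eE m) // !mulr_suml; apply: eq_bigr => n _.
  by rewrite !mulrA.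
have cM N : \sum_(n < N) `|c n| * M ^+ n <= C.
  apply: le_trans (cC N); apply: ler_sum => n _.
  by rewrite ler_wpM2l // lerXn2r ?nnegrE // ltW.
exists e, rho, C; split=> //.
  move=> m; apply: le_trans (cM (m + m)%N).
  apply: (@le_trans _ _ (\sum_(n < m + m)
      `|c n| * box_sum (at_point (abs_coef (cauchy_pow a n)) rho rho) m)).
    rewrite /box_sum; under [X in _ <= X]eq_bigr do rewrite mulr_sumr.
    rewrite [X in _ <= X]exchange_big /=; apply: ler_sum => i _.
    under [X in _ <= X]eq_bigr do rewrite mulr_sumr.
    rewrite [X in _ <= X]exchange_big /=; apply: ler_sum => j _.
    rewrite /at_point /abs_coef (@eE m) //.
    under [X in _ <= X]eq_bigr do rewrite !mulrA -normrM.
    rewrite -!mulr_suml !ler_wpM2r ?exprn_ge0 ?(ltW r0) //.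
    exact: ler_norm_sum.
  apply: ler_sum => n _; rewrite ler_wpM2l //.
  by have [_ + _] := expands_pow n ea.
move=> q q1 q2.
have hM : `|h q - h p| <= M := expands_bound ea q1 q2.
rewrite (_ : phi \o h = fun q => phi (h p + (h q - h p))); last first.
  by apply/funext => z /=; rewrite subrKC.
have cV := cphi _ (le_trans hM Ms).
rewrite (_ : box_sum _ = fun m => \sum_(n < m + m)
   c n * box_sum (at_point (cauchy_pow a n) (q.1 - p.1) (q.2 - p.2)) m); last first.
  by apply/funext => m; rewrite boxE.
apply: (@cvg_dominated_sum
  (fun n m => c n * box_sum (at_point (cauchy_pow a n) (q.1 - p.1) (q.2 - p.2)) m)
  (fun n => c n * (h q - h p) ^+ n)
  (fun n => `|c n| * M ^+ n) C) => //.
  move=> n; apply: cvgM; first exact: cvg_cst.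
  by have [_ _] := expands_pow n ea; apply.
move=> n m; rewrite normrM ler_wpM2l //.
have [_ H _] := expands_pow n ea; apply: le_trans (H m).
apply: le_trans (ler_norm_box_sum _ _) _.
by apply: le_box_sum => i j; exact: abs_coef_at_point_le.
Qed.

(** A function of one variable is analytic if it is so as a function on the
    plane; the closure properties of germs become available in one variable. *)
Lemma germ_power_series phi p : germ (phi \o fst) p ->
  power_series_at phi p.1.
Proof.
move=> [a [rho [M [r0 aM ah]]]]; exists (fun i => a i 0%N), rho, M; split=> //.
  move=> N; apply: le_trans (aM N).
  case: N => [|N]; first by rewrite /box_sum !big_ord0.
  apply: ler_sum => i _; rewrite big_ord_recl /at_point /abs_coef /= expr0 mulr1.
  by rewrite lerDl sumr_ge0 // => j _; rewrite !mulr_ge0 ?exprn_ge0 ?(ltW r0).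
move=> z zr; have := ah (p.1 + z, p.2); rewrite /= subrr addrC addKr normr0.
move=> /(_ zr (ltW r0)); rewrite addrC.
rewrite (_ : box_sum _ = (fun N : nat => \sum_(n < N) a n 0%N * z ^+ n)) //.
apply/funext => -[|N]; rewrite /box_sum; first by rewrite !big_ord0.
apply: eq_bigr => i _; rewrite big_ord_recl /at_point /= expr0 mulr1 big1 ?addr0 //.
by move=> j _; rewrite expr0n /= mulr0.
Qed.

Lemma norm_increment_le (F dF : R -> R) (z0 z B : R) :
  (forall t, `|t - z0| <= `|z| -> is_derive t (1 : R) F (dF t)) ->
  (forall t, `|t - z0| <= `|z| -> `|dF t| <= B) ->
  `|F (z0 + z) - F z0| <= B * `|z|.
Proof.
move=> dFP dFB.
have [z_ge0|z_lt0] := leP 0 z.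
  have zz : z0 <= z0 + z by rewrite lerDl.
  have inz t : t \in `[z0, z0 + z] -> `|t - z0| <= `|z|.
    rewrite in_itv /= => /andP[t1 t2].
    by rewrite !ger0_norm // ?subr_ge0 // lerBlDl.
  have [t| |t tz ->] := @MVT_segment _ F dF z0 (z0 + z) zz.
  - by move=> /subset_itv_oo_cc /inz; exact: dFP.
  - by apply: derivable_within_continuous => t /inz /dFP [].
  - by rewrite addrC addKr normrM ler_wpM2r // dFB // inz.
have zz : z0 + z <= z0 by rewrite gerDl ltW.
have inz t : t \in `[z0 + z, z0] -> `|t - z0| <= `|z|.
  rewrite in_itv /= => /andP[t1 t2].
  by rewrite !ler0_norm ?(ltW z_lt0) ?subr_le0 // lerN2 lerBrDl.
have [t| |t tz E] := @MVT_segment _ F dF (z0 + z) z0 zz.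
- by move=> /subset_itv_oo_cc /inz; exact: dFP.
- by apply: derivable_within_continuous => t /inz /dFP [].
- rewrite distrC E opprD addrA subrr add0r normrM normrN.
  by rewrite ler_wpM2r // dFB // inz.
Qed.

Section PointwiseDerivatives.
Variables (f g : R -> R) (x a b : R).
Hypotheses (df : is_derive x (1 : R) f a) (dg : is_derive x (1 : R) g b).

Lemma is_derive_add : is_derive x (1 : R) (fun t => f t + g t) (a + b).
Proof. exact: is_deriveD. Qed.

Lemma is_derive_sub : is_derive x (1 : R) (fun t => f t - g t) (a - b).
Proof. exact: is_deriveB. Qed.

Lemma is_derive_mul :
  is_derive x (1 : R) (fun t => f t * g t) (f x * b + g x * a).
Proof. exact: is_deriveM. Qed.

Lemma is_derive_inv : f x != 0 ->
  is_derive x (1 : R) (fun t => (f t)^-1) (- (f x) ^- 2 * a).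
Proof. by move=> fx; exact: is_deriveV. Qed.

End PointwiseDerivatives.

Lemma is_derive_const (x k : R) : is_derive x (1 : R) (fun=> k) 0.
Proof. exact: is_derive_cst. Qed.

Lemma is_derive_idfun (x : R) : is_derive x (1 : R) (fun t => t) 1.
Proof. exact: is_derive_id. Qed.

Lemma is_derive_power (z0 t : R) n :
  is_derive t (1 : R) (fun t => (t - z0) ^+ n.+1) (n.+1%:R * (t - z0) ^+ n).
Proof.
have d1 : is_derive t (1 : R) (fun t => t - z0) 1.
  have := is_derive_sub (is_derive_idfun t) (is_derive_const t z0).
  by rewrite subr0.
elim: n => [|n IH].
  by rewrite mul1r expr0 (_ : (fun t => _) = (fun t => t - z0)).
rewrite (_ : (fun t => _) = (fun t => (t - z0) * (t - z0) ^+ n.+1)); last first.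
  by apply/funext => x; rewrite exprS.
have := is_derive_mul d1 IH; rewrite mulr1.
by congr is_derive; rewrite exprS -(natr1 n.+1); ring.
Qed.

Lemma is_derive_power_sum (z0 t : R) (d : nat -> R) N :
  is_derive t (1 : R) (fun t => \sum_(n < N) d n * (t - z0) ^+ n.+1)
    (\sum_(n < N) d n * (n.+1%:R * (t - z0) ^+ n)).
Proof.
elim: N => [|N IH].
  rewrite big_ord0 (_ : (fun t => _) = fun=> 0); first exact: is_derive_cst.
  by apply/funext => x; rewrite big_ord0.
rewrite big_ord_recr (_ : (fun t => _) = (fun t =>
   \sum_(n < N) d n * (t - z0) ^+ n.+1 + d N * (t - z0) ^+ N.+1)); last first.
  by apply/funext => x; rewrite big_ord_recr.
apply: is_derive_add => //.
have := is_derive_mul (is_derive_const t (d N)) (is_derive_power z0 t N).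
by rewrite mulr0 addr0.
Qed.

(** The error of the integrated partial sum vanishes at z0 and its derivative is
    bounded by a tail of the majorant, so the mean value theorem applies. *)
Lemma power_series_primitive phi psi (z0 d : R) : 0 < d ->
  (forall z, `|z - z0| < d -> is_derive z (1 : R) phi (psi z)) ->
  power_series_at psi z0 -> power_series_at phi z0.
Proof.
move=> d0 dphi [c [s0 [C [s00 cC0 cpsi0]]]].
pose s := Num.min s0 (d / 2).
have s_gt0 : 0 < s by rewrite lt_min s00 divr_gt0.
have ss0 : s <= s0 by rewrite ge_min lexx.
have sd : s < d.
  by rewrite (@le_lt_trans _ _ (d / 2)) ?ge_min ?lexx ?orbT // ltr_pdivrMr // ltr_pMr // ltr1n.
have cC N : \sum_(n < N) `|c n| * s ^+ n <= C.
  apply: le_trans (cC0 N); apply: ler_sum => n _.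
  by rewrite ler_wpM2l // lerXn2r ?nnegrE // ltW.
have cpsi z : `|z| <= s ->
    (fun N : nat => \sum_(n < N) c n * z ^+ n) @ \oo --> psi (z0 + z).
  by move=> zs; apply: cpsi0; apply: le_trans ss0.
pose w n := `|c n| * s ^+ n.
have w0 n : 0 <= w n by rewrite mulr_ge0 // exprn_ge0 // ltW.
have [W [cW leW]] := nondecreasing_bounded_cvg
  (fun m n mn => sum_ord_monotone w0 mn) cC.
have tail z N : `|z| <= s -> `|psi (z0 + z) - \sum_(n < N) c n * z ^+ n| <=
    W - \sum_(n < N) w n.
  move=> zs.
  have H : (fun m : nat => `|\sum_(n < m) c n * z ^+ n - \sum_(n < N) c n * z ^+ n|)
     @ \oo --> `|psi (z0 + z) - \sum_(n < N) c n * z ^+ n|.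
    by apply: cvg_norm; apply: cvgB; [exact: cpsi|exact: cvg_cst].
  rewrite -(cvg_lim _ H) //; apply: limr_le; first by apply/cvg_ex; eexists; exact: H.
  have : \forall m \near \oo, (N <= m)%N by exists N.
  apply: filterS => m Nm.
  rewrite -(big_mkord xpredT (fun n => c n * z ^+ n)).
  rewrite -(big_mkord xpredT (fun n => c n * z ^+ n)) (big_cat_nat (leq0n _) Nm) //=.
  rewrite addrAC subrr add0r.
  apply: le_trans (ler_norm_sum _ _ _) _.
  rewrite lerBrDr; apply: le_trans (leW m).
  rewrite -!(big_mkord xpredT w) [X in _ <= X](big_cat_nat (leq0n _) Nm) //=.
  rewrite [X in X <= _]addrC lerD2l.
  apply: ler_sum => n _; rewrite /w normrM normrX ler_wpM2l //.
  by rewrite lerXn2r ?nnegrE // ltW.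
pose b n := if n is m.+1 then c m / m.+1%:R else phi z0.
have bE N z : \sum_(n < N.+1) b n * z ^+ n =
    phi z0 + \sum_(n < N) c n / n.+1%:R * z ^+ n.+1.
  by rewrite big_ord_recl /= expr0 mulr1.
exists b, s, (`|phi z0| + C * s); split=> //.
  case=> [|N].
    rewrite big_ord0 addr_ge0 // mulr_ge0 ?(ltW s_gt0) //.
    by have := cC 0%N; rewrite big_ord0.
  rewrite big_ord_recl /= expr0 mulr1 lerD2l.
  apply: le_trans (ler_wpM2r (ltW s_gt0) (cC N)).
  rewrite mulr_suml; apply: ler_sum => n _.
  rewrite /bump /= add1n exprSr mulrA ler_wpM2r ?(ltW s_gt0) //.
  rewrite ler_wpM2r ?exprn_ge0 ?(ltW s_gt0) // normrM ler_piMr //.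
  by rewrite normfV ger0_norm // invf_le1 ?ltr0n // ler1n.
move=> z zs; rewrite -cvg_shiftS /=.
rewrite [X in X @ _ --> _](_ : _ = fun N : nat =>
  phi z0 + \sum_(n < N) c n / n.+1%:R * z ^+ n.+1); last first.
  by apply/funext => N; rewrite bE.
have E1 : (fun N : nat => (W - \sum_(n < N) w n) * s) @ \oo --> 0.
  have : (fun N : nat => (W - \sum_(n < N) w n) * s) @ \oo --> (W - W) * s.
    by apply: cvgM; [apply: cvgB => //; exact: cvg_cst|exact: cvg_cst].
  by rewrite subrr mul0r.
apply/subr_cvg0; apply/norm_cvg0P.
apply: squeeze_cvgr E1; last exact: cvg_cst.
apply: nearW => N; rewrite normr_ge0 /= distrC.
pose F := fun t => phi t - \sum_(n < N) c n / n.+1%:R * (t - z0) ^+ n.+1.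
pose dF := fun t => psi t - \sum_(n < N) c n * (t - z0) ^+ n.
have F0 : F z0 = phi z0.
  by rewrite /F subrr big1 ?subr0 // => n _; rewrite expr0n mulr0.
have -> : phi (z0 + z) - (phi z0 + \sum_(n < N) c n / n.+1%:R * z ^+ n.+1) =
    F (z0 + z) - F z0.
  have zz : z0 + z - z0 = z by ring.
  by rewrite F0 /F zz; ring.
apply: le_trans (@norm_increment_le F dF z0 z (W - \sum_(n < N) w n) _ _) _.
- move=> t tz; apply: is_derive_sub.
    by apply: dphi; rewrite (le_lt_trans tz) // (le_lt_trans zs).
  apply: is_derive_eq; first exact: (@is_derive_power_sum z0 t (fun n => c n / n.+1%:R)).
  by apply: eq_bigr => n _; rewrite mulrA divfK.
- move=> t tz; rewrite /dF -{1}(subrKC z0 t).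
  exact: tail (le_trans tz zs).
by rewrite ler_wpM2l // subr_ge0 leW.
Qed.

End Composition.

(** * Elementary functions are analytic *)

Section ElementaryFunctions.
Context {R : realType}.

Lemma power_series_of_factorial_bound (c : nat -> R) (phi : R -> R) (z0 A : R) :
  (forall n, `|c n| <= A / n`!%:R) ->
  (forall z, (fun N : nat => \sum_(n < N) c n * z ^+ n) @ \oo --> phi (z0 + z)) ->
  power_series_at phi z0.
Proof.
move=> cA cphi.
have A0 : 0 <= A by have := le_trans (normr_ge0 _) (cA 0%N); rewrite fact0 divr1.
exists c, 1, (A * expR 1); split=> // N.
apply: (@le_trans _ _ (A * \sum_(n < N) exp_coeff 1 n)).
  rewrite mulr_sumr; apply: ler_sum => n _.
  by rewrite expr1n mulr1 exp_coeffE /= expr1n mulr1.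
rewrite ler_wpM2l //.
have := @nondecreasing_cvgn_le _ (series (exp_coeff (1 : R))) _
  (is_cvg_series_exp_coeff _) N.
rewrite /series /= big_mkord; apply.
apply/nondecreasing_seqP => n; rewrite /series /= big_nat_recr //= lerDl.
exact: exp_coeff_ge0.
Qed.

Lemma cvg_ord_series (u : nat -> R) (l : R) : series u @ \oo --> l ->
  (fun N : nat => \sum_(n < N) u n) @ \oo --> l.
Proof.
move=> ul; rewrite (_ : (fun N : nat => _) = series u) //.
by apply/funext => N; rewrite /series /= big_mkord.
Qed.

Lemma power_series_expR z0 : power_series_at (@expR R) z0.
Proof.
apply: (@power_series_of_factorial_bound (fun n => expR z0 * n`!%:R^-1) _ _ (expR z0)).
  by move=> n; rewrite ger0_norm // mulr_ge0 // expR_ge0.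
move=> z; rewrite expRD.
rewrite (_ : (fun N : nat => _) = fun N : nat => expR z0 *
   \sum_(n < N) exp_coeff z n); last first.
  apply/funext => N; rewrite mulr_sumr; apply: eq_bigr => n _.
  by rewrite exp_coeffE mulrA.
apply: cvgM; first exact: cvg_cst.
apply: cvg_ord_series; exact: is_cvg_series_exp_coeff.
Qed.

Definition sin_series (n : nat) : R := (odd n)%:R * (-1) ^+ n.-1./2 / n`!%:R.
Definition cos_series (n : nat) : R := (~~ odd n)%:R * (-1) ^+ n./2 / n`!%:R.

Lemma cvg_sin_series z :
  (fun N : nat => \sum_(n < N) sin_series n * z ^+ n) @ \oo --> sin z.
Proof.
have := @is_cvg_series_sin_coeff R z; rewrite -[X in X -> _]/(cvgn _).
rewrite sin_coeffE => /cvg_ord_series; rewrite sinE; apply.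
Qed.

Lemma cvg_cos_series z :
  (fun N : nat => \sum_(n < N) cos_series n * z ^+ n) @ \oo --> cos z.
Proof.
have := @is_cvg_series_cos_coeff R z; rewrite -[X in X -> _]/(cvgn _).
rewrite cos_coeffE => /cvg_ord_series; rewrite cosE; apply.
Qed.

Lemma sin_cos_series_bound n :
  `|sin_series n| <= 1 / n`!%:R /\ `|cos_series n| <= 1 / n`!%:R.
Proof.
have f0 : 0 <= (n`!%:R : R)^-1 by [].
split; rewrite normrM (ger0_norm f0) ler_wpM2r // normrM normrX normrN1 expr1n mulr1.
  by case: odd; rewrite ?normr1 ?normr0.
by case: odd; rewrite ?normr1 ?normr0.
Qed.

Lemma power_series_trig (a b z0 : R) (phi : R -> R) :
  (forall z, phi (z0 + z) = a * cos z + b * sin z) -> power_series_at phi z0.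
Proof.
move=> phiE.
apply: (@power_series_of_factorial_bound (fun n => a * cos_series n + b * sin_series n)
  _ _ (`|a| + `|b|)).
  move=> n; apply: le_trans (ler_normD _ _) _; rewrite mulrDl.
  have [s1 c1] := sin_cos_series_bound n; rewrite div1r in s1 c1.
  by apply: lerD; rewrite normrM ler_wpM2l.
move=> z; rewrite phiE.
rewrite (_ : (fun N : nat => _) = fun N : nat =>
  a * (\sum_(n < N) cos_series n * z ^+ n) +
  b * (\sum_(n < N) sin_series n * z ^+ n)); last first.
  apply/funext => N; rewrite !mulr_sumr -big_split; apply: eq_bigr => n _ /=.
  by rewrite mulrDl !mulrA.
by apply: cvgD; (apply: cvgM; first exact: cvg_cst);
  [exact: cvg_cos_series|exact: cvg_sin_series].
Qed.

Lemma power_series_sin z0 : power_series_at (@sin R) z0.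
Proof.
by apply: (@power_series_trig (sin z0) (cos z0)) => z; rewrite sinD.
Qed.

Lemma power_series_cos z0 : power_series_at (@cos R) z0.
Proof.
apply: (@power_series_trig (cos z0) (- sin z0)) => z.
by rewrite cosD mulNr.
Qed.

Lemma power_series_inv (z0 : R) : z0 != 0 -> power_series_at (@GRing.inv R) z0.
Proof.
move=> z00; have n0 : 0 < `|z0| by rewrite normr_gt0.
exists (fun n => z0^-1 * (- z0^-1) ^+ n), (`|z0| / 2), (2 / `|z0|); split.
- by rewrite divr_gt0.
- move=> N; rewrite (eq_bigr (fun n : 'I_N => `|z0|^-1 * (2^-1) ^+ n)); last first.
    move=> n _; rewrite normrM normrX normrN !normfV -mulrA -exprMn mulrA.
    by rewrite mulVf ?normr_eq0 // mul1r.
  rewrite -mulr_sumr mulrC ler_wpM2r ?invr_ge0 //.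
  suff -> : \sum_(n < N) (2^-1 : R) ^+ n = 2 - 2 * 2^-1 ^+ N.
    by rewrite gerDl oppr_le0 mulr_ge0 // exprn_ge0.
  elim: N => [|N IH]; first by rewrite big_ord0 expr0 mulr1 subrr.
  by rewrite big_ord_recr /= IH exprS; field.
move=> z zs.
have lt1 : `|- (z / z0)| < 1.
  rewrite normrN normrM normfV ltr_pdivrMr // mul1r.
  by rewrite (le_lt_trans zs) // ltr_pdivrMr // ltr_pMr // ltr1n.
have := @cvg_geometric_series R z0^-1 _ lt1.
have -> : z0^-1 / (1 - - (z / z0)) = (z0 + z)^-1.
  rewrite opprK.
  have -> : z0 + z = z0 * (1 + z / z0) by rewrite mulrDr mulr1 mulrCA divff // mulr1.
  by rewrite invfM.
move=> /cvg_ord_series cg; rewrite [X in X @ _ --> _](_ : _ = fun N : nat =>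
  \sum_(n < N) geometric z0^-1 (- (z / z0)) n) //.
apply/funext => N; apply: eq_bigr => n _ /=.
by rewrite -mulrA -exprMn mulNr [z0^-1 * z]mulrC.
Qed.

Lemma power_series_ln (z0 : R) : 0 < z0 -> power_series_at (@ln R) z0.
Proof.
move=> z00.
apply: (@power_series_primitive _ _ GRing.inv z0 z0 z00); last first.
  by apply: power_series_inv; rewrite gt_eqF.
move=> z zz; apply: is_derive1_ln.
by move: zz; rewrite ltr_norml => /andP[+ _]; rewrite ltrBrDr addNr.
Qed.

Lemma power_series_atan (z0 : R) : power_series_at (@atan R) z0.
Proof.
apply: (@power_series_primitive _ _ (fun x => (1 + x ^+ 2)^-1) z0 1) => //.
apply: (@germ_power_series _ _ (z0, 0)).
apply: (@germ_comp _ _ (fun q : plane R => 1 + q.1 ^+ 2)) => //=.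
  apply: germD; first exact: germ_cst.
  by apply: germM; exact: germ_fst.
by apply: power_series_inv; rewrite gt_eqF // ltr_wpDr // sqr_ge0.
Qed.

End ElementaryFunctions.

Section AnalyticNear.
Context {R : realType}.
Implicit Types (h k : plane R -> R) (p q : plane R).

(** Quantifying over all points near p makes this a property at a single point
    that still yields analyticity on a neighbourhood, as is required of a
    diffeomorphism. *)
Definition analytic_near h p := \forall q \near p, germ h q.

Lemma an_germ h p : analytic_near h p -> germ h p.
Proof. by move=> /nbhs_singleton. Qed.

Lemma an_continuous h p : analytic_near h p -> {for p, continuous h}.
Proof. by move=> /an_germ; exact: germ_continuous. Qed.

Lemma an_cst (c : R) p : analytic_near (fun=> c) p.
Proof. by near=> q; exact: germ_cst. Unshelve. all: by end_near. Qed.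

Lemma an_fst p : analytic_near (fun q => q.1) p.
Proof. by near=> q; exact: germ_fst. Unshelve. all: by end_near. Qed.

Lemma an_snd p : analytic_near (fun q => q.2) p.
Proof. by near=> q; exact: germ_snd. Unshelve. all: by end_near. Qed.

Lemma anD h k p : analytic_near h p -> analytic_near k p -> analytic_near (fun q => h q + k q) p.
Proof. by apply: filterS2 => q; exact: germD. Qed.

Lemma anM h k p : analytic_near h p -> analytic_near k p -> analytic_near (fun q => h q * k q) p.
Proof. by apply: filterS2 => q; exact: germM. Qed.

Lemma anN h p : analytic_near h p -> analytic_near (fun q => - h q) p.
Proof.
move=> ah; have := anM (an_cst (-1) p) ah.
by congr analytic_near; apply/funext => q; rewrite mulN1r.
Qed.

Lemma anX h p n : analytic_near h p -> analytic_near (fun q => h q ^+ n) p.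
Proof.
move=> ah; elim: n => [|n IH].
  by under eq_fun do rewrite expr0; exact: an_cst.
by under eq_fun do rewrite exprS; exact: anM.
Qed.

Lemma an_near (D : set R) h p : open D -> analytic_near h p -> D (h p) ->
  \forall q \near p, D (h q).
Proof.
by move=> oD ah Dh; apply: (an_continuous ah); exact: open_nbhs_nbhs.
Qed.

Lemma an_near_gt0 h p : analytic_near h p -> 0 < h p -> \forall q \near p, 0 < h q.
Proof. by move=> ah h0; exact: (@an_near [set x | 0 < x] h p). Qed.

Lemma an_near_neq0 h p : analytic_near h p -> h p != 0 -> \forall q \near p, h q != 0.
Proof. by move=> ah h0; exact: (@an_near [set x | x != 0] h p). Qed.

Lemma an_comp (phi : R -> R) (D : set R) h p : open D ->
  (forall z, D z -> power_series_at phi z) -> D (h p) -> analytic_near h p ->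
  analytic_near (fun q => phi (h q)) p.
Proof.
move=> oD Dphi Dh ah.
have := an_near oD ah Dh.
by apply: filterS2 ah => q gq Dq; apply: germ_comp (Dphi _ Dq).
Qed.

Lemma anV h p : h p != 0 -> analytic_near h p -> analytic_near (fun q => (h q)^-1) p.
Proof.
move=> h0; apply: (@an_comp _ [set x | x != 0]) => //.
exact: power_series_inv.
Qed.

Lemma an_ln h p : 0 < h p -> analytic_near h p -> analytic_near (fun q => ln (h q)) p.
Proof.
move=> h0; apply: (@an_comp _ [set x | 0 < x]) => //.
exact: power_series_ln.
Qed.

Lemma an_expR h p : analytic_near h p -> analytic_near (fun q => expR (h q)) p.
Proof.
by apply: (@an_comp _ setT _ _ (@openT R)) => // z _; exact: power_series_expR.
Qed.

Lemma an_sin h p : analytic_near h p -> analytic_near (fun q => sin (h q)) p.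
Proof.
by apply: (@an_comp _ setT _ _ (@openT R)) => // z _; exact: power_series_sin.
Qed.

Lemma an_cos h p : analytic_near h p -> analytic_near (fun q => cos (h q)) p.
Proof.
by apply: (@an_comp _ setT _ _ (@openT R)) => // z _; exact: power_series_cos.
Qed.

Lemma an_atan h p : analytic_near h p -> analytic_near (fun q => atan (h q)) p.
Proof.
by apply: (@an_comp _ setT _ _ (@openT R)) => // z _; exact: power_series_atan.
Qed.

Lemma germ_near_ext h k p : (\forall q \near p, h q = k q) -> germ h p -> germ k p.
Proof.
move=> /nbhs_ballP [e e0 be] [a [rho [M ea]]]; have [r0 _ _] := ea.
exists a, (Num.min rho (e / 2)), M.
have e2 : 0 < e / 2 by rewrite divr_gt0.
have m0 : 0 < Num.min rho (e / 2) by rewrite lt_min r0 e2.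
have me : Num.min rho (e / 2) < e.
  rewrite (@le_lt_trans _ _ (e / 2)) ?ge_min ?lexx ?orbT //.
  by rewrite ltr_pdivrMr // ltr_pMr // ltr1n.
apply: expands_ext; last by apply: expands_shrink ea; rewrite // ge_min lexx.
move=> q q1 q2; apply: be; split; rewrite /= /ball /= distrC;
  exact: le_lt_trans me.
Qed.

Lemma an_near_ext h k p : (\forall q \near p, h q = k q) -> analytic_near h p -> analytic_near k p.
Proof.
move=> /nbhs_interior; apply: filterS2 => q; exact: germ_near_ext.
Qed.

(** sqrt x = exp (ln x / 2) for positive x. *)
Lemma an_sqrt h p : 0 < h p -> analytic_near h p -> analytic_near (fun q => Num.sqrt (h q)) p.
Proof.
move=> h0 ah.
apply: (@an_near_ext (fun q => expR (2^-1 * ln (h q)))).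
  apply: filterS (an_near_gt0 ah h0) => q hq.
  by rewrite -powR12_sqrt ?(ltW hq) // /powR gt_eqF.
apply: an_expR; apply: (@anM (fun=> 2^-1) (fun q => ln (h q))).
  exact: an_cst.
exact: an_ln.
Qed.

End AnalyticNear.

(** * Local analytic isomorphisms *)

(** Follows the syntax of an expression; the remaining goals state that
    denominators do not vanish and that arguments of roots and logarithms are
    positive. *)
Ltac analytic :=
  repeat first
  [ match goal with |- analytic_near (fun q => ?c) ?p => exact (@an_cst _ c p) end
  | lazymatch goal with
    | |- analytic_near (fun q => q.1) _ => exact: an_fst
    | |- analytic_near (fun q => q.2) _ => exact: an_snd
    | |- analytic_near (fun q => @?f q + @?g q) _ => apply: (@anD _ f g)
    | |- analytic_near (fun q => - @?f q) _ => apply: (@anN _ f)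
    | |- analytic_near (fun q => @?f q * @?g q) _ => apply: (@anM _ f g)
    | |- analytic_near (fun q => @?f q ^+ _) _ => apply: (@anX _ f)
    | |- analytic_near (fun q => (@?f q)^-1) _ => apply: (@anV _ f)
    | |- analytic_near (fun q => Num.sqrt (@?f q)) _ => apply: (@an_sqrt _ f)
    | |- analytic_near (fun q => ln (@?f q)) _ => apply: (@an_ln _ f)
    | |- analytic_near (fun q => expR (@?f q)) _ => apply: (@an_expR _ f)
    | |- analytic_near (fun q => sin (@?f q)) _ => apply: (@an_sin _ f)
    | |- analytic_near (fun q => cos (@?f q)) _ => apply: (@an_cos _ f)
    | |- analytic_near (fun q => atan (@?f q)) _ => apply: (@an_atan _ f)
    | |- analytic_near _ _ => assumption
    end ].

Section LocalIso.
Context {R : realType}.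
Implicit Types (h k : plane R -> R) (p q z w : plane R).
Implicit Types (F G : plane R -> plane R).

Definition analytic1 (phi : R -> R) (t0 : R) := forall h (w0 : plane R),
  analytic_near h w0 -> h w0 = t0 -> analytic_near (fun w => phi (h w)) w0.

(** Stability under substitution of analytic functions.  It holds of all
    expressions in elementary functions and composes by definition, which makes
    the composition of double series in two variables unnecessary. *)
Definition analytic2 (H : plane R -> R) z0 := forall h k (w0 : plane R),
  analytic_near h w0 -> analytic_near k w0 -> (h w0, k w0) = z0 ->
  analytic_near (fun w => H (h w, k w)) w0.

Definition analytic_map F z0 :=
  analytic2 (fun z => (F z).1) z0 /\ analytic2 (fun z => (F z).2) z0.

Lemma analytic2_near (H : plane R -> R) z0 : analytic2 H z0 -> analytic_near H z0.
Proof.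
move=> aH; have := aH fst snd z0 (an_fst z0) (an_snd z0) (esym (surjective_pairing z0)).
by congr analytic_near; apply/funext => -[].
Qed.

Lemma analytic1_near (phi : R -> R) t0 y : analytic1 phi t0 ->
  analytic_near (fun q => phi q.1) (t0, y).
Proof. by move=> aphi; apply: aphi => //; exact: an_fst. Qed.

Lemma analytic_map_comp F G z0 : analytic_map F z0 -> analytic_map G (F z0) ->
  analytic_map (G \o F) z0.
Proof.
move=> [F1 F2] [G1 G2].
have E h k (w : plane R) : (G \o F) (h w, k w) =
    G ((F (h w, k w)).1, (F (h w, k w)).2) by rewrite -surjective_pairing.
by split=> h k w0 ah ak e; under eq_fun do rewrite E; [apply: G1|apply: G2];
  rewrite ?e -?surjective_pairing //; [exact: F1|exact: F2|exact: F1|exact: F2].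
Qed.

Lemma analytic_map_continuous F z0 : analytic_map F z0 -> {for z0, continuous F}.
Proof.
move=> [/analytic2_near/an_continuous F1 /analytic2_near/an_continuous F2].
rewrite (_ : F = fun z => ((F z).1, (F z).2)); last by apply/funext => z; case: (F z).
exact: (@cvg_pair _ _ _ (nbhs z0) (nbhs (F z0).1) (nbhs (F z0).2) _ _ _ _ _ F1 F2).
Qed.

Lemma near_comp F (P : plane R -> Prop) p0 : {for p0, continuous F} ->
  (\forall z \near F p0, P z) -> \forall p \near p0, P (F p).
Proof. by move=> cF; exact: (cF P). Qed.

Definition local_iso F G p0 w0 :=
  [/\ F p0 = w0, analytic_map F p0, analytic_map G w0,
      \forall p \near p0, G (F p) = p & \forall w \near w0, F (G w) = w].

Lemma local_iso_center F G p0 w0 : local_iso F G p0 w0 -> G w0 = p0.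
Proof. by move=> [<- _ _ /nbhs_singleton]. Qed.

Lemma local_iso_comp F G F' G' p0 w0 v0 :
  local_iso F G p0 w0 -> local_iso F' G' w0 v0 ->
  local_iso (F' \o F) (G \o G') p0 v0.
Proof.
move=> i1 i2; have c1 := local_iso_center i1; have c2 := local_iso_center i2.
move: i1 i2 => [e1 aF aG GF FG] [e2 aF' aG' GF' FG']; split.
- by rewrite /= e1.
- by apply: analytic_map_comp => //; rewrite e1.
- by apply: analytic_map_comp => //; rewrite c2.
- have C : {for p0, continuous F} by exact: analytic_map_continuous.
  have H' : \forall p \near p0, G' (F' (F p)) = F p.
    by apply: (near_comp (P := fun z => G' (F' z) = z) C); rewrite e1.
  by apply: filterS2 GF H' => p E1 E2 /=; rewrite E2.
- have C : {for v0, continuous G'} by exact: analytic_map_continuous.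
  have H' : \forall v \near v0, F (G (G' v)) = G' v.
    by apply: (near_comp (P := fun z => F (G z) = z) C); rewrite c2.
  by apply: filterS2 FG' H' => p E1 E2 /=; rewrite E2.
Qed.

Definition local_iso1 (phi psi : R -> R) t0 u0 :=
  [/\ phi t0 = u0, analytic1 phi t0, analytic1 psi u0,
      \forall t \near t0, psi (phi t) = t & \forall u \near u0, phi (psi u) = u].

Lemma near_fst (P : R -> Prop) (a b : R) :
  (\forall t \near a, P t) -> \forall z \near ((a, b) : plane R), P z.1.
Proof. by move=> aP; apply: (@cvg_fst _ _ (nbhs a) (nbhs b)). Qed.

Lemma near_snd (P : R -> Prop) (a b : R) :
  (\forall t \near b, P t) -> \forall z \near ((a, b) : plane R), P z.2.
Proof. by move=> aP; apply: (@cvg_snd _ _ (nbhs a) (nbhs b)). Qed.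

Lemma local_iso_prod phi1 psi1 phi2 psi2 t1 t2 u1 u2 :
  local_iso1 phi1 psi1 t1 u1 -> local_iso1 phi2 psi2 t2 u2 ->
  local_iso (fun z => (phi1 z.1, phi2 z.2)) (fun w => (psi1 w.1, psi2 w.2))
    (t1, t2) (u1, u2).
Proof.
move=> [<- a1 b1 pp1 qq1] [<- a2 b2 pp2 qq2]; split=> //.
- by split=> h k w0 ah ak [e1 e2]; [exact: a1|exact: a2].
- by split=> h k w0 ah ak [e1 e2]; [exact: b1|exact: b2].
- apply: filterS2 (near_fst (t2) pp1) (near_snd (t1) pp2) => -[x y] /=.
  by move=> -> ->.
- apply: filterS2 (near_fst (phi2 t2) qq1) (near_snd (phi1 t1) qq2) => -[x y] /=.
  by move=> -> ->.
Qed.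

Definition sum_prod z : plane R := (z.1 + z.2, z.1 * z.2).

Definition discr z : R := z.1 ^+ 2 - 4 * z.2.

(** The larger root comes first, so that the two members of a family counted
    twice are told apart. *)
Definition roots z : plane R :=
  ((z.1 + Num.sqrt (discr z)) / 2, (z.1 - Num.sqrt (discr z)) / 2).

Lemma sum_prodK z : z.2 < z.1 -> roots (sum_prod z) = z.
Proof.
case: z => x y /= xy; rewrite /roots.
have -> : discr (sum_prod (x, y)) = (x - y) ^+ 2 by rewrite /discr /=; ring.
rewrite sqrtr_sqr ger0_norm ?subr_ge0 ?ltW //=.
by congr (_, _); field.
Qed.

Lemma rootsK z : 0 <= discr z -> sum_prod (roots z) = z.
Proof.
move=> d0; rewrite [RHS]surjective_pairing /sum_prod /roots /=; congr (_, _).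
  by field.
have E := sqr_sqrtr d0; set s := Num.sqrt _ in E *.
have -> : (z.1 + s) / 2 * ((z.1 - s) / 2) = (z.1 ^+ 2 - s ^+ 2) / 4 by field.
by rewrite E /discr; field.
Qed.

Lemma local_iso_roots t1 t2 : t2 < t1 ->
  local_iso roots sum_prod (t1 + t2, t1 * t2) (t1, t2).
Proof.
move=> t21.
have d0 : 0 < discr (t1 + t2, t1 * t2).
  have -> : discr (t1 + t2, t1 * t2) = (t1 - t2) ^+ 2 by rewrite /discr /=; ring.
  by rewrite exprn_gt0 // subr_gt0.
split.
- exact: (@sum_prodK (t1, t2)).
- by split=> h k w0 ah ak /= e; rewrite /roots /discr /=; analytic => //=;
    move: d0; rewrite -e.
- by split=> h k w0 ah ak /= e; rewrite /sum_prod /=; analytic.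
- have : \forall z \near (t1 + t2, t1 * t2), 0 < discr z.
    by apply: an_near_gt0 => //; rewrite /discr; analytic.
  by apply: filterS => z /ltW; exact: rootsK.
- have : \forall z \near (t1, t2), 0 < z.1 - z.2.
    by apply: an_near_gt0; [analytic|rewrite subr_gt0].
  by apply: filterS => z; rewrite subr_gt0; exact: sum_prodK.
Qed.

End LocalIso.

(** * Arcs cut out of lines and circles by small open sets *)

Section Arcs.
Context {R : realType}.
Implicit Types (p q c v w : plane R) (A S Omega : set (plane R)).

Lemma open_interval (E : set R) (lo hi : R) :
  open E -> connected E -> E !=set0 -> (forall t, E t -> lo < t < hi) ->
  exists a b, [/\ lo <= a, a < b, b <= hi & E = [set` `]a, b[ ]].
Proof.
move=> oE /connected_intervalP iE [t0 Et0] Ebd.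
have hl : has_lbound E by exists lo => t /Ebd /andP[/ltW].
have hu : has_ubound E by exists hi => t /Ebd /andP[_ /ltW].
have EE : E = [set r | inf E < r < sup E].
  by rewrite -(interval_bounded_interior iE hl hu); apply/esym/interior_id.
exists (inf E), (sup E); split.
- apply: lb_le_inf; first by exists t0.
  by move=> t /Ebd /andP[/ltW].
- by move: Et0; rewrite {1}EE /= => /andP[h1 h2]; exact: lt_trans h2.
- apply: ge_sup; first by exists t0.
  by move=> t /Ebd /andP[_ /ltW].
- by rewrite {1}EE; apply/seteqP; split => t /=; rewrite in_itv.
Qed.

Lemma continuous_curve (x y : R -> R) : continuous x -> continuous y ->
  continuous (fun t => (x t, y t) : plane R).
Proof.
move=> cx cy t; exact: (@cvg_pair _ _ _ (nbhs t) (nbhs (x t)) (nbhs (y t))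
  _ _ _ _ _ (cx t) (cy t)).
Qed.

Lemma continuous_affine (a b : R) : continuous (fun t : R => a + t * b).
Proof.
by move=> t; apply: cvgD; [exact: cvg_cst|apply: cvgM; [exact: cvg_id|exact: cvg_cst]].
Qed.

(** The set of parameters of A is open since Omega is open, and an interval since
    it is the image under tau of a connected set. *)
Lemma arc_parameters (sigma : R -> plane R) (tau : plane R -> R) A S Omega
    (lo hi : R) (D := [set t | lo < t < hi]) :
  open Omega -> continuous sigma -> A = S `&` Omega ->
  connected A -> A !=set0 ->
  (forall q, A q -> {for q, continuous tau}) ->
  (forall q, A q -> D (tau q) /\ sigma (tau q) = q) ->
  (forall t, D t -> S (sigma t) /\ tau (sigma t) = t) ->
  exists a b, [/\ lo <= a, a < b, b <= hi & A = sigma @` [set` `]a, b[ ]].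
Proof.
move=> oO csig AE cA A0 ctau tauK sigK.
pose E := D `&` (sigma @^-1` Omega).
have AsE : A = sigma @` E.
  apply/seteqP; split=> q /=.
    move=> Aq; have [Dt st] := tauK q Aq.
    by exists (tau q) => //; split; rewrite //= st; move: Aq; rewrite AE => -[].
  by move=> [t [Dt Ot] <-]; rewrite AE; split=> //; case: (sigK t Dt).
have EtA : E = tau @` A.
  apply/seteqP; split=> t /=.
    move=> [Dt Ot]; exists (sigma t); last by case: (sigK t Dt).
    by rewrite AE; split=> //; case: (sigK t Dt).
  move=> [q Aq <-]; have [Dt st] := tauK q Aq.
  by split=> //=; rewrite st; move: Aq; rewrite AE => -[].
have [||||a [b [la ab bh EE]]] := @open_interval E lo hi.
- apply: openI; last by apply: open_comp => // t _; exact: csig.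
  rewrite (_ : D = [set t | lo < t] `&` [set t | t < hi]).
    by apply: openI; [exact: open_gt|exact: open_lt].
  by apply/seteqP; split => t /=; [move=> /andP[]|move=> [? ?]; apply/andP].
- rewrite EtA; apply: connected_continuous_connected => //.
  by apply: continuous_in_subspaceT => q /set_mem; exact: ctau.
- by rewrite EtA; case: A0 => q Aq; exists (tau q), q.
- by move=> t [].
- by exists a, b; split=> //; rewrite AsE EE.
Qed.


Lemma continuous_fst_plane : continuous (fun q : plane R => q.1).
Proof. by move=> q; apply: cvg_fst. Qed.

Lemma continuous_snd_plane : continuous (fun q : plane R => q.2).
Proof. by move=> q; apply: cvg_snd. Qed.

Definition sqdist p q : R := (p.1 - q.1) ^+ 2 + (p.2 - q.2) ^+ 2.

Lemma plane_neq0 v : v != 0 -> 0 < v.1 ^+ 2 + v.2 ^+ 2.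
Proof.
move=> v0; rewrite lt_neqAle addr_ge0 ?sqr_ge0 // andbT eq_sym paddr_eq0 ?sqr_ge0 //.
by rewrite !sqrf_eq0 -xpair_eqE -surjective_pairing.
Qed.

Lemma sqdist_gt0 p q : p <> q -> 0 < sqdist p q.
Proof.
move=> pq; apply: (@plane_neq0 (p.1 - q.1, p.2 - q.2)); apply/eqP => -[h1 h2].
by apply: pq; rewrite [p]surjective_pairing [q]surjective_pairing; congr (_, _); lra.
Qed.

Lemma sqr_lt_bound (t t0 m : R) : 0 < m -> (t - t0) ^+ 2 < m ->
  t0 - (1 + m) < t < t0 + (1 + m).
Proof.
by move=> m0 H; apply/andP; split; rewrite ltNge; apply/negP => h; nra.
Qed.

Lemma circular_arc_line S Omega A (rho : R) :
  is_line S -> open Omega -> 0 < rho ->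
  (forall p q, Omega p -> Omega q -> sqdist p q < rho) ->
  A = S `&` Omega -> connected A -> A !=set0 -> circular_arc A.
Proof.
move=> [p [v [v0 SE]]] oO rho0 small AE cA A0.
have vv := plane_neq0 v0.
set n := v.1 ^+ 2 + v.2 ^+ 2 in vv.
have n0 : n != 0 by rewrite gt_eqF.
pose sigma t : plane R := (p.1 + t * v.1, p.2 + t * v.2).
pose tau q : R := ((q.1 - p.1) * v.1 + (q.2 - p.2) * v.2) / n.
have tausig t : tau (sigma t) = t.
  by rewrite /tau /sigma /n /=; field.
have [q0 Aq0] := A0.
have [q0O q0S] : Omega q0 /\ exists t, q0 = sigma t.
  by move: Aq0; rewrite AE SE => -[[t ->] ?]; split=> //; exists t.
pose M := 1 + rho / n.
have [||||a [b [_ ab _ ->]]] := @arc_parameters sigma tau A S Omega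
    (tau q0 - M) (tau q0 + M) oO _ AE cA A0.
- by apply: continuous_curve; exact: continuous_affine.
- move=> q _; rewrite /tau; apply: cvgM; last exact: cvg_cst.
  apply: cvgD; apply: cvgM; try exact: cvg_cst.
    by apply: cvgB; [exact: continuous_fst_plane|exact: cvg_cst].
  by apply: cvgB; [exact: continuous_snd_plane|exact: cvg_cst].
- move=> q; rewrite AE SE => -[[t ->] Oq]; rewrite -/(sigma t) tausig; split=> //.
  have [t0 E0] := q0S; rewrite /= E0 tausig.
  have := small _ _ Oq q0O; rewrite E0 -/(sigma t).
  have -> : sqdist (sigma t) (sigma t0) = (t - t0) ^+ 2 * n.
    by rewrite /sqdist /sigma /n /=; ring.
  rewrite -ltr_pdivlMr // => H.
  have m0 : 0 < rho / n by rewrite divr_gt0.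
  exact: sqr_lt_bound.
- by move=> t _; split=> //; rewrite SE; exists t.
apply: Or42; exists (sigma a), ((b - a) * v.1, (b - a) * v.2); split.
  apply: contra_neq v0 => -[/eqP]; rewrite mulf_eq0 subr_eq0 gt_eqF //= => /eqP v1.
  move/eqP; rewrite mulf_eq0 subr_eq0 gt_eqF //= => /eqP v2.
  by rewrite [v]surjective_pairing v1 v2.
have ba : 0 < b - a by rewrite subr_gt0.
apply/seteqP; split=> q /= [t tab <-].
  exists ((t - a) / (b - a)).
    move: tab; rewrite /= !in_itv /= => /andP[h1 h2].
    by rewrite divr_gt0 ?subr_gt0 //= ltr_pdivrMr // mul1r ltrD2r.
  have ba' : b - a != 0 by rewrite gt_eqF.
  by rewrite /sigma /=; congr (_, _); field.
exists (a + t * (b - a)).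
  move: tab; rewrite /= !in_itv /= => /andP[h1 h2].
  rewrite ltrDl mulr_gt0 //= -ltrBrDl -{2}[b - a]mul1r ltr_pM2r //.
by rewrite /sigma /=; congr (_, _); ring.
Qed.

Lemma angle_exists (x y : R) : x ^+ 2 + y ^+ 2 = 1 ->
  exists th, cos th = x /\ sin th = y.
Proof.
move=> E.
have x1 : -1 <= x <= 1 by apply/andP; split; nra.
have [y0|y0] := leP 0 y.
  exists (acos x); rewrite acosK ?in_itv //=; split=> //.
  rewrite sin_acos // (_ : 1 - x ^+ 2 = y ^+ 2); last by rewrite -E; ring.
  by rewrite sqrtr_sqr ger0_norm.
exists (- acos x); rewrite cosN sinN acosK ?in_itv //=; split=> //.
rewrite sin_acos // (_ : 1 - x ^+ 2 = y ^+ 2); last by rewrite -E; ring.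
by rewrite sqrtr_sqr ltr0_norm // opprK.
Qed.

Lemma edist_sqr p q : edist p q ^+ 2 = sqdist p q.
Proof. by rewrite sqr_sqrtr // addr_ge0 // sqr_ge0. Qed.

Lemma circleE c (r : R) q : 0 <= r -> circle c r q <-> sqdist q c = r ^+ 2.
Proof.
move=> r0; split=> [<-|E]; first by rewrite edist_sqr.
by rewrite /circle /= /edist -/(sqdist q c) E sqrtr_sqr ger0_norm.
Qed.

(** Omega is smaller than the radius, so its trace on the circle lies in an open
    half circle centred at any of its points.  There the angle is the arctangent
    of a quotient of coordinates. *)
Lemma circular_arc_circle c (r : R) Omega A :
  0 < r -> open Omega ->
  (forall p q, Omega p -> Omega q -> sqdist p q < r ^+ 2) ->
  A = circle c r `&` Omega -> connected A -> A !=set0 -> circular_arc A.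
Proof.
move=> r0 oO small AE cA A0; have r00 := ltW r0.
have rn : r != 0 by rewrite gt_eqF.
have [q0 Aq0] := A0.
have [q0c q0O] : sqdist q0 c = r ^+ 2 /\ Omega q0.
  by move: Aq0; rewrite AE => -[/circleE -/(_ r00)].
have [th [cth sth]] : exists th, cos th = (q0.1 - c.1) / r /\ sin th = (q0.2 - c.2) / r.
  apply: angle_exists; rewrite !expr_div_n -mulrDl.
  by rewrite -[X in X / _]/(sqdist q0 c) q0c divff // sqrf_eq0.
have cs : cos th ^+ 2 + sin th ^+ 2 = 1 by rewrite cos2Dsin2.
pose X q := (q.1 - c.1) * cos th + (q.2 - c.2) * sin th.
pose Y q := (q.2 - c.2) * cos th - (q.1 - c.1) * sin th.
have XY q : X q ^+ 2 + Y q ^+ 2 = sqdist q c.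
  rewrite /X /Y /sqdist -[RHS]mulr1 -cs; ring.
have XA q : A q -> 0 < X q.
  rewrite AE => -[/circleE -/(_ r00) qc qO].
  have := small _ _ qO q0O.
  have -> : sqdist q q0 = r ^+ 2 + r ^+ 2 - 2 * r * X q.
    rewrite -{1}qc -q0c /X cth sth /sqdist.
    rewrite (_ : 2 * r * _ = 2 * ((q.1 - c.1) * (q0.1 - c.1) +
       (q.2 - c.2) * (q0.2 - c.2))); last by field.
    ring.
  move=> H; rewrite -(pmulr_rgt0 _ r0); nra.
pose sigma t : plane R := (c.1 + r * cos (th + t), c.2 + r * sin (th + t)).
pose tau q := atan (Y q / X q).
have Xsig t : X (sigma t) = r * cos t.
  rewrite /X /sigma /= cosD sinD -[RHS]mulr1 -cs; ring.
have Ysig t : Y (sigma t) = r * sin t.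
  rewrite /Y /sigma /= cosD sinD -[RHS]mulr1 -cs; ring.
have [||||a [b [la ab bh ->]]] := @arc_parameters sigma tau A (circle c r) Omega
    (- (pi / 2)) (pi / 2) oO _ AE cA A0.
- apply: continuous_curve => t; apply: cvgD; try exact: cvg_cst;
    apply: cvgM; try exact: cvg_cst.
    apply: (@continuous_comp _ _ _ (fun t => th + t) cos); last exact: continuous_cos.
    by apply: cvgD; [exact: cvg_cst|exact: cvg_id].
  apply: (@continuous_comp _ _ _ (fun t => th + t) sin); last exact: continuous_sin.
  by apply: cvgD; [exact: cvg_cst|exact: cvg_id].
- move=> q /XA Xq.
  suff : analytic_near tau q by exact: an_continuous.
  rewrite /tau /X /Y; analytic.
  by rewrite gt_eqF.
- move=> q Aq; have Xq := XA _ Aq.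
  have qc : sqdist q c = r ^+ 2.
    by move: Aq; rewrite AE => -[/circleE -/(_ r00)].
  split; first by rewrite /= /tau atan_gtNpi2 atan_ltpi2.
  have Xn : X q != 0 by rewrite gt_eqF.
  have ct : cos (tau q) = X q / r.
    rewrite /tau cos_atan.
    have -> : 1 + (Y q / X q) ^+ 2 = (r / X q) ^+ 2.
      by rewrite !expr_div_n -qc -XY; field.
    by rewrite sqrtr_sqr ger0_norm ?invf_div // divr_ge0 // ltW.
  have st : sin (tau q) = Y q / r.
    have := atanK (Y q / X q); rewrite -/(tau q) /tan ct => E.
    have -> : sin (tau q) = (sin (tau q) / (X q / r)) * (X q / r).
      by field; rewrite rn Xn.
    by rewrite E; field; rewrite rn Xn.
  rewrite /sigma cosD sinD ct st [RHS]surjective_pairing; congr (_, _).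
    transitivity (c.1 + (q.1 - c.1) * (cos th ^+ 2 + sin th ^+ 2)).
      by rewrite /X /Y; field.
    by rewrite cs; ring.
  transitivity (c.2 + (q.2 - c.2) * (cos th ^+ 2 + sin th ^+ 2)).
    by rewrite /X /Y; field.
  by rewrite cs; ring.
- move=> t /= tD; have ct := cos_gt0_pihalf tD; split.
    apply/circleE => //; rewrite -XY Xsig Ysig !exprMn -mulrDr cos2Dsin2 mulr1 //.
  rewrite /tau Xsig Ysig (_ : r * sin t / (r * cos t) = tan t).
    by rewrite tanK // in_itv.
  by rewrite /tan; field; rewrite rn gt_eqF.
apply: Or41; exists c, r, (th + a), (th + b); split=> //.
- by rewrite ltrD2l.
- have pi0 := pi_gt0 R; lra.
apply/seteqP; split=> q /= [t tab <-].
  by exists (th + t); rewrite // in_itv /= !ltrD2l; move: tab; rewrite /= in_itv.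
exists (t - th); last by rewrite /sigma subrKC.
by move: tab; rewrite /= !in_itv /= ltrBrDl ltrBlDl.
Qed.

Lemma convex_connected A :
  (forall p q t, A p -> A q -> 0 <= t <= 1 ->
     A (p.1 + t * (q.1 - p.1), p.2 + t * (q.2 - p.2))) ->
  connected A.
Proof.
move=> convA.
have [->|/set0P [p Ap]] := eqVneq A set0; first exact: connected0.
pose seg q := (fun t : R => (p.1 + t * (q.1 - p.1), p.2 + t * (q.2 - p.2)) : plane R)
   @` [set` `[0, 1]].
have -> : A = \bigcup_(q in A) seg q.
  apply/seteqP; split=> q.
    move=> Aq; exists q => //; exists 1; first by rewrite /= in_itv /= ler01 lexx.
    by rewrite !mul1r !subrKC -surjective_pairing.
  by move=> [q' Aq' [t /=]]; rewrite in_itv /= => t01 <-; exact: convA.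
apply: bigcup_connected.
  exists p => q Aq; exists 0; first by rewrite /= in_itv /= ler01 lexx.
  by rewrite !mul0r !addr0 -surjective_pairing.
move=> q _; apply: connected_continuous_connected; first exact: segment_connected.
apply: continuous_subspaceT; apply: continuous_curve; exact: continuous_affine.
Qed.

End Arcs.

(** * A chart that straightens three families gives a web *)

Section WebOfChart.
Context {R : realType}.
Implicit Types (p q c v w z : plane R) (A S Omega B : set (plane R)).
Implicit Types (C : set (set (plane R))) (F G : plane R -> plane R).

(** The lower bound on the radius, common to a whole family, allows one small
    domain to cut all its members in less than half a circle. *)
Definition arc_carrier (rho : R) S :=
  (exists c r, [/\ 0 < r, rho <= r ^+ 2 & S = circle c r]) \/ is_line S.

Definition lin (n w : plane R) : R := n.1 * w.1 + n.2 * w.2.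

Definition cuts_leaves (rho : R) B G C (S : R -> set (plane R)) (n : plane R) :=
  forall w w', B w -> B w' ->
    [/\ C (S (lin n w)), arc_carrier rho (S (lin n w))
      & S (lin n w) (G w') <-> lin n w' = lin n w].

Section Foliation.
Variables (Omega B : set (plane R)) (F G : plane R -> plane R) (rho : R).
Hypotheses (oOmega : open Omega) (rho0 : 0 < rho)
  (small : forall p q, Omega p -> Omega q -> sqdist p q < rho)
  (convB : forall p q t, B p -> B q -> 0 <= t <= 1 ->
     B (p.1 + t * (q.1 - p.1), p.2 + t * (q.2 - p.2)))
  (FP : forall p, Omega p -> B (F p) /\ G (F p) = p)
  (GP : forall w, B w -> Omega (G w) /\ F (G w) = w)
  (cG : forall w, B w -> {for w, continuous G}).

Variables (C : set (set (plane R))) (S : R -> set (plane R)) (n v : plane R).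
Hypotheses (n0 : n != 0) (v0 : v != 0) (nv : lin n v = 0)
  (SP : cuts_leaves rho B G C S n).

Definition leaf (k : R) := [set p | Omega p /\ lin n (F p) = k].

(** The arc chosen on X is the trace of Omega, provided that it is a leaf of the
    foliation under consideration. *)
Definition leaf_arc (X : set (plane R)) : set (plane R) :=
  if `[< exists w, B w /\ X `&` Omega = leaf (lin n w) >] then X `&` Omega
  else set0.

Lemma lin_line p q : line p v q <-> lin n q = lin n p.
Proof.
split=> [[t ->]|E].
  move: nv; rewrite /lin /= => nv'.
  rewrite -[RHS]addr0 -(mulr0 t) -nv'; ring.
have [v1|v1] := eqVneq v.1 0.
  have v2 : v.2 != 0.
    by apply: contra_neq v0 => v2; rewrite [v]surjective_pairing v1 v2.
  have n2 : n.2 = 0.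
    move/eqP: nv; rewrite /lin v1 mulr0 add0r mulf_eq0 (negbTE v2) orbF.
    by move/eqP.
  have n1 : n.1 != 0.
    by apply: contra_neq n0 => n1; rewrite [n]surjective_pairing n1 n2.
  exists ((q.2 - p.2) / v.2); rewrite [LHS]surjective_pairing v1 mulr0 addr0.
  congr (_, _); last by rewrite divfK // subrKC.
  by move: E; rewrite /lin n2 !mul0r !addr0 => /(mulfI n1).
exists ((q.1 - p.1) / v.1); rewrite [LHS]surjective_pairing divfK // subrKC.
congr (_, _).
have n2 : n.2 != 0.
  apply: contra_neq n0 => n2; rewrite [n]surjective_pairing n2; congr (_, _).
  move/eqP: nv; rewrite /lin n2 mul0r addr0 mulf_eq0 (negbTE v1) orbF.
  by move/eqP.
apply: (mulfI n2).
have n1v : n.1 = - (n.2 * v.2) / v.1.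
  apply: (mulIf v1); rewrite divfK //; apply/eqP; rewrite -addr_eq0.
  by apply/eqP; move: nv; rewrite /lin.
move: E; rewrite /lin n1v => E.
have -> : n.2 * q.2 = (- (n.2 * v.2) / v.1 * q.1 + n.2 * q.2) +
   n.2 * v.2 / v.1 * q.1 by ring.
rewrite E; ring.
Qed.

Lemma leaf_image w : F @` leaf (lin n w) = line w v `&` B.
Proof.
apply/seteqP; split=> q /=.
  by move=> [p [Op Lp] <-]; split; [apply/lin_line|case: (FP Op)].
move=> [/lin_line lq Bq]; have [Oq FG] := GP Bq.
by exists (G q) => //; split=> //; rewrite FG.
Qed.

Lemma leaf_preimage w : leaf (lin n w) = G @` (line w v `&` B).
Proof.
rewrite -leaf_image; apply/seteqP; split=> q /=.
  by move=> Lq; exists (F q); [exists q|case: Lq => /FP[]].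
by move=> [_ [p Lp <-] <-]; have [Op _] := Lp; have [_ ->] := FP Op.
Qed.

Lemma line_box_connected w : connected (line w v `&` B).
Proof.
apply: convex_connected => p q t [/lin_line lp Bp] [/lin_line lq Bq] t01.
split; last exact: convB.
apply/lin_line; move: lp lq; rewrite /lin /= => lp lq.
have -> : n.1 * (p.1 + t * (q.1 - p.1)) + n.2 * (p.2 + t * (q.2 - p.2)) =
  (1 - t) * (n.1 * p.1 + n.2 * p.2) + t * (n.1 * q.1 + n.2 * q.2) by ring.
by rewrite lp lq; ring.
Qed.

Lemma carrier_leaf w : B w -> S (lin n w) `&` Omega = leaf (lin n w).
Proof.
move=> Bw; apply/seteqP; split=> p /= [h1 h2]; split=> //.
  have [BF GF] := FP h2; have [_ _ SG] := SP Bw BF.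
  by apply/SG; rewrite GF.
have [BF GF] := FP h1; have [_ _ SG] := SP Bw BF.
by rewrite -GF; apply/SG.
Qed.

Lemma leaf_circular w : B w -> circular_arc (leaf (lin n w)).
Proof.
move=> Bw.
have cl : connected (leaf (lin n w)).
  rewrite leaf_preimage; apply: connected_continuous_connected.
    exact: line_box_connected.
  by apply: continuous_in_subspaceT => q /set_mem [_ Bq]; exact: cG.
have l0 : leaf (lin n w) !=set0.
  by exists (G w); have [OG FG] := GP Bw; split; rewrite ?FG.
have [_ [[c [r [r0 rr SE]]]|lS] _] := SP Bw Bw.
  apply: (@circular_arc_circle _ c r Omega) => //.
    by move=> p q Op Oq; apply: lt_le_trans rr; exact: small.
  by rewrite -SE carrier_leaf.
by apply: (circular_arc_line lS oOmega rho0 small) => //; rewrite carrier_leaf.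
Qed.

Lemma leaf_arcE X : leaf_arc X !=set0 ->
  exists w, [/\ B w, X `&` Omega = leaf (lin n w) & leaf_arc X = leaf (lin n w)].
Proof.
rewrite /leaf_arc; case: asboolP => [[w [Bw XE]] _|_ [q []]//].
by exists w; rewrite XE.
Qed.

Lemma leaf_arc_carrier w : B w -> leaf_arc (S (lin n w)) = leaf (lin n w).
Proof.
move=> Bw; rewrite /leaf_arc; case: asboolP => [_|[]]; first exact: carrier_leaf.
by exists w; split=> //; exact: carrier_leaf.
Qed.

Lemma leaf_arc_choice : arc_choice Omega C leaf_arc.
Proof.
move=> X CX; have [->|/set0P] := eqVneq (leaf_arc X) set0; first by left.
move=> /leaf_arcE [w [Bw E1 E2]]; right; rewrite E2; split.
  exact: leaf_circular.
by rewrite E1.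
Qed.

Lemma chosen_leaf A : chosen_arcs C leaf_arc A <->
  exists w, B w /\ A = leaf (lin n w).
Proof.
split=> [[A0 [X [CX AX]]]|[w [Bw ->]]].
  by move: A0; rewrite AX => /leaf_arcE [w [Bw E1 E2]]; exists w.
split; first by exists (G w); have [OG FG] := GP Bw; split; rewrite ?FG.
exists (S (lin n w)); have [CS _ _] := SP Bw Bw; split=> //.
by rewrite leaf_arc_carrier.
Qed.

Lemma chosen_arc_circular A : chosen_arcs C leaf_arc A ->
  circular_arc A /\ A `<=` Omega.
Proof.
by move=> /chosen_leaf [w [Bw ->]]; split; [exact: leaf_circular|move=> q []].
Qed.

Lemma image_chosen_leaves :
  [set F @` A | A in chosen_arcs C leaf_arc] = parallel_leaves B v.
Proof.
apply/seteqP; split=> A /=.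
  move=> [A' /chosen_leaf [w [Bw ->]] <-]; rewrite leaf_image; split.
    by exists w; split=> //; exists 0; rewrite !mul0r !addr0 -surjective_pairing.
  by exists w.
move=> [[w wA] [p Ap]]; move: wA; rewrite Ap => -[lw Bw].
exists (leaf (lin n w)); first by apply/chosen_leaf; exists w.
rewrite leaf_image; apply/seteqP; split=> q [/lin_line lq Bq]; split=> //;
  apply/lin_line; move/lin_line: lw => lw; congruence.
Qed.

Lemma parallel_leaf_connected A : parallel_leaves B v A -> connected A.
Proof.
by move=> [_ [p ->]]; exact: line_box_connected.
Qed.

End Foliation.

(** The local form of [cuts_leaves]: near w0 the member S u contains exactly those
    points whose coordinate lin n has the value u. *)
Definition web_family C (S : R -> set (plane R)) G (rho : R) (n w0 : plane R) :=
  (\forall u \near lin n w0, C (S u) /\ arc_carrier rho (S u)) /\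
  (\forall z \near ((lin n w0, w0) : R * plane R),
     S z.1 (G z.2) <-> lin n z.2 = z.1).

Lemma ball_of_near (P : set (plane R)) w0 : nbhs w0 P ->
  exists e : R, 0 < e /\ forall w, ball w0 e w -> P w.
Proof. by move=> /nbhs_ballP [e e0 eP]; exists e. Qed.

Lemma web_family_near C (S : R -> set (plane R)) G rho n w0 : web_family C S G rho n w0 ->
  \forall e \near 0^'+, cuts_leaves rho (ball w0 e) G C S n.
Proof.
move=> [H1 [[P Q] [/= nP nQ] PQ]].
have al : analytic_near (lin n) w0 by rewrite /lin; analytic.
have cl := an_continuous al.
have L1 : \forall w \near w0, C (S (lin n w)) /\ arc_carrier rho (S (lin n w)).
  exact: (cl (fun u => C (S u) /\ arc_carrier rho (S u)) H1).
have L2 : \forall w \near w0, P (lin n w) by exact: (cl P nP).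
have [e0 [e00 L]] := ball_of_near (filterI (filterI L1 L2) nQ).
near=> e => w w' Bw Bw'.
have ee : e <= e0 by near: e; exact: nbhs_right_le.
have [[[h1 h2] h3] _] := L _ (le_ball ee Bw).
have [_ h4] := L _ (le_ball ee Bw').
by split=> //; apply: (PQ (lin n w, w')).
Unshelve. all: by end_near. Qed.

Lemma box_convex w0 (e : R) p q t :
  ball w0 e p -> ball w0 e q -> 0 <= t <= 1 ->
  ball w0 e ((p.1 + t * (q.1 - p.1), p.2 + t * (q.2 - p.2)) : plane R).
Proof.
have H (a x y : R) : `|a - x| < e -> `|a - y| < e -> 0 <= t <= 1 ->
    `|a - (x + t * (y - x))| < e.
  rewrite !ltr_norml => /andP[h1 h2] /andP[h3 h4] /andP[t0 t1].
  have -> : a - (x + t * (y - x)) = (1 - t) * (a - x) + t * (a - y) by ring.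
  have [->|tn0] := eqVneq t 0; first by rewrite subr0 mul1r mul0r addr0 h1 h2.
  have t0' : 0 < t by rewrite lt_neqAle eq_sym tn0.
  by apply/andP; split; nra.
by move=> [p1 p2] [q1 q2] t01; split; exact: H.
Qed.

Lemma ball_sqdist p0 (d rho : R) p q : d <= 1 -> 8 * d <= rho ->
  ball p0 d p -> ball p0 d q -> sqdist p q < rho.
Proof.
move=> d1 dr [p1 p2] [q1 q2].
have H (a x y : R) : `|a - x| < d -> `|a - y| < d -> (x - y) ^+ 2 < 4 * d.
  rewrite !ltr_norml => /andP[h1 h2] /andP[h3 h4].
  have k1 : x - y < 2 * d by lra.
  have k2 : - (2 * d) < x - y by lra.
  have d0 : 0 < d by lra.
  nra.
have h1 : (p.1 - q.1) ^+ 2 < 4 * d by exact: H p1 q1.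
have h2 : (p.2 - q.2) ^+ 2 < 4 * d by exact: H p2 q2.
rewrite /sqdist; lra.
Qed.

Lemma analytic_map_near F p0 : analytic_map F p0 ->
  \forall p \near p0, germ (fun q => (F q).1) p /\ germ (fun q => (F q).2) p.
Proof. by move=> [/analytic2_near a1 /analytic2_near a2]; apply: filterI. Qed.

Lemma germ_map_continuous F p : germ (fun q => (F q).1) p ->
  germ (fun q => (F q).2) p -> {for p, continuous F}.
Proof.
move=> /germ_continuous F1 /germ_continuous F2.
rewrite (_ : F = fun z => ((F z).1, (F z).2)); last by apply/funext => z; case: (F z).
exact: (@cvg_pair _ _ _ (nbhs p) (nbhs (F p).1) (nbhs (F p).2) _ _ _ _ _ F1 F2).
Qed.

(** The arcs chosen on one set for the first two families are disjoint, as is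
    required when these families coincide. *)
Definition contains_web (C1 C2 C3 : set (set (plane R))) :=
  exists Omega s1 s2 s3, web_from_choices Omega C1 C2 C3 s1 s2 s3 /\
    (forall X, s1 X `&` s2 X = set0).

(** The domain is the image of a small square of the chart.  The leaves are the
    images of the intersections of this square with parallel lines in three
    directions, hence connected, and they are traces of the domain on lines and
    circles.  A trace cannot be a leaf of two of the families, as a segment of
    the square in one direction is not a segment in another. *)
Lemma web_of_chart (C1 C2 C3 : set (set (plane R))) F G p0 w0 rho
    (S1 S2 S3 : R -> set (plane R)) :
  0 < rho -> local_iso F G p0 w0 ->
  web_family C1 S1 G rho (1, 0) w0 -> web_family C2 S2 G rho (0, 1) w0 ->
  web_family C3 S3 G rho (1, 1) w0 ->
  contains_web C1 C2 C3.
Proof.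
move=> rho0 iFG f1 f2 f3; have Gw0 := local_iso_center iFG.
have [Fp0 aF aG GF FG] := iFG.
pose d := Num.min 1 (rho / 8).
have d0 : 0 < d by rewrite lt_min ltr01 divr_gt0.
have d1 : d <= 1 by rewrite ge_min lexx.
have d8 : 8 * d <= rho by rewrite mulrC -ler_pdivlMr // ge_min lexx orbT.
have nd : \forall p \near p0, ball p0 d p by exact: nbhsx_ballx.
pose U0 : set (plane R) := [set p | [/\ G (F p) = p, germ (fun q => (F q).1) p,
  germ (fun q => (F q).2) p & ball p0 d p]].
have nU : nbhs p0 U0.
  by apply: filterS3 GF (analytic_map_near aF) nd => p h1 [h2 h3] h4.
pose U := interior U0.
have oU : open U by exact: open_interior.
have UP p : U p -> [/\ G (F p) = p, germ (fun q => (F q).1) p,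
    germ (fun q => (F q).2) p & ball p0 d p].
  by move=> /interior_subset.
have GU : \forall w \near w0, U (G w).
  apply: (near_comp (P := U)); first exact: analytic_map_continuous.
  by rewrite Gw0; exact: (nbhs_interior nU).
have [e0 [e00 L]] := ball_of_near (filterI (filterI FG (analytic_map_near aG)) GU).
have [e [[e0' ee0] [W1 W2] W3]] : exists e : R, [/\ 0 < e /\ e <= e0,
    cuts_leaves rho (ball w0 e) G C1 S1 (1, 0) /\
    cuts_leaves rho (ball w0 e) G C2 S2 (0, 1)
    & cuts_leaves rho (ball w0 e) G C3 S3 (1, 1)].
  apply: (@filter_ex _ (0 : R)^'+).
  have pos : \forall e \near (0 : R)^'+, 0 < e /\ e <= e0.
    by apply: filterI; [exact: nbhs_right_gt|exact: nbhs_right_le].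
  apply: filterS3 (filterI pos (web_family_near f1)) (web_family_near f2)
    (web_family_near f3) => e [e0' W1] W2 W3.
  by split.
pose B := ball w0 e : set (plane R).
pose Omega := U `&` F @^-1` B.
have BL w : B w -> [/\ F (G w) = w, germ (fun q => (G q).1) w,
    germ (fun q => (G q).2) w & U (G w)].
  by move=> Bw; have [[h1 [h2 h3]] h4] := L w (le_ball ee0 Bw).
have oB : open B by exact: ball_open.
have oOmega : open Omega.
  rewrite openE => p [Up Bp]; have [_ g1 g2 _] := UP p Up.
  apply: filterI; first by apply: open_nbhs_nbhs; split.
  by apply: (germ_map_continuous g1 g2); apply: open_nbhs_nbhs; split.
have FP p : Omega p -> B (F p) /\ G (F p) = p.
  by move=> [Up Bp]; have [? _ _ _] := UP p Up.
have GP w : B w -> Omega (G w) /\ F (G w) = w.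
  by move=> Bw; have [FGw _ _ UG] := BL w Bw; split=> //; split=> //=; rewrite FGw.
have cG w : B w -> {for w, continuous G}.
  by move=> Bw; have [_ g1 g2 _] := BL w Bw; exact: germ_map_continuous.
have small p q : Omega p -> Omega q -> sqdist p q < rho.
  move=> [Up _] [Uq _]; have [_ _ _ hp] := UP p Up; have [_ _ _ hq] := UP q Uq.
  exact: ball_sqdist hp hq.
have convB := @box_convex w0 e.
have Bw0 : B w0 by exact: ballxx.
pose ta : plane R := (0, 0); pose tb : plane R := (0, 1); pose tc : plane R := (-1, 1).
have ne (x y : R) : (x != 0) || (y != 0) -> ((x, y) : plane R) != 0.
  by move=> xy; rewrite -pair_eqE /pair_eq /= negb_and.
have n1 : ((1, 0) : plane R) != 0 by apply: ne; rewrite oner_neq0.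
have n2 : ((0, 1) : plane R) != 0 by apply: ne; rewrite oner_neq0 orbT.
have n3 : ((1, 1) : plane R) != 0 by apply: ne; rewrite oner_neq0.
have v1 : vec ta tb != 0 by apply: ne; rewrite /= !subr0 oner_neq0 orbT.
have v2 : vec tb tc != 0 by apply: ne; rewrite /= subr0 oppr_eq0 oner_neq0.
have v3 : vec tc ta != 0 by apply: ne; rewrite /= opprK add0r oner_neq0.
have l1 : lin (1, 0) (vec ta tb) = 0 by rewrite /lin /=; ring.
have l2 : lin (0, 1) (vec tb tc) = 0 by rewrite /lin /=; ring.
have l3 : lin (1, 1) (vec tc ta) = 0 by rewrite /lin /=; ring.
exists Omega, (leaf_arc Omega B F (1, 0)), (leaf_arc Omega B F (0, 1)),
  (leaf_arc Omega B F (1, 1)); split; last first.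
  move=> X; apply: contrapT => /eqP /set0P [q [q1 q2]].
  have [|a [Ba Xa Ea]] := @leaf_arcE Omega B F (1, 0) X; first by exists q.
  have [|b [Bb Xb Eb]] := @leaf_arcE Omega B F (0, 1) X; first by exists q.
  (* two points on one leaf of the first family with different second coordinates *)
  pose w' : plane R := (a.1, w0.2 + e / 2); pose w'' : plane R := (a.1, w0.2).
  have e2 : 0 < e / 2 by rewrite divr_gt0.
  have e2' : e / 2 < e by rewrite ltr_pdivrMr // ltr_pMr // ltr1n.
  have Bw' : B w'.
    split; first by case: Ba.
    by rewrite /ball /= opprD addrA subrr add0r normrN gtr0_norm.
  have Bw'' : B w'' by split; [case: Ba|exact: ballxx].
  have H w : B w -> w.1 = a.1 -> w.2 = lin (0, 1) b.
    move=> Bw wa; have [Ow FGw] := GP w Bw.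
    have : leaf Omega F (1, 0) (lin (1, 0) a) (G w).
      by split=> //; rewrite FGw /lin /= wa !mul0r.
    rewrite -Xa Xb => -[_]; rewrite FGw /lin /= => <-.
    by rewrite mul0r mul1r add0r.
  have := H w' Bw' erefl; rewrite -(H w'' Bw'' erefl) /= => /eqP.
  by rewrite -subr_eq0 addrAC subrr add0r gt_eqF.
split.
- split; [by exists (G w0); case: (GP w0 Bw0)|exact: oOmega|].
  have -> : Omega = G @` B.
    apply/seteqP; split=> p.
      by move=> Op; have [BF GFp] := FP p Op; exists (F p).
    by move=> [w Bw <-]; case: (GP w Bw).
  apply: connected_continuous_connected; first exact: convex_connected.
  by apply: continuous_in_subspaceT => q /set_mem; exact: cG.
- split.
  + exact: (leaf_arc_choice oOmega rho0 small convB FP GP cG n1 v1 l1 W1).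
  + exact: (leaf_arc_choice oOmega rho0 small convB FP GP cG n2 v2 l2 W2).
  + exact: (leaf_arc_choice oOmega rho0 small convB FP GP cG n3 v3 l3 W3).
- split.
    move=> A [|[|]].
    + exact: (chosen_arc_circular oOmega rho0 small convB FP GP cG n1 v1 l1 W1).
    + exact: (chosen_arc_circular oOmega rho0 small convB FP GP cG n2 v2 l2 W2).
    + exact: (chosen_arc_circular oOmega rho0 small convB FP GP cG n3 v3 l3 W3).
  exists ta, tb, tc, B, F; split.
  + by rewrite /triangle /=; apply/eqP => E; nra.
  + split=> //.
    * split.
      - by move=> p /FP [].
      - move=> p q /set_mem Op /set_mem Oq E.
        by have [_ <-] := FP p Op; have [_ <-] := FP q Oq; rewrite E.
      - by move=> w /GP [Ow Fw]; exists (G w).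
    * by move=> p [Up _]; have [_ g1 g2 _] := UP p Up; split; exact: germ_analytic.
    * exists G; split; first by move=> p /FP [].
      by move=> w /BL [_ g1 g2 _]; split; exact: germ_analytic.
  + split.
    * exact: (image_chosen_leaves FP GP n1 v1 l1 W1).
    * exact: (image_chosen_leaves FP GP n2 v2 l2 W2).
    * exact: (image_chosen_leaves FP GP n3 v3 l3 W3).
  + move=> A [|[|]].
    * exact: (parallel_leaf_connected convB n1 v1 l1).
    * exact: (parallel_leaf_connected convB n2 v2 l2).
    * exact: (parallel_leaf_connected convB n3 v3 l3).
Qed.

Lemma contains_web_twice C C3 : contains_web C C C3 ->
  contains_hexagonal_web_twice C C3.
Proof.
by move=> [Om [s1 [s2 [s3 [w d]]]]]; exists Om, s1, s2, s3; split=> // X _; exact: d.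
Qed.

Lemma contains_web_hexagonal C1 C2 C3 : contains_web C1 C2 C3 ->
  contains_hexagonal_web C1 C2 C3.
Proof. by move=> [Om [s1 [s2 [s3 [w _]]]]]; exists Om, s1, s2, s3. Qed.

End WebOfChart.

(** * Equations of pencils of circles *)

Section Pencils.
Context {R : realType}.
Implicit Types (p q c v w z X : plane R) (S : set (plane R)).
Implicit Types (e f g s m : plane R -> R).

Definition in_span e1 e2 f :=
  exists a b : R, forall X, f X = a * e1 X + b * e2 X.

Lemma in_span_comb e1 e2 f g (a b : R) : in_span e1 e2 f -> in_span e1 e2 g ->
  in_span e1 e2 (fun X => a * f X + b * g X).
Proof.
move=> [a1 [b1 fE]] [a2 [b2 gE]]; exists (a * a1 + b * a2), (a * b1 + b * b2) => X.
by rewrite fE gE; ring.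
Qed.

Lemma circle_proper S : is_circle S -> S <> setT.
Proof.
move=> [[c [r [r0 ->]]]|[p [v [v0 ->]]]] E.
  have : circle c r c by rewrite E.
  move/circleE => /(_ (ltW r0)); rewrite /sqdist !subrr expr0n addr0 => /esym/eqP.
  by rewrite sqrf_eq0 gt_eqF.
have : line p v (p.1 - v.2, p.2 + v.1) by rewrite E.
move=> [t [E1 E2]]; have := plane_neq0 v0.
have h1 : t * v.1 = - v.2 by lra.
have h2 : t * v.2 = v.1 by lra.
have -> : v.1 ^+ 2 + v.2 ^+ 2 = 0.
  transitivity (v.1 * (t * v.2) - v.2 * (t * v.1)); last by ring.
  by rewrite h1 h2; ring.
by rewrite ltxx.
Qed.

Lemma circle_not_pair S p q : is_circle S -> S <> [set p; q].
Proof.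
have key (a b d : plane R) : [set p; q] a -> [set p; q] b -> [set p; q] d ->
    a <> b -> b <> d -> a <> d -> False.
  by move=> [->|->] [->|->] [->|->].
move=> [[c [r [r0 ->]]]|[x [v [v0 ->]]]] E.
  have rn : r != 0 by rewrite gt_eqF.
  have on x : sqdist x c = r ^+ 2 -> [set p; q] x.
    by rewrite -E => h; apply/circleE; rewrite // ltW.
  apply: (key (c.1 + r, c.2) (c.1 - r, c.2) (c.1, c.2 + r)).
  - by apply: on; rewrite /sqdist /=; ring.
  - by apply: on; rewrite /sqdist /=; ring.
  - by apply: on; rewrite /sqdist /=; ring.
  - by move=> [h]; lra.
  - by move=> [h _]; lra.
  - by move=> [h _]; lra.
have on t : [set p; q] (x.1 + t * v.1, x.2 + t * v.2) by rewrite -E; exists t.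
have ne (s t : R) : s != t ->
    ((x.1 + s * v.1, x.2 + s * v.2) : plane R) <> (x.1 + t * v.1, x.2 + t * v.2).
  move=> st [h1 h2]; have := plane_neq0 v0.
  have st0 : s - t != 0 by rewrite subr_eq0.
  have -> : v.1 = 0 by apply: (mulfI st0); rewrite mulr0; lra.
  have -> : v.2 = 0 by apply: (mulfI st0); rewrite mulr0; lra.
  by rewrite expr0n addr0 ltxx.
apply: (key _ _ _ (on 0) (on 1) (on 2)); apply: ne; rewrite -subr_eq0.
- by apply/eqP; lra.
- by apply/eqP; lra.
- by apply/eqP; lra.
Qed.

Lemma pencil_member e1 e2 f S : in_span e1 e2 f -> is_circle S -> S = zeros f ->
  pencil e1 e2 S.
Proof.
move=> [a [b fE]] cS SE; split=> //; exists a, b; split.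
  apply/eqP => -[a0 b0]; apply: (circle_proper cS); rewrite SE.
  by apply/seteqP; split=> // X _; rewrite /zeros /= fE a0 b0 !mul0r addr0.
by rewrite SE; congr zeros; apply/funext.
Qed.

(** If the determinant of the coefficients vanished, the two equations would be
    proportional and have the same zeros. *)
Lemma in_span_basis e1 e2 s m (a1 k1 a2 k2 : R) :
  (forall X, e1 X = a1 * s X + k1 * m X) ->
  (forall X, e2 X = a2 * s X + k2 * m X) ->
  zeros e1 <> setT -> zeros e2 <> setT -> zeros e1 <> zeros e2 ->
  in_span e1 e2 s /\ in_span e1 e2 m.
Proof.
move=> E1 E2 z1 z2 z12.
have [D0|D0] := eqVneq (a1 * k2 - a2 * k1) 0; last first.
  split; [exists (k2 / (a1 * k2 - a2 * k1)), (- k1 / (a1 * k2 - a2 * k1))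
         |exists (- a2 / (a1 * k2 - a2 * k1)), (a1 / (a1 * k2 - a2 * k1))] => X;
  by rewrite E1 E2; field.
exfalso.
have n1 : (a1 != 0) || (k1 != 0).
  rewrite -negb_and; apply/negP => /andP[/eqP a0 /eqP k0]; apply: z1.
  by apply/seteqP; split=> // X _; rewrite /zeros /= E1 a0 k0 !mul0r addr0.
have n2 : (a2 != 0) || (k2 != 0).
  rewrite -negb_and; apply/negP => /andP[/eqP a0 /eqP k0]; apply: z2.
  by apply/seteqP; split=> // X _; rewrite /zeros /= E2 a0 k0 !mul0r addr0.
suff [t [t0 E]] : exists t : R, t != 0 /\ forall X, e2 X = t * e1 X.
  apply: z12; apply/seteqP; split=> X; rewrite /zeros /= E; first by move=> ->; rewrite mulr0.
  by move=> /eqP; rewrite mulf_eq0 (negbTE t0) /= => /eqP.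
have [a10|a10] := eqVneq a1 0.
  have k10 : k1 != 0 by rewrite a10 eqxx in n1.
  have a20 : a2 = 0.
    by move/eqP: D0; rewrite a10 mul0r add0r oppr_eq0 mulf_eq0 (negbTE k10) orbF => /eqP.
  have k20 : k2 != 0 by rewrite a20 eqxx in n2.
  exists (k2 / k1); split; first by rewrite mulf_neq0 // invr_eq0.
  by move=> X; rewrite E1 E2 a10 a20; field.
have k2E : k2 = a2 * k1 / a1.
  by apply: (mulfI a10); rewrite mulrCA divff // mulr1; apply/eqP; rewrite -subr_eq0 D0.
have a20 : a2 != 0.
  by apply/negP => /eqP a20; move: n2; rewrite k2E a20 !mul0r eqxx.
exists (a2 / a1); split; first by rewrite mulf_neq0 // invr_eq0.
by move=> X; rewrite E1 E2 k2E; field.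
Qed.

(** The zero set of a circle equation is symmetric about the centre, and that of
    a line equation is invariant under a translation.  A single zero is therefore
    the centre, and is counted twice. *)
Lemma circle_polynomial_point e p : circle_polynomial e -> zeros e = [set p] ->
  exists k : R, k != 0 /\ forall X, e X = k * sqdist X p.
Proof.
move=> [a [b [c [d ->]]]] ze.
set e0 := fun X => _ in ze *.
have ep : e0 p = 0 by have : zeros e0 p by rewrite ze.
have uniq X : e0 X = 0 -> X = p by move=> h; have : zeros e0 X by []; rewrite ze.
have [a0|a0] := eqVneq a 0.
  exfalso.
  have E1 : ((p.1 - c, p.2 + b) : plane R) = p.
    by apply: uniq; rewrite -ep /e0 /= a0; ring.
  have c0 : c = 0 by have := congr1 fst E1; rewrite /=; lra.
  have b0 : b = 0 by have := congr1 snd E1; rewrite /=; lra.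
  have E2 : ((p.1 + 1, p.2) : plane R) = p.
    by apply: uniq; rewrite -ep /e0 /= a0 b0 c0; ring.
  by have := congr1 fst E2; rewrite /=; lra.
have E : ((- b / a - p.1, - c / a - p.2) : plane R) = p.
  by apply: uniq; rewrite -ep /e0 /=; field.
have bE : b = - (2 * a * p.1).
  have := congr1 (fun z => a * fst z) E; rewrite /= mulrBr mulrCA divff // mulr1; lra.
have cE : c = - (2 * a * p.2).
  have := congr1 (fun z => a * snd z) E; rewrite /= mulrBr mulrCA divff // mulr1; lra.
exists a; split=> // X; rewrite -[LHS]subr0 -[X in _ - X]ep /e0 /sqdist bE cE; ring.
Qed.

Lemma circle_polynomial_comb e1 e2 (a b : R) :
  circle_polynomial e1 -> circle_polynomial e2 ->
  circle_polynomial (fun X => a * e1 X + b * e2 X).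
Proof.
move=> [a1 [b1 [c1 [d1 ->]]]] [a2 [b2 [c2 [d2 ->]]]].
exists (a * a1 + b * a2), (a * b1 + b * b2), (a * c1 + b * c2), (a * d1 + b * d2).
by apply/funext => X; ring.
Qed.

Lemma point_locus_span e1 e2 p : circle_polynomial e1 -> circle_polynomial e2 ->
  pencil_loci e1 e2 [set p] -> in_span e1 e2 (sqdist^~ p).
Proof.
move=> c1 c2 [a [b [_ E]]].
have [k [k0 kE]] := circle_polynomial_point (circle_polynomial_comb a b c1 c2) (esym E).
exists (a / k), (b / k) => X.
by apply: (mulfI k0); rewrite -kE; field.
Qed.

Lemma hyperbolic_pencil_span P p q : hyperbolic_pencil P p q ->
  exists e1 e2, [/\ P = pencil e1 e2, p <> q, in_span e1 e2 (sqdist^~ p)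
    & in_span e1 e2 (sqdist^~ q)].
Proof.
move=> [e1 [e2 [S1 [S2 [[c1 _ _] [c2 _ _] PE _ [pq lp lq]]]]]].
by exists e1, e2; split=> //; exact: point_locus_span.
Qed.

(** Vanishing at p and q leaves a two-dimensional space of equations, spanned by
    the circle with diameter pq and the line pq. *)
Lemma elliptic_pencil_span P p q : elliptic_pencil P p q ->
  exists e1 e2, [/\ P = pencil e1 e2, p <> q,
    in_span e1 e2 (fun X => (X.1 - p.1) * (X.1 - q.1) + (X.2 - p.2) * (X.2 - q.2))
    & in_span e1 e2 (fun X => (X.1 - p.1) * (q.2 - p.2) - (X.2 - p.2) * (q.1 - p.1))].
Proof.
move=> [e1 [e2 [S1 [S2 [[c1 s1 E1] [c2 s2 E2] PE [pq S12]]]]]].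
exists e1, e2.
set s := (fun X => (X.1 - p.1) * (X.1 - q.1) + _).
set m := (fun X => (X.1 - p.1) * (q.2 - p.2) - _).
have n0 := sqdist_gt0 (nesym pq).
set n := sqdist q p in n0; have nn : n != 0 by rewrite gt_eqF.
have key e : circle_polynomial e -> e p = 0 -> e q = 0 ->
    exists a k : R, forall X, e X = a * s X + k * m X.
  move=> [a [b [c [d ->]]]] ep eq.
  pose al := b + a * (p.1 + q.1); pose be := c + a * (p.2 + q.2).
  exists a, ((al * (q.2 - p.2) - be * (q.1 - p.1)) / n) => X.
  have dE : d = - (al * p.1 + be * p.2 - a * (p.1 * q.1 + p.2 * q.2)).
    by rewrite /al /be; lra.
  have albe : al * (q.1 - p.1) + be * (q.2 - p.2) = 0.
    by rewrite /al /be; lra.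
  have -> : a * (X.1 ^+ 2 + X.2 ^+ 2) + b * X.1 + c * X.2 + d =
     a * s X + (al * (X.1 - p.1) + be * (X.2 - p.2)).
    by rewrite dE /s /al /be; ring.
  congr (_ + _); apply: (mulIf nn); rewrite mulrAC divfK //.
  transitivity ((al * (q.2 - p.2) - be * (q.1 - p.1)) * m X +
    (al * (q.1 - p.1) + be * (q.2 - p.2)) *
    ((X.1 - p.1) * (q.1 - p.1) + (X.2 - p.2) * (q.2 - p.2))).
    by rewrite /m /n /sqdist; ring.
  by rewrite albe mul0r addr0.
have [[p1 p2] [q1 q2]] : (e1 p = 0 /\ e2 p = 0) /\ (e1 q = 0 /\ e2 q = 0).
  have : (S1 `&` S2) p by rewrite S12; left.
  have : (S1 `&` S2) q by rewrite S12; right.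
  by rewrite E1 E2.
have [a1 [k1 F1]] := key e1 c1 p1 q1.
have [a2 [k2 F2]] := key e2 c2 p2 q2.
have [|||h1 h2] := @in_span_basis e1 e2 s m a1 k1 a2 k2 F1 F2.
- by rewrite -E1; exact: circle_proper.
- by rewrite -E2; exact: circle_proper.
- rewrite -E1 -E2 => E; move: S12; rewrite -E setIid.
  exact: circle_not_pair.
by split.
Qed.

Lemma is_derive_zero (f : R -> R) (l : R) : is_derive (0 : R) (1 : R) f l ->
  (\forall t \near (0 : R), f t = 0) -> l = 0.
Proof.
move=> df f0.
have d0 : is_derive (0 : R) (1 : R) (fun=> 0 : R) l.
  exact: near_eq_is_derive f0 df.
have d1 := is_derive_const (0 : R) (0 : R).
by rewrite -(@derive_val _ _ _ _ _ _ _ d0) (@derive_val _ _ _ _ _ _ _ d1).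
Qed.

Lemma line_tangent_direction p v w : line p v = line p w -> v != 0 ->
  exists t, t != 0 /\ w = (t * v.1, t * v.2).
Proof.
move=> E v0.
have : line p w (p.1 + v.1, p.2 + v.2).
  by rewrite -E; exists 1; rewrite !mul1r.
move=> [s [h1 h2]].
have v1 : v.1 = s * w.1 by lra.
have v2 : v.2 = s * w.2 by lra.
have s0 : s != 0.
  apply: contra_neq v0 => s0; rewrite [v]surjective_pairing v1 v2 s0 !mul0r //.
exists s^-1; split; first by rewrite invr_eq0.
by rewrite v1 v2 !mulKf // -surjective_pairing.
Qed.

(** Differentiating the equations along the two curves shows that their gradients
    at p are orthogonal to v; with their value 0 at p this leaves only multiples
    of the two functions on the right. *)
Lemma parabolic_pencil_span P p : parabolic_pencil P p ->
  exists e1 e2 v, [/\ P = pencil e1 e2, v != 0, in_span e1 e2 (sqdist^~ p)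
    & in_span e1 e2 (fun X => (X.2 - p.2) * v.1 - (X.1 - p.1) * v.2)].
Proof.
move=> [e1 [e2 [S1 [S2 [[c1 s1 E1] [c2 s2 E2] PE [S12 [L [T1 T2]]]]]]]].
have [x1 [y1 [v [[x10 y10] K1 [dx1 dy1] v0 LE]]]] := T1.
have [x2 [y2 [w [[x20 y20] K2 [dx2 dy2] w0 LE2]]]] := T2.
exists e1, e2, v.
set m := (fun X => (X.2 - p.2) * v.1 - _).
have n0 := plane_neq0 v0.
set n := (_ + _) in n0; have nn : n != 0 by rewrite gt_eqF.
have key e x y u (t : R) : circle_polynomial e -> x 0 = p.1 -> y 0 = p.2 ->
    (\forall t \near (0 : R), e (x t, y t) = 0) ->
    is_derive (0 : R) (1 : R) x u.1 -> is_derive (0 : R) (1 : R) y u.2 ->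
    t != 0 -> u = (t * v.1, t * v.2) ->
    exists a k : R, forall X, e X = a * sqdist X p + k * m X.
  move=> [a [b [c [d ->]]]] x0 y0 exy dx dy t0 uE.
  have ep : a * (p.1 ^+ 2 + p.2 ^+ 2) + b * p.1 + c * p.2 + d = 0.
    by have := nbhs_singleton exy; rewrite /= x0 y0.
  pose al := 2 * a * p.1 + b; pose be := 2 * a * p.2 + c.
  have albe : al * u.1 + be * u.2 = 0.
    have D := is_derive_add (is_derive_add (is_derive_add
      (is_derive_mul (is_derive_const 0 a)
        (is_derive_add (is_derive_mul dx dx) (is_derive_mul dy dy)))
      (is_derive_mul (is_derive_const 0 b) dx))
      (is_derive_mul (is_derive_const 0 c) dy)) (is_derive_const 0 d).
    have := is_derive_zero D; rewrite x0 y0 /al /be => H.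
    apply: etrans (H _); first by ring.
    by apply: filterS exy => s /= <-; rewrite !expr2.
  have albe' : al * v.1 + be * v.2 = 0.
    by apply: (mulfI t0); rewrite mulr0 -albe uE /=; ring.
  exists a, ((be * v.1 - al * v.2) / n) => X.
  have dE : d = - (a * (p.1 ^+ 2 + p.2 ^+ 2) + b * p.1 + c * p.2) by lra.
  have -> : a * (X.1 ^+ 2 + X.2 ^+ 2) + b * X.1 + c * X.2 + d =
     a * sqdist X p + (al * (X.1 - p.1) + be * (X.2 - p.2)).
    by rewrite dE /sqdist /al /be; ring.
  congr (_ + _); apply: (mulIf nn); rewrite mulrAC divfK //.
  transitivity ((be * v.1 - al * v.2) * m X + (al * v.1 + be * v.2) *
    ((X.1 - p.1) * v.1 + (X.2 - p.2) * v.2)).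
    by rewrite /m /n; ring.
  by rewrite albe' mul0r addr0.
have vE : v = (1 * v.1, 1 * v.2) by rewrite !mul1r -surjective_pairing.
have [t [t0 wE]] := line_tangent_direction (etrans (esym LE) LE2) v0.
have [|a1 [k1 F1]] := key e1 x1 y1 v 1 c1 x10 y10 _ dx1 dy1 (oner_neq0 _) vE.
  by apply: filterS K1 => s; rewrite E1.
have [|a2 [k2 F2]] := key e2 x2 y2 w t c2 x20 y20 _ dx2 dy2 t0 wE.
  by apply: filterS K2 => s; rewrite E2.
have [|||h1 h2] := @in_span_basis e1 e2 (sqdist^~ p) m a1 k1 a2 k2 F1 F2.
- by rewrite -E1; exact: circle_proper.
- by rewrite -E2; exact: circle_proper.
- by rewrite -E1 -E2.
by split.
Qed.

End Pencils.

(** * Euclidean frames *)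

Section Frames.
Context {R : realType}.
Implicit Types (o e p q c v w z : plane R) (S K L : set (plane R)).
Implicit Types (C : set (set (plane R))).

(** Cartesian coordinates with origin o and unit first axis e. *)
Definition frame o e z : plane R :=
  (o.1 + z.1 * e.1 - z.2 * e.2, o.2 + z.1 * e.2 + z.2 * e.1).

Definition coframe o e q : plane R :=
  ((q.1 - o.1) * e.1 + (q.2 - o.2) * e.2, (q.2 - o.2) * e.1 - (q.1 - o.1) * e.2).

Definition turn e v : plane R := (v.1 * e.1 - v.2 * e.2, v.1 * e.2 + v.2 * e.1).

Section Frame.
Variables o e : plane R.
Hypothesis e1 : e.1 ^+ 2 + e.2 ^+ 2 = 1.
Local Notation fr := (frame o e).
Local Notation co := (coframe o e).

Lemma frameK z : co (fr z) = z.
Proof.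
rewrite [RHS]surjective_pairing /coframe /frame /=; congr (_, _).
  by rewrite -[RHS]mulr1 -e1; ring.
by rewrite -[RHS]mulr1 -e1; ring.
Qed.

Lemma coframeK q : fr (co q) = q.
Proof.
rewrite [RHS]surjective_pairing /coframe /frame /=; congr (_, _).
  transitivity (o.1 + (q.1 - o.1) * (e.1 ^+ 2 + e.2 ^+ 2)); first by ring.
  by rewrite e1 mulr1 subrKC.
transitivity (o.2 + (q.2 - o.2) * (e.1 ^+ 2 + e.2 ^+ 2)); first by ring.
by rewrite e1 mulr1 subrKC.
Qed.

Lemma sqdist_frame z w : sqdist (fr z) (fr w) = sqdist z w.
Proof. by rewrite /sqdist /frame /= -[RHS]mulr1 -e1; ring. Qed.

Lemma edist_frame z w : edist (fr z) (fr w) = edist z w.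
Proof. by rewrite /edist -[X in Num.sqrt X]/(sqdist (fr z) (fr w)) sqdist_frame. Qed.

Lemma frame_inj z w : fr z = fr w -> z = w.
Proof. by move=> E; rewrite -(frameK z) E frameK. Qed.

Lemma frame_image S z : (fr @` S) (fr z) <-> S z.
Proof. by split=> [[w Sw /frame_inj <-]//|Sz]; exists z. Qed.

Lemma frame_circle c r : fr @` circle c r = circle (fr c) r.
Proof.
apply/seteqP; split=> q /=.
  by move=> [z zc <-]; rewrite /circle /= edist_frame.
by move=> qc; exists (co q); rewrite ?coframeK // /circle /= -edist_frame coframeK.
Qed.

Lemma frame_line p v : fr @` line p v = line (fr p) (turn e v).
Proof.
apply/seteqP; split=> q /=.
  by move=> [z [t ->] <-]; exists t; rewrite /frame /turn /=; congr (_, _); ring.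
move=> [t ->]; exists (p.1 + t * v.1, p.2 + t * v.2); first by exists t.
by rewrite /frame /turn /=; congr (_, _); ring.
Qed.

Lemma turn_neq0 v : v != 0 -> turn e v != 0.
Proof.
move=> v0; apply/eqP => -[h1 h2].
have := plane_neq0 v0; rewrite -[X in _ < X]mulr1 -e1.
have -> : (v.1 ^+ 2 + v.2 ^+ 2) * (e.1 ^+ 2 + e.2 ^+ 2) =
  (v.1 * e.1 - v.2 * e.2) ^+ 2 + (v.1 * e.2 + v.2 * e.1) ^+ 2 by ring.
by rewrite h1 h2 expr0n addr0 ltxx.
Qed.

Lemma frame_is_line S : is_line S -> is_line (fr @` S).
Proof.
move=> [p [v [v0 ->]]]; exists (fr p), (turn e v); split; first exact: turn_neq0.
exact: frame_line.
Qed.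

Lemma frame_is_circle S : is_circle S -> is_circle (fr @` S).
Proof.
move=> [[c [r [r0 ->]]]|lS]; last by right; exact: frame_is_line.
by left; exists (fr c), r; rewrite frame_circle.
Qed.

Lemma frame_arc_carrier rho S : arc_carrier rho S -> arc_carrier rho (fr @` S).
Proof.
move=> [[c [r [r0 rr ->]]]|lS]; last by right; exact: frame_is_line.
by left; exists (fr c), r; rewrite frame_circle.
Qed.

Lemma local_iso_frame z0 : local_iso co fr (fr z0) z0.
Proof.
split; first exact: frameK.
- by split=> h k w0 ah ak _; rewrite /coframe /=; analytic.
- by split=> h k w0 ah ak _; rewrite /frame /=; analytic.
- by near=> q; rewrite coframeK.
- by near=> q; rewrite frameK.
Unshelve. all: by end_near. Qed.

Definition in_coords C : set (set (plane R)) := [set S | C (fr @` S)].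

Lemma web_in_frame (C1 C2 C3 : set (set (plane R))) (F G : plane R -> plane R)
    (p0 w0 : plane R) (rho : R) (S1 S2 S3 : R -> set (plane R)) :
  0 < rho -> local_iso F G p0 w0 ->
  web_family (in_coords C1) S1 G rho (1, 0) w0 ->
  web_family (in_coords C2) S2 G rho (0, 1) w0 ->
  web_family (in_coords C3) S3 G rho (1, 1) w0 ->
  contains_web C1 C2 C3.
Proof.
move=> rho0 iFG f1 f2 f3.
have T C n (S : R -> set (plane R)) : web_family (in_coords C) S G rho n w0 ->
    web_family C (fun u => fr @` S u) (fr \o G) rho n w0.
  move=> [h1 h2]; split.
    by apply: filterS h1 => u [Cu Au]; split=> //; exact: frame_arc_carrier.
  apply: filterS h2 => z SG; apply: iff_trans SG; exact: frame_image.
have i0 := local_iso_frame p0.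
exact: (web_of_chart rho0 (local_iso_comp i0 iFG) (T _ _ _ f1) (T _ _ _ f2) (T _ _ _ f3)).
Qed.

Lemma tangent_line_frame K L K' p :
  (forall z, K z -> K' (fr z)) -> tangent_line_at K p L ->
  tangent_line_at K' (fr p) (fr @` L).
Proof.
move=> KK [x [y [v [[x0 y0] Kxy [dx dy] v0 LE]]]].
exists (fun t => (fr (x t, y t)).1), (fun t => (fr (x t, y t)).2), (turn e v).
split.
- by rewrite /= x0 y0.
- by apply: filterS Kxy => t /KK; rewrite -surjective_pairing.
- split; rewrite /frame /turn /=.
    have := is_derive_sub (is_derive_add (is_derive_const 0 o.1)
      (is_derive_mul dx (is_derive_const 0 e.1)))
      (is_derive_mul dy (is_derive_const 0 e.2)).
    by rewrite !mulr0 !add0r [e.1 * _]mulrC [e.2 * _]mulrC.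
  have := is_derive_add (is_derive_add (is_derive_const 0 o.2)
      (is_derive_mul dx (is_derive_const 0 e.2)))
      (is_derive_mul dy (is_derive_const 0 e.1)).
  by rewrite !mulr0 !add0r [e.1 * _]mulrC [e.2 * _]mulrC.
- exact: turn_neq0.
- by rewrite LE frame_line.
Qed.

Lemma in_coords_tangent_lines K K' p L : (forall z, K z -> K' (fr z)) ->
  tangent_line_at K p L -> in_coords (tangent_lines K') L.
Proof. by move=> KK T; exists (fr p); exact: tangent_line_frame T. Qed.

Lemma in_coords_doubly_tangent K K' axis c r p q Lp Lq : (forall z, K z -> K' (fr z)) ->
  0 < r -> axis (fr c) -> p <> q ->
  tangent_line_at (circle c r) p Lp -> tangent_line_at K p Lp ->
  tangent_line_at (circle c r) q Lq -> tangent_line_at K q Lq ->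
  in_coords (doubly_tangent_circles K' axis) (circle c r).
Proof.
move=> KK r0 ax pq T1 T2 T3 T4.
have CC z : circle c r z -> (fr @` circle c r) (fr z) by exists z.
exists (fr c), r; split=> //; first exact: frame_circle.
exists (fr p), (fr q); split; first by move=> /frame_inj.
  exists (fr @` Lp); split; first exact: tangent_line_frame T1.
  exact: tangent_line_frame T2.
exists (fr @` Lq); split; first exact: tangent_line_frame T3.
exact: tangent_line_frame T4.
Qed.

Lemma in_coords_pencil P (f1 f2 f g : plane R -> R) S : P = pencil f1 f2 -> in_span f1 f2 f ->
  is_circle S -> (forall z, g z = f (fr z)) -> S = zeros g -> in_coords P S.
Proof.
move=> -> sf cS gE SE; apply: (pencil_member sf); first exact: frame_is_circle.
apply/seteqP; split=> q /=.
  by move=> [z Sz <-]; move: Sz; rewrite SE /zeros /= gE.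
by rewrite /zeros /= => fq; exists (co q); rewrite ?SE /zeros /= ?gE coframeK.
Qed.

End Frame.

Lemma foci_frame F1 F2 : F1 <> F2 -> exists o e (c : R),
  [/\ e.1 ^+ 2 + e.2 ^+ 2 = 1, 0 < c, edist F1 F2 = 2 * c,
      F1 = frame o e (c, 0) & F2 = frame o e (- c, 0)].
Proof.
move=> F12.
have d0 := sqdist_gt0 F12.
set d := edist F1 F2.
have dd : d ^+ 2 = (F1.1 - F2.1) ^+ 2 + (F1.2 - F2.2) ^+ 2 by exact: edist_sqr.
have dp : 0 < d by rewrite sqrtr_gt0.
have dn : d != 0 by rewrite gt_eqF.
exists ((F1.1 + F2.1) / 2, (F1.2 + F2.2) / 2),
  ((F1.1 - F2.1) / d, (F1.2 - F2.2) / d), (d / 2); split.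
- by rewrite /= !expr_div_n -mulrDl -dd divff // sqrf_eq0.
- by rewrite divr_gt0.
- by rewrite mulrC divfK.
- by rewrite [LHS]surjective_pairing /frame /=; congr (_, _); field.
- by rewrite [LHS]surjective_pairing /frame /=; congr (_, _); field.
Qed.

End Frames.

(** * Neighbourhoods in products *)

Section NearLemmas.
Context {R : realType}.

(** Neighbourhoods in one variable are handled through functions on the plane, for
    which analyticity is defined. *)
Lemma near_axis (P : R -> Prop) (a b : R) :
  (\forall q \near ((a, b) : plane R), P q.1) -> \forall t \near a, P t.
Proof.
move=> [[A B] [/= nA nB] AB]; apply: filterS nA => t At.
by have := AB (t, b); apply; split=> //=; exact: nbhs_singleton.
Qed.

Lemma near_gt0 (phi : R -> R) (t0 : R) : analytic_near (fun q => phi q.1) (t0, 0) ->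
  0 < phi t0 -> \forall t \near t0, 0 < phi t.
Proof.
move=> aphi p0; apply: (@near_axis (fun t => 0 < phi t) t0 0).
exact: (an_near_gt0 aphi).
Qed.

Lemma near_neq0 (phi : R -> R) (t0 : R) : analytic_near (fun q => phi q.1) (t0, 0) ->
  phi t0 != 0 -> \forall t \near t0, phi t != 0.
Proof.
move=> aphi p0; apply: (@near_axis (fun t => phi t != 0) t0 0).
exact: (an_near_neq0 aphi).
Qed.

Lemma near_product (P : R -> Prop) (Q : plane R -> Prop) (u0 : R) (w0 : plane R) :
  (\forall u \near u0, P u) -> (\forall w \near w0, Q w) ->
  \forall z \near ((u0, w0) : R * plane R), P z.1 /\ Q z.2.
Proof. by move=> nP nQ; exists (P, Q) => // -[u w] []. Qed.

End NearLemmas.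

(** * Conics: tangent lines and focal radii *)

Section Conics.
Context {R : realType}.
Implicit Types (p q c v w z : plane R) (K L : set (plane R)).

(** An ellipse for B > 0 and a hyperbola for B < 0. *)
Definition conic (a B : R) : set (plane R) :=
  [set z | z.1 ^+ 2 / a ^+ 2 + z.2 ^+ 2 / B = 1].

Definition conic_tangent (a B : R) z : set (plane R) :=
  [set q | z.1 / a ^+ 2 * q.1 + z.2 / B * q.2 = 1].

(** The conic is parametrized rationally by the slope t of the chord from the
    vertex (- a, 0), whence the hypothesis on z. *)
Lemma conic_tangent_line (a B : R) z : a != 0 -> B != 0 -> conic a B z ->
  a + z.1 != 0 ->
  tangent_line_at (conic a B) z (conic_tangent a B z) /\ is_line (conic_tangent a B z).
Proof.
move=> a0 B0 Kz az.
pose n : plane R := (z.1 / a ^+ 2, z.2 / B).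
have nz : lin n z = 1 by rewrite -Kz /lin /n /=; field; rewrite a0 B0.
have n0 : n != 0.
  by apply/eqP => n0; move: nz; rewrite n0 /lin !mul0r addr0 => /eqP; rewrite eq_sym oner_eq0.
have LE v : v != 0 -> lin n v = 0 -> conic_tangent a B z = line z v.
  move=> v0 nv; apply/seteqP; split=> q.
    by move=> Lq; apply/(lin_line n0 v0 nv); rewrite nz.
  by move=> /(lin_line n0 v0 nv); rewrite nz.
pose t0 := z.2 / (a + z.1).
pose g t := 1 + a ^+ 2 * (t0 + t) ^+ 2 / B.
have a1 : a ^+ 2 / B * z.2 ^+ 2 = (a - z.1) * (a + z.1).
  have -> : a ^+ 2 / B * z.2 ^+ 2 = a ^+ 2 * (z.2 ^+ 2 / B) by field.
  have -> : z.2 ^+ 2 / B = 1 - z.1 ^+ 2 / a ^+ 2 by rewrite -Kz addrC addKr.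
  by field.
have g0 : g 0 = 2 * a / (a + z.1).
  rewrite /g addr0 /t0 expr_div_n.
  have -> : a ^+ 2 * (z.2 ^+ 2 / (a + z.1) ^+ 2) / B =
     (a ^+ 2 / B * z.2 ^+ 2) / (a + z.1) ^+ 2 by field; rewrite az B0.
  by rewrite a1; field.
have gn : g 0 != 0 by rewrite g0 !mulf_neq0 ?invr_eq0 // pnatr_eq0.
pose dg := 2 * a ^+ 2 * t0 / B.
have dgP : is_derive (0 : R) (1 : R) g dg.
  have D := is_derive_add (is_derive_const 0 t0) (is_derive_idfun (0 : R)).
  have := is_derive_add (is_derive_const 0 1) (is_derive_mul (is_derive_mul
    (is_derive_const 0 (a ^+ 2)) (is_derive_mul D D)) (is_derive_const 0 (B^-1))).
  by congr is_derive; rewrite /dg addr0; ring.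
have igP := is_derive_inv dgP gn.
pose x t := - a + 2 * a * (g t)^-1; pose y t := (t0 + t) * (2 * a * (g t)^-1).
pose v : plane R := (2 * a * (- g 0 ^- 2 * dg),
  t0 * (2 * a * (- g 0 ^- 2 * dg)) + 2 * a * (g 0)^-1).
have dP : is_derive (0 : R) (1 : R) (fun t => 2 * a * (g t)^-1) v.1.
  have := is_derive_mul (is_derive_const 0 (2 * a)) igP.
  by congr is_derive; rewrite /v /=; ring.
have xP : is_derive (0 : R) (1 : R) x v.1.
  by have := is_derive_add (is_derive_const 0 (- a)) dP; rewrite add0r.
have yP : is_derive (0 : R) (1 : R) y v.2.
  have D := is_derive_add (is_derive_const 0 t0) (is_derive_idfun (0 : R)).
  have := is_derive_mul D dP.
  by congr is_derive; rewrite /v /= addr0; ring.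
have x0 : x 0 = z.1 by rewrite /x g0; field; rewrite az a0.
have y0 : y 0 = z.2 by rewrite /y g0 /t0; field; rewrite az a0.
have v0 : v != 0.
  apply/eqP => -[h1 h2]; move: h2; rewrite h1 mulr0 add0r => /eqP.
  by rewrite !mulf_eq0 invr_eq0 (negbTE gn) (negbTE a0) pnatr_eq0.
have nv : lin n v = 0.
  have t0E : t0 * (a + z.1) = z.2 by rewrite divfK.
  rewrite /lin /n /v /= /dg g0.
  transitivity (t0 * (a + z.1) / (a * B) * ((a + z.1) * (a - z.1) - a ^+ 2 / B * (t0 * (a + z.1)) ^+ 2)).
    by rewrite -{1}t0E; field; rewrite az B0 a0.
  by rewrite t0E a1; ring.
split; last by exists z, v; split=> //; exact: LE.
exists x, y, v; split=> //; last exact: LE.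
have : \forall t \near (0 : R), g t != 0.
  by apply: near_neq0 => //; rewrite /g; analytic.
apply: filterS => t gt; rewrite /conic /= /x /y.
have gE : (t0 + t) ^+ 2 / B = (g t - 1) / a ^+ 2 by rewrite /g; field; rewrite a0 B0.
have -> : ((t0 + t) * (2 * a / g t)) ^+ 2 / B =
   ((t0 + t) ^+ 2 / B) * (2 * a / g t) ^+ 2 by ring.
by rewrite gE; field; rewrite a0 gt.
Qed.

(** By the equation of the conic, squared focal radii are perfect squares. *)
Lemma conic_focal (a c : R) z : 0 < a -> a ^+ 2 - c ^+ 2 != 0 ->
  conic a (a ^+ 2 - c ^+ 2) z ->
  edist z (c, 0) = `|a - c * z.1 / a| /\ edist z (- c, 0) = `|a + c * z.1 / a|.
Proof.
move=> a0 B0 Kz; have an0 : a != 0 by rewrite gt_eqF.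
have E : z.2 ^+ 2 = (a ^+ 2 - c ^+ 2) * (1 - z.1 ^+ 2 / a ^+ 2).
  by rewrite -Kz; field; rewrite B0 an0.
by split; rewrite -sqrtr_sqr /edist /=; congr Num.sqrt; rewrite subr0 E; field.
Qed.

Lemma conic_sub_ellipse (a c : R) z : 0 < a -> 0 <= c -> c < a ->
  conic a (a ^+ 2 - c ^+ 2) z -> edist z (c, 0) + edist z (- c, 0) = 2 * a.
Proof.
move=> a0 c0 ca Kz.
have B0 : 0 < a ^+ 2 - c ^+ 2 by rewrite subr_gt0; nra.
have [|-> ->] := conic_focal a0 _ Kz; first by rewrite gt_eqF.
have h0 : 0 <= z.2 ^+ 2 / (a ^+ 2 - c ^+ 2) by rewrite divr_ge0 ?sqr_ge0 // ltW.
have : z.1 ^+ 2 / a ^+ 2 <= 1 by move: Kz; rewrite /conic /= => <-; rewrite lerDl.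
rewrite -expr_div_n => z1.
have -> : c * z.1 / a = c * (z.1 / a) by rewrite mulrA.
move: (z.1 / a) z1 => s s1.
have [h1 h2] : -1 <= s /\ s <= 1 by split; nra.
rewrite !ger0_norm; first by ring.
  by nra.
by nra.
Qed.

Lemma conic_sub_hyperbola (a c : R) z : 0 < a -> a < c ->
  conic a (a ^+ 2 - c ^+ 2) z -> `|edist z (c, 0) - edist z (- c, 0)| = 2 * a.
Proof.
move=> a0 ac Kz.
have B0 : a ^+ 2 - c ^+ 2 < 0 by rewrite subr_lt0; nra.
have [|-> ->] := conic_focal a0 _ Kz; first by rewrite lt_eqF.
have h0 : z.2 ^+ 2 / (a ^+ 2 - c ^+ 2) <= 0.
  by rewrite mulr_ge0_le0 ?sqr_ge0 // invr_le0 ltW.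
have : 1 <= z.1 ^+ 2 / a ^+ 2 by move: Kz; rewrite /conic /= => <-; rewrite gerDl.
rewrite -expr_div_n => z1.
have -> : c * z.1 / a = c * (z.1 / a) by rewrite mulrA.
move: (z.1 / a) z1 => s s1.
have [s0|s0] := leP 0 s.
  have s2 : 1 <= s by nra.
  have h1 : a < c * s by nra.
  have -> : `|a - c * s| = c * s - a by rewrite ltr0_norm; lra.
  have -> : `|a + c * s| = a + c * s by rewrite gtr0_norm; lra.
  by rewrite ltr0_norm; lra.
have s2 : s <= -1 by nra.
have h1 : c * s < - a by nra.
have -> : `|a - c * s| = a - c * s by rewrite gtr0_norm; lra.
have -> : `|a + c * s| = - (a + c * s) by rewrite ltr0_norm; lra.
by rewrite gtr0_norm; lra.
Qed.

End Conics.

(** * Families counted twice *)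

Section SymmetricWeb.
Context {R : realType}.
Implicit Types (p q w z : plane R).

Lemma near_comp1 (k : R -> R) (P : R -> Prop) (u0 : R) : analytic1 k u0 ->
  (\forall t \near k u0, P t) -> \forall u \near u0, P (k u).
Proof.
move=> ak nP; apply: (@near_axis _ (fun u => P (k u)) u0 0).
have c := an_continuous (analytic1_near 0 ak); exact: (c P nP).
Qed.

Lemma near_reparam (K : plane R -> plane R) (P : R * plane R -> Prop) (c0 : R) w0 :
  {for w0, continuous K} ->
  (\forall z \near ((c0, K w0) : R * plane R), P z) ->
  \forall z \near ((c0, w0) : R * plane R), P (z.1, K z.2).
Proof.
move=> cK [[A B] [/= nA nB] AB]; exists (A, K @^-1` B).
  by split=> //; exact: cK.
by move=> [c w] [/= Ac Bw]; exact: AB.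
Qed.

Lemma analytic1_pair_continuous (k1 k2 : R -> R) (u1 u2 : R) : analytic1 k1 u1 -> analytic1 k2 u2 ->
  {for ((u1, u2) : plane R), continuous (fun w => (k1 w.1, k2 w.2) : plane R)}.
Proof.
move=> a1 a2; apply: analytic_map_continuous.
by split=> h k w0 ah ak [e1 e2]; [exact: a1|exact: a2].
Qed.

Variables (o e : plane R) (e1 : e.1 ^+ 2 + e.2 ^+ 2 = 1).
Variables (C C3 : set (set (plane R))) (rho : R) (rho0 : 0 < rho).
Variables (t1 t2 : R) (t21 : t2 < t1).
Variables (Phi Psi : plane R -> plane R) (q0 : plane R).
Hypothesis iPhi : local_iso Phi Psi q0 (t1 + t2, t1 * t2).
Variables (h k1 k2 : R -> R).
Hypotheses (i1 : local_iso1 h k1 t1 (h t1)) (i2 : local_iso1 h k2 t2 (h t2)).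
Variables (T S3 : R -> set (plane R)).
Hypotheses (T1 : \forall t \near t1, in_coords o e C (T t) /\ arc_carrier rho (T t))
  (T2 : \forall t \near t2, in_coords o e C (T t) /\ arc_carrier rho (T t))
  (TP : \forall s \near (t1 + t2, t1 * t2), forall t,
     T t (Psi s) <-> t ^+ 2 - s.1 * t + s.2 = 0)
  (S3P : \forall w \near (h t1 + h t2), in_coords o e C3 (S3 w) /\ arc_carrier rho (S3 w))
  (S3Q : \forall z \near ((h t1 + h t2, (t1, t2)) : R * plane R),
     S3 z.1 (Psi (sum_prod z.2)) <-> h z.2.1 + h z.2.2 = z.1).

(** T t passes through the point with coordinates (t1', t2') exactly when t is one
    of the two roots; near t1 only the first root is possible, near t2 only the
    second. *)
Lemma symmetric_web : contains_hexagonal_web_twice C C3.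
Proof.
apply: contains_web_twice.
have i12 := local_iso_comp (local_iso_comp iPhi (local_iso_roots t21))
  (local_iso_prod i1 i2).
have [_ ah1 ak1 kh1 hk1] := i1; have [_ ah2 ak2 kh2 hk2] := i2.
have k1u : k1 (h t1) = t1 by exact: nbhs_singleton kh1.
have k2u : k2 (h t2) = t2 by exact: nbhs_singleton kh2.
set m := (t1 + t2) / 2.
have [m2 m1] : t2 < m /\ m < t1 by rewrite /m addrC !midf_lt.
have n1 : \forall u \near h t1, m < k1 u.
  by apply: (near_comp1 (P := fun t => m < t)) => //; rewrite k1u; exact: lt_nbhsr.
have n2 : \forall u \near h t2, k2 u < m.
  by apply: (near_comp1 (P := fun t => t < m)) => //; rewrite k2u; exact: lt_nbhsl.
have cK := analytic1_pair_continuous ak1 ak2.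
have TP' : \forall w \near (h t1, h t2), forall t,
    T t (Psi (sum_prod (k1 w.1, k2 w.2))) <->
    (t - k1 w.1) * (t - k2 w.2) = 0.
  have cs : {for ((t1, t2) : plane R), continuous (@sum_prod R)}.
    have [_ _ a _ _] := local_iso_roots t21; exact: analytic_map_continuous.
  have H : \forall w \near ((t1, t2) : plane R), forall t,
      T t (Psi (sum_prod w)) <-> t ^+ 2 - (sum_prod w).1 * t + (sum_prod w).2 = 0.
    exact: (cs (fun s => forall t, T t (Psi s) <-> t ^+ 2 - s.1 * t + s.2 = 0) TP).
  pose P w := forall t,
      T t (Psi (sum_prod w)) <-> t ^+ 2 - (sum_prod w).1 * t + (sum_prod w).2 = 0.
  have H' : \forall w \near (h t1, h t2), P (k1 w.1, k2 w.2).
    by apply: (near_comp (P := P) cK); rewrite /= k1u k2u.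
  apply: filterS H' => w Hw t.
  apply: iff_trans (Hw t) _; rewrite /sum_prod /=.
  by rewrite (_ : _ + _ = (t - k1 w.1) * (t - k2 w.2)) //; ring.
have l1 : lin (1, 0) (h t1, h t2) = h t1 by rewrite /lin /=; ring.
have l2 : lin (0, 1) (h t1, h t2) = h t2 by rewrite /lin /=; ring.
have l3 : lin (1, 1) (h t1, h t2) = h t1 + h t2 by rewrite /lin /=; ring.
have N1 : \forall u \near h t1, h (k1 u) = u /\ m < k1 u by apply: filterI.
have N2 : \forall u \near h t2, h (k2 u) = u /\ k2 u < m by apply: filterI.
pose Q w := [/\ forall t, T t (Psi (sum_prod (k1 w.1, k2 w.2))) <->
    (t - k1 w.1) * (t - k2 w.2) = 0, h (k1 w.1) = w.1 /\ m < k1 w.1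
    & h (k2 w.2) = w.2 /\ k2 w.2 < m].
have NQ : \forall w \near (h t1, h t2), Q w.
  by apply: filterS3 TP' (near_fst (h t2) N1) (near_snd (h t1) N2).
apply: (@web_in_frame _ o e e1 C C C3 _ _ _ _ rho (T \o k1) (T \o k2) S3 rho0 i12).
- split; rewrite l1.
    apply: (near_comp1 (P := fun t => in_coords o e C (T t) /\ arc_carrier rho (T t))) => //.
    by rewrite k1u.
  apply: filterS (near_product N1 NQ) => -[u w] /= [[E1 mu] [Tw [E2 _] [_ wm]]].
  apply: iff_trans (Tw (k1 u)) _; rewrite /lin /= mul0r addr0 mul1r.
  split; last by move=> ->; rewrite subrr mul0r.
  move=> /eqP; rewrite mulf_eq0 !subr_eq0 => /orP[/eqP E|/eqP E].
    by rewrite -E1 E E2.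
  by move: mu; rewrite E => /(lt_trans wm); rewrite ltxx.
- split; rewrite l2.
    apply: (near_comp1 (P := fun t => in_coords o e C (T t) /\ arc_carrier rho (T t))) => //.
    by rewrite k2u.
  apply: filterS (near_product N2 NQ) => -[u w] /= [[E1 um] [Tw [_ mw] [E2 _]]].
  apply: iff_trans (Tw (k2 u)) _; rewrite /lin /= mul0r add0r mul1r.
  split; last by move=> ->; rewrite subrr mulr0.
  move=> /eqP; rewrite mulf_eq0 !subr_eq0 => /orP[/eqP E|/eqP E].
    by move: um; rewrite E => /(lt_trans mw); rewrite ltxx.
  by rewrite -E1 E E2.
- split; rewrite l3 //.
  have S3Q' : \forall z \near ((h t1 + h t2, (h t1, h t2)) : R * plane R),
     S3 z.1 (Psi (sum_prod (k1 z.2.1, k2 z.2.2))) <->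
     h (k1 z.2.1) + h (k2 z.2.2) = z.1.
    pose P (z : R * plane R) :=
      S3 z.1 (Psi (sum_prod z.2)) <-> h z.2.1 + h z.2.2 = z.1.
    have HP : \forall z \near ((h t1 + h t2, (k1 (h t1), k2 (h t2))) : R * plane R), P z.
      by rewrite k1u k2u.
    exact: (near_reparam (P := P) cK HP).
  have nT : \forall w \near h t1 + h t2, True by near=> w.
  apply: filterS2 S3Q' (near_product nT NQ) => -[u w] /= H [_ [_ [E1 _] [E2 _]]].
  by apply: iff_trans H _; rewrite E1 E2 /lin !mul1r.
Unshelve. all: by end_near. Qed.

End SymmetricWeb.

(** * Tangent lines of a conic counted twice *)

Section TangentsOfConic.
Context {R : realType}.
Implicit Types (p q w z s : plane R).

(** Reduces an equivalence of two equations to a single polynomial identity. *)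
Lemma iff_of_factor (k x y a b : R) : k != 0 -> x - y = k * (a - b) ->
  (a = b) <-> (x = y).
Proof.
move=> k0 E; split=> [ab|xy]; apply/eqP; rewrite -subr_eq0.
  by rewrite E ab subrr mulr0.
by move: E => /eqP; rewrite xy subrr eq_sym mulf_eq0 (negbTE k0).
Qed.

Lemma zeros_circle (c1 c2 r : R) (g : plane R -> R) : 0 < r ->
  (forall z, g z = (z.1 - c1) ^+ 2 + (z.2 - c2) ^+ 2 - r ^+ 2) ->
  circle (c1, c2) r = zeros g.
Proof.
move=> r0 gE; apply/seteqP; split=> z.
  by move/circleE => /(_ (ltW r0)); rewrite /zeros /sqdist /= gE => ->; rewrite subrr.
rewrite /zeros /= gE => /eqP; rewrite subr_eq0 => /eqP E.
by apply/circleE; rewrite ?ltW.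
Qed.

Section ConicWeb.
Variables (o e : plane R) (e1 : e.1 ^+ 2 + e.2 ^+ 2 = 1).
Variables (K : set (plane R)) (C3 : set (set (plane R))).
Variables (a b eps : R) (a0 : 0 < a) (b0 : 0 < b) (eps1 : eps ^+ 2 = 1).
Hypothesis KP : forall z, conic a (eps * b ^+ 2) z -> K (frame o e z).

(** The tangent at the point with rational parameter t.  With eps = 1 the conic is
    an ellipse, with eps = - 1 a hyperbola. *)
Definition tangent_zeros (t : R) : set (plane R) :=
  [set z | (1 + z.1 / a) * t ^+ 2 - 2 * (z.2 / b) * t + eps * (1 - z.1 / a) = 0].

(** Sum and product of the parameters of the two tangents through z, read off from
    the quadratic equation [tangent_zeros]. *)
Definition to_params z : plane R :=
  (2 * a * z.2 / (b * (a + z.1)), eps * (a - z.1) / (a + z.1)).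

Definition of_params s : plane R :=
  (a * (1 - eps * s.2) / (1 + eps * s.2), s.1 * b / (1 + eps * s.2)).

Lemma local_iso_params s0 : 1 + eps * s0.2 != 0 ->
  local_iso to_params of_params (of_params s0) s0.
Proof.
have an0 : a != 0 by rewrite gt_eqF.
have bn0 : b != 0 by rewrite gt_eqF.
move=> d0.
have axE s : 1 + eps * s.2 != 0 -> a + (of_params s).1 = 2 * a / (1 + eps * s.2).
  by move=> ds; rewrite /of_params /=; field.
have tok s : 1 + eps * s.2 != 0 -> to_params (of_params s) = s.
  move=> ds; rewrite [RHS]surjective_pairing /to_params axE // /of_params /=.
  congr (_, _); first by field; rewrite an0 bn0 ds.
  transitivity (eps ^+ 2 * s.2); last by rewrite eps1 mul1r.
  by field; rewrite an0 ds.
have a2 : a + (of_params s0).1 != 0.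
  by rewrite axE // !mulf_neq0 ?invr_eq0 // pnatr_eq0.
split; first exact: tok.
- split=> h k w0 ah ak e0; rewrite /to_params /=; analytic => //.
    rewrite mulf_neq0 //; move: a2; rewrite -e0 //.
  by move: a2; rewrite -e0.
- by split=> h k w0 ah ak e0; rewrite /of_params /=; analytic; move: d0; rewrite -e0.
- have : \forall z \near of_params s0, a + z.1 != 0.
    apply: (an_near_neq0 (h := fun z => a + z.1)) => //.
    by analytic.
  apply: filterS => z az; rewrite [RHS]surjective_pairing /of_params /to_params /=.
  have -> : 1 + eps * (eps * (a - z.1) / (a + z.1)) = 2 * a / (a + z.1).
    transitivity (1 + eps ^+ 2 * (a - z.1) / (a + z.1)); first by ring.
    by rewrite eps1; field.
  have -> : 1 - eps * (eps * (a - z.1) / (a + z.1)) = 2 * z.1 / (a + z.1).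
    transitivity (1 - eps ^+ 2 * (a - z.1) / (a + z.1)); first by ring.
    by rewrite eps1; field.
  by congr (_, _); field; rewrite ?an0 ?bn0 ?az.
- have : \forall s \near s0, 1 + eps * s.2 != 0.
    apply: (an_near_neq0 (h := fun s => 1 + eps * s.2)) => //.
    by analytic.
  by apply: filterS => s; exact: tok.
Qed.

Lemma tangent_zeros_params s t : 1 + eps * s.2 != 0 ->
  tangent_zeros t (of_params s) <-> t ^+ 2 - s.1 * t + s.2 = 0.
Proof.
have an0 : a != 0 by rewrite gt_eqF.
have bn0 : b != 0 by rewrite gt_eqF.
move=> ds; rewrite /tangent_zeros /of_params /=.
have -> : a * (1 - eps * s.2) / (1 + eps * s.2) / a = (1 - eps * s.2) / (1 + eps * s.2).
  by field; rewrite ds an0.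
have -> : s.1 * b / (1 + eps * s.2) / b = s.1 / (1 + eps * s.2).
  by field; rewrite ds bn0.
apply: iff_sym; apply: (@iff_of_factor (2 / (1 + eps * s.2))).
  by rewrite mulf_neq0 ?invr_eq0 // pnatr_eq0.
rewrite !subr0.
transitivity (2 / (1 + eps * s.2) * (t ^+ 2 - s.1 * t + eps ^+ 2 * s.2)).
  by field.
by rewrite eps1 mul1r.
Qed.

Lemma in_coords_tangent_zeros t : 1 + eps * t ^+ 2 != 0 ->
  in_coords o e (tangent_lines K) (tangent_zeros t) /\ is_line (tangent_zeros t).
Proof.
have an0 : a != 0 by rewrite gt_eqF.
have bn0 : b != 0 by rewrite gt_eqF.
have en0 : eps != 0 by rewrite -sqrf_eq0 eps1 oner_neq0.
move=> d0.
pose z : plane R := (a * (1 - eps * t ^+ 2) / (1 + eps * t ^+ 2),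
  2 * b * t / (1 + eps * t ^+ 2)).
have Bn0 : eps * b ^+ 2 != 0 by rewrite mulf_neq0 // sqrf_eq0.
have ieps : eps^-1 = eps by apply: (mulfI en0); rewrite divff // -expr2 eps1.
have iB : (eps * b ^+ 2)^-1 = eps * b ^- 2 by rewrite invfM ieps.
have zK : conic a (eps * b ^+ 2) z.
  rewrite /conic /= iB.
  transitivity (((1 + eps * t ^+ 2) ^+ 2 + 4 * (eps - eps) * t ^+ 2) / (1 + eps * t ^+ 2) ^+ 2).
    by field; rewrite ?an0 ?bn0 ?d0.
  by field.
have az : a + z.1 != 0.
  have -> : a + z.1 = 2 * a / (1 + eps * t ^+ 2) by rewrite /z /=; field.
  by rewrite !mulf_neq0 ?invr_eq0 // pnatr_eq0.
have -> : tangent_zeros t = conic_tangent a (eps * b ^+ 2) z.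
  apply/seteqP; split=> q; rewrite /tangent_zeros /conic_tangent /= iB.
    move=> E; apply/eqP; rewrite -subr_eq0; apply/eqP.
    transitivity (- eps / (1 + eps * t ^+ 2) * ((1 + q.1 / a) * t ^+ 2 -
      2 * (q.2 / b) * t + eps * (1 - q.1 / a)) + (eps ^+ 2 - 1) * (1 - q.1 / a) / (1 + eps * t ^+ 2)).
      by field; rewrite ?an0 ?bn0 ?d0.
    by rewrite E eps1 subrr !mul0r mulr0 addr0.
  move=> /eqP; rewrite -subr_eq0 => /eqP E.
  transitivity (- eps * (1 + eps * t ^+ 2) * (a * (1 - eps * t ^+ 2) /
     (1 + eps * t ^+ 2) / a ^+ 2 * q.1 + 2 * b * t / (1 + eps * t ^+ 2) *
     (eps * b ^- 2) * q.2 - 1) + (eps ^+ 2 - 1) * (2 * (q.2 / b) * t - t ^+ 2 * (1 + q.1 / a))).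
    by field; rewrite ?an0 ?bn0 ?d0.
  by rewrite E eps1 subrr mulr0 mul0r addr0.
have [T lT] := conic_tangent_line an0 Bn0 zK az.
by split=> //; exact: (in_coords_tangent_lines e1 KP T).
Qed.

Variables (rho : R) (rho0 : 0 < rho) (h k1 k2 : R -> R) (S3 : R -> set (plane R)).
Hypotheses (i1 : local_iso1 h k1 (1 / 2) (h (1 / 2)))
  (i2 : local_iso1 h k2 (1 / 3) (h (1 / 3))).
Hypotheses
  (S3P : \forall w \near (h (1 / 2) + h (1 / 3)),
     in_coords o e C3 (S3 w) /\ arc_carrier rho (S3 w))
  (S3Q : \forall z \near ((h (1 / 2) + h (1 / 3), (1 / 2, 1 / 3)) : R * plane R),
     S3 z.1 (of_params (sum_prod z.2)) <-> h z.2.1 + h z.2.2 = z.1).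

Lemma tangents_of_conic_web : contains_hexagonal_web_twice (tangent_lines K) C3.
Proof.
have eE : eps = 1 \/ eps = -1.
  by move/eqP: eps1; rewrite sqrf_eq1 => /orP[/eqP ->|/eqP ->]; [left|right].
have d (t : R) : 0 <= t -> t < 1 -> 1 + eps * t != 0.
  by move=> t0 t1; apply/eqP; case: eE => ->; lra.
have t21 : (1 / 3 : R) < 1 / 2 by lra.
have s0 : 1 + eps * (((1 / 2 + 1 / 3, 1 / 2 * (1 / 3)) : plane R).2) != 0.
  by apply: d => /=; lra.
have P (t : R) : 0 < t -> t < 1 -> \forall u \near t,
   in_coords o e (tangent_lines K) (tangent_zeros u) /\ arc_carrier rho (tangent_zeros u).
  move=> t0 t1; have : \forall t \near t, 1 + eps * t ^+ 2 != 0.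
    apply: (@near_neq0 _ (fun t => 1 + eps * t ^+ 2)); first by analytic.
    by apply: d; [exact: sqr_ge0|nra].
  by apply: filterS => u /in_coords_tangent_zeros [h1 h2]; split=> //; right.
apply: (symmetric_web e1 rho0 t21 (local_iso_params s0) i1 i2
   (P _ _ _) (P _ _ _) _ S3P S3Q); try lra.
have : \forall s \near ((1 / 2 + 1 / 3, 1 / 2 * (1 / 3)) : plane R), 1 + eps * s.2 != 0.
  apply: (an_near_neq0 (h := fun s => 1 + eps * s.2)) => //.
  by analytic.
by apply: filterS => s ds t; exact: tangent_zeros_params.
Qed.

End ConicWeb.

End TangentsOfConic.

(** * Tangents of a circle and a parabolic pencil *)

Section Cases.
Context {R : realType}.
Implicit Types (p q w z s : plane R).

Lemma local_iso1_cosine (t0 : R) : 0 < t0 ->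
  local_iso1 (fun t => (1 - t ^+ 2) / (1 + t ^+ 2))
    (fun u => Num.sqrt ((1 - u) / (1 + u))) t0 ((1 - t0 ^+ 2) / (1 + t0 ^+ 2)).
Proof.
move=> t00.
have d (t : R) : 1 + t ^+ 2 != 0 by rewrite gt_eqF // ltr_wpDr // sqr_ge0.
have E1 (t : R) : 1 + (1 - t ^+ 2) / (1 + t ^+ 2) = 2 / (1 + t ^+ 2) by field.
have E2 (t : R) : (1 - (1 - t ^+ 2) / (1 + t ^+ 2)) / (1 + (1 - t ^+ 2) / (1 + t ^+ 2)) = t ^+ 2.
  by rewrite E1; field.
have E3 (t : R) : 1 + (1 - t ^+ 2) / (1 + t ^+ 2) != 0.
  by rewrite E1 mulf_neq0 ?invr_eq0 ?pnatr_eq0.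
split=> //.
- by move=> h w0 ah _; analytic.
- by move=> h w0 ah e; analytic; rewrite e ?E2 ?exprn_gt0.
- have : \forall t \near t0, 0 < t by exact: lt_nbhsr.
  by apply: filterS => t t_gt0; rewrite E2 sqrtr_sqr gtr0_norm.
- have : \forall u \near (1 - t0 ^+ 2) / (1 + t0 ^+ 2), 1 + u != 0.
    by apply: (@near_neq0 _ (fun u => 1 + u)) => //; analytic.
  have : \forall u \near (1 - t0 ^+ 2) / (1 + t0 ^+ 2), 0 < (1 - u) / (1 + u).
    apply: (@near_gt0 _ (fun u => (1 - u) / (1 + u))); first by analytic; exact: E3.
    by rewrite E2 exprn_gt0.
  apply: filterS2 => u u0 u1; rewrite sqr_sqrtr ?ltW //.
  by field; rewrite u1 (_ : 1 + u + (1 - u) = 2) ?pnatr_eq0 //; ring.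
Qed.

(** With t = tan (x / 2), where x is the angle of the contact point, h t = cos x,
    and h t1 + h t2 is 2 r z.1 / (z.1 ^ 2 + z.2 ^ 2). *)
Lemma tangents_of_circle_web (O : plane R) (r : R) (P : set (set (plane R))) :
  0 < r -> parabolic_pencil P O ->
  contains_hexagonal_web_twice (tangent_lines (circle O r)) P.
Proof.
move=> r0 /parabolic_pencil_span [f1 [f2 [v [PE v0 sp1 sp2]]]].
have rn : r != 0 by rewrite gt_eqF.
have vv := plane_neq0 v0.
pose d := Num.sqrt (v.1 ^+ 2 + v.2 ^+ 2).
have d0 : 0 < d by rewrite sqrtr_gt0.
have dn : d != 0 by rewrite gt_eqF.
have dd : d ^+ 2 = v.1 ^+ 2 + v.2 ^+ 2 by rewrite sqr_sqrtr // ltW.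
pose e : plane R := (- v.2 / d, v.1 / d).
have e1 : e.1 ^+ 2 + e.2 ^+ 2 = 1.
  by rewrite /e /= !expr_div_n -mulrDl sqrrN addrC -dd divff // sqrf_eq0.
pose h (t : R) := (1 - t ^+ 2) / (1 + t ^+ 2).
have h12 : h (1 / 2) + h (1 / 3) = 7 / 5 by rewrite /h; field.
have i1 := @local_iso1_cosine (1 / 2) ltac:(lra).
have i2 := @local_iso1_cosine (1 / 3) ltac:(lra).
pose S3 (w : R) := circle ((r / w, 0) : plane R) (r / w).
have frO : O = frame O e (0, 0).
  by rewrite [LHS]surjective_pairing /frame /=; congr (_, _); ring.
have rho0 : 0 < (r / 2) ^+ 2 by rewrite exprn_gt0 // divr_gt0.
apply: (@tangents_of_conic_web _ O e e1 _ P r r 1 r0 r0 (expr1n _ _) _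
  ((r / 2) ^+ 2) rho0 h _ _ S3 i1 i2).
- move=> z; rewrite /conic /= mul1r => E; rewrite /circle /= {2}frO edist_frame //.
  apply/(circleE (0, 0) _ (ltW r0)); rewrite /sqdist !subr0.
  by apply: (mulIf (x := r ^- 2)); rewrite ?invr_eq0 ?sqrf_eq0 // mulrDl E divff // sqrf_eq0.
- rewrite -/(h _) h12.
  have : \forall w \near (7 / 5 : R), 0 < w by apply: lt_nbhsr; lra.
  have : \forall w \near (7 / 5 : R), w < 2 by apply: lt_nbhsl; lra.
  apply: filterS2 => w w2 w0.
  have wn : w != 0 by rewrite gt_eqF.
  have rw : 0 < r / w by rewrite divr_gt0.
  split; last first.
    left; exists (r / w, 0), (r / w); split=> //.
    rewrite lerXn2r ?nnegrE ?divr_ge0 ?(ltW r0) ?(ltW w0) //.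
    by rewrite ler_pM2l // lef_pV2 ?posrE // ltW.
  apply: (@in_coords_pencil _ _ _ e1 P f1 f2 _
    (fun z => z.1 ^+ 2 + z.2 ^+ 2 - 2 * r / w * z.1) _ PE
    (in_span_comb 1 (- (2 * r / w / d)) sp1 sp2)).
  + by left; exists (r / w, 0), (r / w).
  + move=> z; rewrite mul1r {2}frO sqdist_frame // /sqdist /= !subr0.
    rewrite mulNr; congr (_ - _).
    have -> : (O.2 + z.1 * (v.1 / d) + z.2 * (- v.2 / d) - O.2) * v.1 -
        (O.1 + z.1 * (- v.2 / d) - z.2 * (v.1 / d) - O.1) * v.2 =
        z.1 * (v.1 ^+ 2 + v.2 ^+ 2) / d by field.
    by rewrite -dd; field; rewrite wn dn.
  + by apply: zeros_circle => // z; field.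
- rewrite -/(h _) h12.
  have nw : \forall w \near (7 / 5 : R), 0 < w by apply: lt_nbhsr; lra.
  have nt : \forall t \near ((1 / 2, 1 / 3) : plane R), 0 < 1 + t.1 * t.2.
    by apply: an_near_gt0; [analytic|rewrite /=; lra].
  apply: filterS (near_product nw nt) => -[w t] /= [w0 tp].
  have wn : w != 0 by rewrite gt_eqF.
  have pn : 1 + t.1 * t.2 != 0 by rewrite gt_eqF.
  have dt (x : R) : 1 + x ^+ 2 != 0 by rewrite gt_eqF // ltr_wpDr // sqr_ge0.
  rewrite /S3 (@zeros_circle _ _ _ _
    (fun z => z.1 ^+ 2 + z.2 ^+ 2 - 2 * r / w * z.1)) ?divr_gt0 //; last first.
    by move=> z /=; field.
  rewrite /zeros /of_params /sum_prod /= !mul1r.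
  apply: (@iff_of_factor _ (- w * (1 + t.1 * t.2) ^+ 2 /
     (r ^+ 2 * (1 + t.1 ^+ 2) * (1 + t.2 ^+ 2)))).
    by rewrite !mulf_neq0 ?oppr_eq0 ?invr_eq0 ?mulf_neq0 ?sqrf_eq0.
  by rewrite /h; field; rewrite ?wn ?pn ?rn ?dt.
Qed.

End Cases.

(** * Tangents of a general conic and a hyperbolic pencil *)

Section Apollonius.
Context {R : realType}.
Implicit Types (p q z s A B : plane R).

Definition apollonius A B (mu : R) : set (plane R) :=
  [set z | sqdist z A - mu * sqdist z B = 0].

Lemma apollonius_circle A B (mu : R) : A <> B -> 0 < mu -> mu != 1 ->
  exists c r, [/\ 0 < r, r ^+ 2 = mu * sqdist A B / (1 - mu) ^+ 2
    & apollonius A B mu = circle c r].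
Proof.
move=> AB mu0 mu1.
have AB0 := sqdist_gt0 AB.
have d0 : 1 - mu != 0 by rewrite subr_eq0 eq_sym.
have r2 : 0 < mu * sqdist A B / (1 - mu) ^+ 2.
  by apply: divr_gt0; [exact: mulr_gt0|rewrite exprn_even_gt0].
exists ((A.1 - mu * B.1) / (1 - mu), (A.2 - mu * B.2) / (1 - mu)),
  (Num.sqrt (mu * sqdist A B / (1 - mu) ^+ 2)); split.
- by rewrite sqrtr_gt0.
- by rewrite sqr_sqrtr // ltW.
have key z : sqdist z A - mu * sqdist z B = (1 - mu) *
    ((z.1 - (A.1 - mu * B.1) / (1 - mu)) ^+ 2 +
     (z.2 - (A.2 - mu * B.2) / (1 - mu)) ^+ 2 - mu * sqdist A B / (1 - mu) ^+ 2).
  by rewrite /sqdist; field.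
rewrite (@zeros_circle _ _ _ _ (fun z =>
  (z.1 - (A.1 - mu * B.1) / (1 - mu)) ^+ 2 +
  (z.2 - (A.2 - mu * B.2) / (1 - mu)) ^+ 2 - mu * sqdist A B / (1 - mu) ^+ 2)).
- apply/seteqP; split=> z; rewrite /apollonius /zeros /= key; last by move=> ->; rewrite mulr0.
  by move=> /eqP; rewrite mulf_eq0 (negbTE d0) /= => /eqP.
- by rewrite sqrtr_gt0.
- by move=> z; rewrite sqr_sqrtr // ltW.
Qed.

(** The Apollonius circles of A and B are the members of the hyperbolic pencil
    with these limiting points; their radii are bounded below near w0 by
    continuity. *)
Lemma near_apollonius (o e F1 F2 : plane R) (P : set (set (plane R))) A B
    (f1 f2 : plane R -> R) (mu : R -> R) (w0 rho : R) :
  e.1 ^+ 2 + e.2 ^+ 2 = 1 -> F1 = frame o e A -> F2 = frame o e B -> A <> B ->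
  P = pencil f1 f2 -> in_span f1 f2 (sqdist^~ F1) -> in_span f1 f2 (sqdist^~ F2) ->
  analytic_near (fun q => mu q.1) (w0, 0) -> 0 < mu w0 -> mu w0 != 1 ->
  rho < mu w0 * sqdist A B / (1 - mu w0) ^+ 2 ->
  \forall w \near w0, in_coords o e P (apollonius A B (mu w)) /\
    arc_carrier rho (apollonius A B (mu w)).
Proof.
move=> e1 F1E F2E AB PE s1 s2 amu mu0 mu1 rhow.
have d0 : 1 - mu w0 != 0 by rewrite subr_eq0 eq_sym.
have n1 : \forall w \near w0, 0 < mu w by apply: near_gt0.
have n2 : \forall w \near w0, 1 - mu w != 0.
  by apply: (@near_neq0 _ (fun w => 1 - mu w)) => //; analytic.
have n3 : \forall w \near w0, 0 < mu w * sqdist A B / (1 - mu w) ^+ 2 - rho.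
  apply: (@near_gt0 _ (fun w => mu w * sqdist A B / (1 - mu w) ^+ 2 - rho)).
    by analytic; rewrite sqrf_eq0.
  by rewrite subr_gt0.
apply: filterS3 n1 n2 n3 => w h1 h2 h3.
have h2' : mu w != 1 by move: h2; rewrite subr_eq0 eq_sym.
have [c [r [r0 rE SE]]] := apollonius_circle AB h1 h2'.
split; last by left; exists c, r; split=> //; rewrite rE -subr_ge0 ltW.
apply: (@in_coords_pencil _ _ _ e1 P f1 f2 _
    (fun z => sqdist z A - mu w * sqdist z B) _ PE (in_span_comb 1 (- mu w) s1 s2)) => //.
- by rewrite SE; left; exists c, r.
- by move=> z; rewrite F1E F2E !sqdist_frame // mul1r mulNr.
Qed.

End Apollonius.

Section FocalConics.
Context {R : realType}.
Implicit Types (p q z s : plane R).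

Lemma general_conic_foci (K : set (plane R)) F1 F2 : general_conic K F1 F2 -> F1 <> F2.
Proof.
move=> [[a [[aE KE] notc]]|[a [a0 aE _]]] F12.
  apply: notc; exists F2, a; split.
    move: aE; rewrite F12 /edist !subrr expr0n addr0 sqrtr0 => h; lra.
  rewrite KE F12; apply/seteqP; split=> q; rewrite /circle /= => h; lra.
move: aE; rewrite F12 /edist !subrr expr0n addr0 sqrtr0 => h; lra.
Qed.

Lemma general_conic_frame (K : set (plane R)) F1 F2 : general_conic K F1 F2 ->
  exists o e (a c : R), [/\ e.1 ^+ 2 + e.2 ^+ 2 = 1, [/\ 0 < a, 0 < c & a != c],
    F1 = frame o e (c, 0), F2 = frame o e (- c, 0)
    & forall z, conic a (a ^+ 2 - c ^+ 2) z -> K (frame o e z)].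
Proof.
move=> gK; have [org [e [c [e1 c0 dE F1E F2E]]]] := foci_frame (general_conic_foci gK).
move: gK => [[a [[aE KE] _]]|[a [a0 aE KE]]].
  have ca : c < a by lra.
  exists org, e, a, c; split=> //.
    by split=> //; [lra|rewrite gt_eqF].
  move=> z zK; rewrite KE /= F1E F2E !edist_frame //.
  by apply: conic_sub_ellipse => //; lra.
have ca : a < c by lra.
exists org, e, a, c; split=> //; first by split=> //; rewrite lt_eqF.
move=> z zK; rewrite KE /= F1E F2E !edist_frame //.
by apply: conic_sub_hyperbola.
Qed.

Section FocalParameter.
Variables (kap : R) (kap0 : 0 < kap) (kap1 : kap < 1).

(** The quotient is the ratio of the distances from the two foci to the tangent
    with parameter t, when kap is the ratio of the distances from the foci to the
    vertex (a, 0). *)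
Definition focal_log (t : R) : R := ln ((kap + t ^+ 2) / (1 + kap * t ^+ 2)).

Definition focal_log_inv (u : R) : R :=
  Num.sqrt ((expR u - kap) / (1 - kap * expR u)).

Lemma focal_ratio_gt0 t : 0 < (kap + t ^+ 2) / (1 + kap * t ^+ 2).
Proof.
apply: divr_gt0; first by rewrite ltr_wpDr // sqr_ge0.
by rewrite ltr_wpDr // mulr_ge0 ?sqr_ge0 // ltW.
Qed.

Lemma expR_focal_log t : expR (focal_log t) = (kap + t ^+ 2) / (1 + kap * t ^+ 2).
Proof. by rewrite lnK // posrE focal_ratio_gt0. Qed.

Lemma local_iso1_focal (t0 : R) : 0 < t0 ->
  local_iso1 focal_log focal_log_inv t0 (focal_log t0).
Proof.
move=> t00.
have d (t : R) : 1 + kap * t ^+ 2 != 0.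
  by rewrite gt_eqF // ltr_wpDr // mulr_ge0 ?sqr_ge0 // ltW.
have k2 : 1 - kap ^+ 2 != 0 by rewrite gt_eqF // subr_gt0 exprn_ilt1 // ltW.
have E1 (t : R) : 1 - kap * ((kap + t ^+ 2) / (1 + kap * t ^+ 2)) =
    (1 - kap ^+ 2) / (1 + kap * t ^+ 2) by field.
have E2 (t : R) : ((kap + t ^+ 2) / (1 + kap * t ^+ 2) - kap) /
   (1 - kap * ((kap + t ^+ 2) / (1 + kap * t ^+ 2))) = t ^+ 2.
  by rewrite E1; field; rewrite d k2.
have E3 (t : R) : 1 - kap * ((kap + t ^+ 2) / (1 + kap * t ^+ 2)) != 0.
  by rewrite E1 mulf_neq0 ?invr_eq0.
split=> //.
- move=> h w0 ah _; rewrite /focal_log; analytic => //.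
  exact: focal_ratio_gt0.
- move=> h w0 ah e; rewrite /focal_log_inv; analytic; rewrite e expR_focal_log //.
  by rewrite E2 exprn_gt0.
- have : \forall t \near t0, 0 < t by exact: lt_nbhsr.
  apply: filterS => t t_gt0.
  by rewrite /focal_log_inv expR_focal_log E2 sqrtr_sqr gtr0_norm.
- have : \forall u \near focal_log t0, 1 - kap * expR u != 0.
    apply: (@near_neq0 _ (fun u => 1 - kap * expR u)); first by analytic.
    by rewrite expR_focal_log.
  have : \forall u \near focal_log t0, 0 < (expR u - kap) / (1 - kap * expR u).
    apply: (@near_gt0 _ (fun u => (expR u - kap) / (1 - kap * expR u))).
      by analytic; rewrite expR_focal_log.
    by rewrite expR_focal_log E2 exprn_gt0.
  apply: filterS2 => u u0 u1; rewrite /focal_log /focal_log_inv sqr_sqrtr ?ltW //.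
  rewrite -[RHS]expRK; congr ln; field.
  rewrite u1 /= (_ : _ + _ = 1 - kap ^+ 2) //; ring.
Qed.

End FocalParameter.

(** The squared distances from (c, 0) and (- c, 0) to the intersection of the
    tangents t1 and t2 are, up to a common factor, the products of the numerators
    and of the denominators in [focal_log]. *)
Lemma tangents_of_focal_conic_web (K : set (plane R)) F1 F2 (P : set (set (plane R))) :
  general_conic K F1 F2 -> hyperbolic_pencil P F1 F2 ->
  contains_hexagonal_web_twice (tangent_lines K) P.
Proof.
move=> /general_conic_frame [org [e [a [c [e1 [a0 c0 ac] F1E F2E KP]]]]].
move=> /hyperbolic_pencil_span [f1 [f2 [PE _ s1 s2]]].
(* the sign distinguishes ellipses from hyperbolas *)
have [eps [eps1 kap0]] : exists eps : R, eps ^+ 2 = 1 /\ 0 < eps * (a - c).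
  have [ca|ca] := ltP c a.
    by exists 1; rewrite expr1n mul1r subr_gt0.
  by exists (-1); rewrite sqrrN expr1n; split=> //; move: ca; rewrite le_eqVlt (negbTE ac) /=; lra.
have s0 : 0 < a + c by rewrite addr_gt0.
have sn : a + c != 0 by rewrite gt_eqF.
pose kap := eps * (a - c) / (a + c).
have k0 : 0 < kap by rewrite divr_gt0.
have eE : eps = 1 \/ eps = -1.
  by move/eqP: eps1; rewrite sqrf_eq1 => /orP[/eqP ->|/eqP ->]; [left|right].
have k1 : kap < 1.
  by rewrite ltr_pdivrMr // mul1r; case: eE => ->; lra.
pose b := Num.sqrt kap * (a + c).
have b0 : 0 < b by rewrite mulr_gt0 ?sqrtr_gt0.
have bb : b ^+ 2 = kap * (a + c) ^+ 2 by rewrite exprMn sqr_sqrtr // ltW.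
have eb : eps * b ^+ 2 = a ^+ 2 - c ^+ 2.
  rewrite bb /kap; transitivity (eps ^+ 2 * (a - c) * (a + c)); first by field.
  by rewrite eps1; ring.
pose h := focal_log kap.
(* the circle through the base point is not a line *)
have hneg : h (1 / 2) + h (1 / 3) < 0.
  have hn t : 0 < t -> t < 1 -> h t < 0.
    move=> t0 t1; rewrite /h /focal_log ln_lt0 // focal_ratio_gt0 //=.
    have tt : 0 < t ^+ 2 by rewrite exprn_gt0.
    have t2 : t ^+ 2 < 1 by nra.
    rewrite ltr_pdivrMr; last by nra.
    nra.
  have := hn (1 / 2) ltac:(lra) ltac:(lra).
  have := hn (1 / 3) ltac:(lra) ltac:(lra).
  lra.
set w0 := h (1 / 2) + h (1 / 3) in hneg.
have mu1 : expR w0 != 1 by rewrite lt_eqF // expR_lt1.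
pose A : plane R := (c, 0); pose B : plane R := (- c, 0).
have AB : A <> B by move=> [E]; lra.
pose D := expR w0 * sqdist A B / (1 - expR w0) ^+ 2.
have D0 : 0 < D.
  apply: divr_gt0; last by rewrite exprn_even_gt0 //= subr_eq0 eq_sym.
  by apply: mulr_gt0; [exact: expR_gt0|exact: sqdist_gt0].
have rho0 : 0 < D / 2 by rewrite divr_gt0.
have rhoD : D / 2 < D by rewrite ltr_pdivrMr // ltr_pMr // ltr1n.
apply: (@tangents_of_conic_web _ org e e1 K P a b eps a0 b0 eps1 _ (D / 2) rho0 h _ _
  (fun w => apollonius A B (expR w))
  (local_iso1_focal k0 k1 _) (local_iso1_focal k0 k1 _)); try lra.
- by move=> z; rewrite eb; exact: KP.
- apply: (near_apollonius e1 F1E F2E AB PE s1 s2) => //; last exact: expR_gt0.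
  by analytic.
- have nt : \forall t \near ((1 / 2, 1 / 3) : plane R), 1 + eps * (t.1 * t.2) != 0.
    apply: (an_near_neq0 (h := fun t => 1 + eps * (t.1 * t.2))).
      by analytic.
    by rewrite /=; apply/eqP; case: eE => ->; lra.
  have nT : \forall w \near w0, True by near=> w.
  apply: filterS (near_product nT nt) => -[w t] /= [_ pn].
  have q1 (x : R) : kap + x ^+ 2 != 0 by rewrite gt_eqF // ltr_wpDr // sqr_ge0.
  have q2 (x : R) : 1 + kap * x ^+ 2 != 0.
    by rewrite gt_eqF // ltr_wpDr // mulr_ge0 ?sqr_ge0 // ltW.
  have -> : (h t.1 + h t.2 = w) <-> (expR w = expR (h t.1 + h t.2)).
    by split=> [->//|/expR_inj ->].
  rewrite expRD /h !expR_focal_log // /apollonius /=.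
  set z := of_params _ _ _ _; set E := expR w.
  have zA : sqdist z A = (a + c) ^+ 2 * ((kap + t.1 ^+ 2) * (kap + t.2 ^+ 2)) /
      (1 + eps * (t.1 * t.2)) ^+ 2.
    have -> : sqdist z A = (z.1 - c) ^+ 2 + ((t.1 + t.2) / (1 + eps * (t.1 * t.2))) ^+ 2 * b ^+ 2.
      by rewrite /sqdist /z /of_params /A /=; ring.
    have -> : z.1 - c = eps * (a + c) * (kap - t.1 * t.2) / (1 + eps * (t.1 * t.2)).
      rewrite /z /of_params /= /kap.
      transitivity ((eps ^+ 2 * (a - c) - eps * (a + c) * (t.1 * t.2)) / (1 + eps * (t.1 * t.2))).
        by rewrite eps1; field.
      by field; rewrite sn pn.
    rewrite bb !exprMn eps1; field.
    done.
  have zB : sqdist z B = (a + c) ^+ 2 * ((1 + kap * t.1 ^+ 2) * (1 + kap * t.2 ^+ 2)) /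
      (1 + eps * (t.1 * t.2)) ^+ 2.
    have -> : sqdist z B = (z.1 + c) ^+ 2 + ((t.1 + t.2) / (1 + eps * (t.1 * t.2))) ^+ 2 * b ^+ 2.
      by rewrite /sqdist /z /of_params /B /=; ring.
    have -> : z.1 + c = (a + c) * (1 - kap * (t.1 * t.2)) / (1 + eps * (t.1 * t.2)).
      rewrite /z /of_params /= /kap; by field; rewrite sn pn.
    by rewrite bb; field.
  rewrite zA zB; apply: (@iff_of_factor _ (- (1 + eps * (t.1 * t.2)) ^+ 2 /
     ((a + c) ^+ 2 * (1 + kap * t.1 ^+ 2) * (1 + kap * t.2 ^+ 2)))).
    by rewrite !mulf_neq0 ?oppr_eq0 ?invr_eq0 ?mulf_neq0 ?sqrf_eq0.
  by field; rewrite ?pn ?sn ?q2.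
Unshelve. all: by end_near. Qed.

End FocalConics.

(** * Tangents of a parabola and a hyperbolic pencil *)

Section ParabolaWeb.
Context {R : realType}.
Implicit Types (p q z s : plane R).

Definition parabola (p : R) : set (plane R) :=
  [set z | z.2 = (z.1 ^+ 2 + p ^+ 2) / (2 * p)].

Definition parabola_tangent (p t : R) : set (plane R) :=
  [set z | t ^+ 2 - 2 * t * z.1 + 2 * p * z.2 - p ^+ 2 = 0].

Lemma parabola_tangent_line (p t : R) : p != 0 ->
  tangent_line_at (parabola p) (t, (t ^+ 2 + p ^+ 2) / (2 * p)) (parabola_tangent p t)
  /\ is_line (parabola_tangent p t).
Proof.
move=> p0.
pose v : plane R := (1, t / p).
have v0 : v != 0 by apply/eqP => -[/eqP]; rewrite oner_eq0.
have LE : parabola_tangent p t = line (t, (t ^+ 2 + p ^+ 2) / (2 * p)) v.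
  apply/seteqP; split=> z.
    rewrite /parabola_tangent /= => E; exists (z.1 - t).
    rewrite [LHS]surjective_pairing /=; congr (_, _); first by ring.
    apply/eqP; rewrite -subr_eq0; apply/eqP.
    transitivity ((t ^+ 2 - 2 * t * z.1 + 2 * p * z.2 - p ^+ 2) / (2 * p)).
      by field.
    by rewrite E mul0r.
  by move=> [u ->]; rewrite /parabola_tangent /=; field.
split; last by eexists; exists v; split; [exact: v0|exact: LE].
exists (fun u => t + u), (fun u => ((t + u) ^+ 2 + p ^+ 2) / (2 * p)), v; split=> //.
- by rewrite /= addr0.
- by near=> u.
have D := is_derive_add (is_derive_const 0 t) (is_derive_idfun (0 : R)).
split; first by rewrite add0r in D.
have := is_derive_mul (is_derive_add (is_derive_mul D D) (is_derive_const 0 (p ^+ 2)))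
  (is_derive_const 0 (2 * p)^-1).
by congr is_derive; rewrite /v /=; field.
Unshelve. all: by end_near. Qed.

Lemma set_dist_axis o e z : e.1 ^+ 2 + e.2 ^+ 2 = 1 ->
  set_dist (frame o e z) [set frame o e (x, 0) | x in [set: R]] = `|z.2|.
Proof.
move=> e1; rewrite /set_dist; set S := (X in inf X).
have lbS : lbound S `|z.2|.
  move=> _ [_ [x _ <-] <-]; rewrite edist_frame // -sqrtr_sqr ler_sqrt /=.
    by rewrite subr0 lerDr sqr_ge0.
  by rewrite addr_ge0 // sqr_ge0.
have inS : S `|z.2|.
  exists (frame o e (z.1, 0)); first by exists z.1.
  by rewrite edist_frame // /edist /= subrr expr0n add0r subr0 sqrtr_sqr.
apply/le_anti/andP; split; first by apply: ge_inf => //; exists `|z.2|.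
by apply: lb_le_inf => //; exists `|z.2|.
Qed.

Lemma parabola_frame (K D : set (plane R)) F Q : is_parabola K F D -> D Q ->
  exists org e (p q : R), [/\ e.1 ^+ 2 + e.2 ^+ 2 = 1, 0 < p,
    F = frame org e (0, p), Q = frame org e (q, 0)
    & forall z, parabola p z -> K (frame org e z)].
Proof.
move=> [[d [v [v0 DE]]] DF KE] DQ.
have vv := plane_neq0 v0.
pose l := Num.sqrt (v.1 ^+ 2 + v.2 ^+ 2).
have l0 : 0 < l by rewrite sqrtr_gt0.
have ln0 : l != 0 by rewrite gt_eqF.
have ll : l ^+ 2 = v.1 ^+ 2 + v.2 ^+ 2 by rewrite sqr_sqrtr // ltW.
pose hgt := (F.2 - d.2) * v.1 - (F.1 - d.1) * v.2.
pose dot := (F.1 - d.1) * v.1 + (F.2 - d.2) * v.2.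
have hgt0 : hgt != 0.
  apply/eqP => h0; apply: DF; rewrite DE; exists (dot / l ^+ 2).
  rewrite [LHS]surjective_pairing; congr (_, _); apply/eqP; rewrite -subr_eq0; apply/eqP.
    transitivity ((F.1 - d.1) * (l ^+ 2 - v.1 ^+ 2 - v.2 ^+ 2) / l ^+ 2 - v.2 * hgt / l ^+ 2).
      by rewrite /hgt /dot; field.
    by rewrite h0 ll; ring.
  transitivity ((F.2 - d.2) * (l ^+ 2 - v.1 ^+ 2 - v.2 ^+ 2) / l ^+ 2 + v.1 * hgt / l ^+ 2).
    by rewrite /hgt /dot; field.
  by rewrite h0 ll; ring.
(* the axis is oriented so that the focus lies on its positive side *)
have [sg [sg1 sgh]] : exists sg : R, sg ^+ 2 = 1 /\ 0 < sg * hgt.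
  case: (ltrgtP hgt 0) hgt0 => // h _.
    by exists (-1); rewrite sqrrN expr1n; split=> //; lra.
  by exists 1; rewrite expr1n mul1r.
have sgn0 : sg != 0 by rewrite -sqrf_eq0 sg1 oner_neq0.
pose e : plane R := (sg * v.1 / l, sg * v.2 / l).
have e1 : e.1 ^+ 2 + e.2 ^+ 2 = 1.
  rewrite /e /=; transitivity (sg ^+ 2 * (v.1 ^+ 2 + v.2 ^+ 2) / l ^+ 2); first by field.
  by rewrite sg1 -ll mul1r divff // sqrf_eq0.
pose org : plane R := (d.1 + dot / l ^+ 2 * v.1, d.2 + dot / l ^+ 2 * v.2).
pose p := sg * hgt / l.
have p0 : 0 < p by rewrite divr_gt0.
have FE : F = frame org e (0, p).
  rewrite [LHS]surjective_pairing /frame /e /org /p /=.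
  congr (_, _); apply/eqP; rewrite -subr_eq0; apply/eqP.
    transitivity ((F.1 - d.1) * (l ^+ 2 - v.1 ^+ 2 - v.2 ^+ 2) / l ^+ 2 +
        (sg ^+ 2 - 1) * hgt * v.2 / l ^+ 2).
      by rewrite /hgt /dot; field.
    by rewrite sg1 ll; ring.
  transitivity ((F.2 - d.2) * (l ^+ 2 - v.1 ^+ 2 - v.2 ^+ 2) / l ^+ 2 -
        (sg ^+ 2 - 1) * hgt * v.1 / l ^+ 2).
    by rewrite /hgt /dot; field.
  by rewrite sg1 ll; ring.
have DE' : D = [set frame org e (x, 0) | x in [set: R]].
  rewrite DE; apply/seteqP; split=> z /=.
    move=> [t ->]; exists ((t - dot / l ^+ 2) * l / sg) => //.
    by rewrite /frame /org /e /=; congr (_, _); field; rewrite ln0 sgn0.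
  move=> [x _ <-]; exists (dot / l ^+ 2 + x * sg / l).
  by rewrite /frame /org /e /=; congr (_, _); field.
move: DQ; rewrite DE' => -[q _ QE].
exists org, e, p, q; split=> // z zK.
rewrite KE /= DE' FE edist_frame // set_dist_axis // -sqrtr_sqr /edist /=.
have pn : p != 0 by rewrite gt_eqF.
by congr Num.sqrt; rewrite zK; field.
Qed.

Section Params.
Variables (p q : R) (p0 : 0 < p).
Let m := Num.sqrt (q ^+ 2 + p ^+ 2).

Lemma focal_sqr : m ^+ 2 = q ^+ 2 + p ^+ 2.
Proof. by rewrite sqr_sqrtr // addr_ge0 // sqr_ge0. Qed.

Lemma focal_gt0 : 0 < m.
Proof. by rewrite sqrtr_gt0 ltr_wpDl ?sqr_ge0 // exprn_gt0. Qed.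

(** With the focus (0, p), the directrix as first axis and the point (q, 0) on it,
    the tangent with parameter t is the perpendicular bisector of the focus and of
    (t, 0). *)
Definition directrix_log (t : R) : R := ln ((t - q) / (t ^+ 2 + p ^+ 2)).

(** The solution t of exp u = (t - q) / (t ^ 2 + p ^ 2) with the larger t - q. *)
Definition directrix_log_inv (u : R) : R :=
  q + ((expR (- u) - 2 * q) +
    Num.sqrt ((expR (- u) - 2 * q) ^+ 2 - 4 * (q ^+ 2 + p ^+ 2))) / 2.

Lemma directrix_ratio_gt0 t : q < t -> 0 < (t - q) / (t ^+ 2 + p ^+ 2).
Proof.
by move=> qt; rewrite divr_gt0 ?subr_gt0 // ltr_wpDl ?sqr_ge0 // exprn_gt0.
Qed.

Lemma expR_directrix_log t : q < t ->
  expR (directrix_log t) = (t - q) / (t ^+ 2 + p ^+ 2).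
Proof. by move=> qt; rewrite lnK // posrE directrix_ratio_gt0. Qed.

Lemma directrix_log_sum t : q < t ->
  expR (- directrix_log t) - 2 * q = (t - q) + m ^+ 2 / (t - q).
Proof.
move=> qt; have tq : t - q != 0 by rewrite gt_eqF // subr_gt0.
have tp : t ^+ 2 + p ^+ 2 != 0.
  by rewrite gt_eqF // ltr_wpDl ?sqr_ge0 // exprn_gt0.
by rewrite expRN expR_directrix_log // focal_sqr; field; rewrite tq tp.
Qed.

Lemma directrix_discr t : q < t ->
  (expR (- directrix_log t) - 2 * q) ^+ 2 - 4 * (q ^+ 2 + p ^+ 2) =
  ((t - q) - m ^+ 2 / (t - q)) ^+ 2.
Proof.
move=> qt; have tq : t - q != 0 by rewrite gt_eqF // subr_gt0.
by rewrite directrix_log_sum // -focal_sqr; field.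
Qed.

Lemma directrix_gap t : m < t - q -> 0 < (t - q) - m ^+ 2 / (t - q).
Proof.
move=> mt; have m0 := focal_gt0; have t0 : 0 < t - q by apply: lt_trans mt.
rewrite subr_gt0 ltr_pdivrMr // -expr2.
by rewrite ltrXn2r // ltW.
Qed.

Lemma local_iso1_directrix (t0 : R) : m < t0 - q ->
  local_iso1 directrix_log directrix_log_inv t0 (directrix_log t0).
Proof.
move=> mt; have m0 := focal_gt0.
have above t : m < t - q -> q < t.
  by move=> h; rewrite -subr_gt0; apply: lt_trans h.
have hk t : m < t - q -> directrix_log_inv (directrix_log t) = t.
  move=> h; have qt := above _ h.
  have tq : t - q != 0 by rewrite gt_eqF // subr_gt0.
  rewrite /directrix_log_inv directrix_discr // sqrtr_sqr gtr0_norm ?directrix_gap //.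
  by rewrite directrix_log_sum //; field.
have dpos : 0 < (expR (- directrix_log t0) - 2 * q) ^+ 2 - 4 * (q ^+ 2 + p ^+ 2).
  by rewrite directrix_discr ?above // exprn_gt0 // directrix_gap.
have ak : analytic1 directrix_log_inv (directrix_log t0).
  move=> h w0 ah e; rewrite /directrix_log_inv; analytic.
  by rewrite e.
have tp (t : R) : 0 < t ^+ 2 + p ^+ 2 by rewrite ltr_wpDl ?sqr_ge0 // exprn_gt0.
split=> //.
- move=> h w0 ah e; rewrite /directrix_log; analytic.
    by rewrite e directrix_ratio_gt0 // above.
  by rewrite gt_eqF.
- have : \forall t \near t0, 0 < t - q - m.
    by apply: (@near_gt0 _ (fun t => t - q - m)); [analytic|rewrite subr_gt0].
  by apply: filterS => t; rewrite subr_gt0; exact: hk.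
- have n1 : \forall u \near directrix_log t0,
      0 < (expR (- u) - 2 * q) ^+ 2 - 4 * (q ^+ 2 + p ^+ 2).
    apply: (@near_gt0 _ (fun u => (expR (- u) - 2 * q) ^+ 2 - 4 * (q ^+ 2 + p ^+ 2))) => //.
    by analytic.
  have n2 : \forall u \near directrix_log t0, 0 < directrix_log_inv u - q.
    apply: (@near_comp1 _ _ (fun t => 0 < t - q)) => //; rewrite hk //.
    have : \forall t \near t0, q < t by apply: lt_nbhsr; exact: above.
    by apply: filterS => t; rewrite subr_gt0.
  apply: filterS2 n1 n2 => u u1 u2; rewrite /directrix_log.
  set t := directrix_log_inv u in u2 *.
  (* t - q is a root of X ^ 2 - E X + q ^ 2 + p ^ 2 with E = exp (- u) - 2 q *)
  have E : (t - q) ^+ 2 + (q ^+ 2 + p ^+ 2) = (expR (- u) - 2 * q) * (t - q).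
    have S := sqr_sqrtr (ltW u1).
    rewrite /t /directrix_log_inv.
    set s := Num.sqrt _ in S *; set E := expR (- u) - 2 * q in S *.
    transitivity ((s ^+ 2 - (E ^+ 2 - 4 * (q ^+ 2 + p ^+ 2))) / 4 +
      E * (q + (E + s) / 2 - q)); first by field.
    by rewrite S subrr mul0r add0r.
  have -> : t ^+ 2 + p ^+ 2 = expR (- u) * (t - q).
    transitivity (((t - q) ^+ 2 + (q ^+ 2 + p ^+ 2)) + 2 * q * (t - q)); first by ring.
    by rewrite E; ring.
  have tq : t - q != 0 by rewrite gt_eqF.
  rewrite expRN (_ : _ / _ = expR u) ?expRK //.
  by field; rewrite gt_eqF ?expR_gt0.
Qed.

End Params.

(** The tangents with parameters t1 and t2 meet in a point z such that
    |z - Q|^2 - |z - F|^2 = (t1 - q) (t2 - q) and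
    4 p^2 |z - F|^2 = (t1^2 + p^2) (t2^2 + p^2). *)
Lemma tangents_of_parabola_web (K D : set (plane R)) F Q (P : set (set (plane R))) :
  is_parabola K F D -> D Q -> hyperbolic_pencil P F Q ->
  contains_hexagonal_web_twice (tangent_lines K) P.
Proof.
move=> Kpar /(parabola_frame Kpar) [org [e [p [q [e1 p0 FE QE KP]]]]].
move=> /hyperbolic_pencil_span [f1 [f2 [PE _ s1 s2]]].
have pn : p != 0 by rewrite gt_eqF.
set m := Num.sqrt (q ^+ 2 + p ^+ 2).
have m0 : 0 < m by exact: focal_gt0.
have qt1 : q < q + 3 * m by lra.
have qt2 : q < q + 2 * m by lra.
have i1 := @local_iso1_directrix p q p0 (q + 3 * m) ltac:(rewrite -/m; lra).
have i2 := @local_iso1_directrix p q p0 (q + 2 * m) ltac:(rewrite -/m; lra).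
set h := directrix_log p q in i1 i2.
set t1 := q + 3 * m in qt1 i1; set t2 := q + 2 * m in qt2 i2.
have t21 : t2 < t1 by rewrite /t1 /t2; lra.
pose Phi z : plane R := (2 * z.1, 2 * p * z.2 - p ^+ 2).
pose Psi s : plane R := (s.1 / 2, (s.2 + p ^+ 2) / (2 * p)).
have PhiK z : Psi (Phi z) = z.
  by rewrite [RHS]surjective_pairing /Psi /Phi /=; congr (_, _); field.
have PsiK s : Phi (Psi s) = s.
  by rewrite [RHS]surjective_pairing /Psi /Phi /=; congr (_, _); field.
have iPhi : local_iso Phi Psi (Psi (t1 + t2, t1 * t2)) (t1 + t2, t1 * t2).
  split; first exact: PsiK.
  - by split=> h' k w ah ak _; rewrite /Phi /=; analytic.
  - by split=> h' k w ah ak _; rewrite /Psi /=; analytic.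
  - by near=> z; rewrite PhiK.
  - by near=> z; rewrite PsiK.
pose A : plane R := (q, 0); pose B : plane R := (0, p).
have AB : A <> B by move=> [_ /esym/eqP]; rewrite (negbTE pn).
pose mu w := 1 + 4 * p ^+ 2 * expR w.
have mu1 w : 1 < mu w by rewrite /mu ltrDl mulr_gt0 ?expR_gt0 // mulr_gt0 ?exprn_gt0.
set w0 := h t1 + h t2.
pose Dr := mu w0 * sqdist A B / (1 - mu w0) ^+ 2.
have D0 : 0 < Dr.
  apply: divr_gt0; last by rewrite exprn_even_gt0 //= subr_eq0 lt_eqF.
  by apply: mulr_gt0; [apply: lt_trans (mu1 _)|exact: sqdist_gt0].
have rho0 : 0 < Dr / 2 by rewrite divr_gt0.
have rhoD : Dr / 2 < Dr by rewrite ltr_pdivrMr // ltr_pMr // ltr1n.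
have T t : in_coords org e (tangent_lines K) (parabola_tangent p t) /\
    arc_carrier (Dr / 2) (parabola_tangent p t).
  have [T lT] := parabola_tangent_line t pn; split; last by right.
  exact: (in_coords_tangent_lines e1 KP T).
apply: (@symmetric_web _ org e e1 (tangent_lines K) P (Dr / 2) rho0 t1 t2 t21 Phi Psi _
  iPhi h _ _ i1 i2 (parabola_tangent p) (fun w => apollonius A B (mu w))).
- by near=> t; exact: T.
- by near=> t; exact: T.
- near=> s => t; rewrite /parabola_tangent /Psi /=.
  by rewrite (_ : _ - p ^+ 2 = t ^+ 2 - s.1 * t + s.2) //; field.
- apply: (near_apollonius e1 QE FE AB PE s2 s1) => //; last 2 first.
  + by apply: lt_trans (mu1 _).
  + by rewrite gt_eqF.
  by rewrite /mu; analytic.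
- have nT : \forall w \near w0, True by near=> w.
  have n1 : \forall t \near t1, q < t by exact: lt_nbhsr.
  have n2 : \forall t \near t2, q < t by exact: lt_nbhsr.
  have nt : \forall t \near (t1, t2), q < t.1 /\ q < t.2.
    by apply: filterS2 (near_fst t2 n1) (near_snd t1 n2).
  apply: filterS (near_product nT nt) => -[w t] /= [_ [q1 q2]].
  have tp (x : R) : x ^+ 2 + p ^+ 2 != 0.
    by rewrite gt_eqF // ltr_wpDl ?sqr_ge0 // exprn_gt0.
  have -> : (h t.1 + h t.2 = w) <-> (expR w = expR (h t.1 + h t.2)).
    by split=> [->//|/expR_inj ->].
  rewrite expRD /h !expR_directrix_log // /apollonius /=.
  set E := expR w; rewrite /mu -/E.
  apply: (@iff_of_factor _ (- ((t.1 ^+ 2 + p ^+ 2) * (t.2 ^+ 2 + p ^+ 2))^-1)).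
    by rewrite oppr_eq0 invr_eq0 mulf_neq0.
  by rewrite /sqdist /Psi /sum_prod /A /B /=; field; rewrite ?tp ?pn.
Unshelve. all: by end_near. Qed.

End ParabolaWeb.

(** * Circles doubly tangent to an ellipse *)

Section CircleTangent.
Context {R : realType}.
Implicit Types (p q c z s : plane R).

Lemma circle_tangent_line c (r : R) p : 0 < r -> sqdist p c = r ^+ 2 ->
  r + (p.1 - c.1) != 0 ->
  tangent_line_at (circle c r) p
    [set z | (p.1 - c.1) * (z.1 - c.1) + (p.2 - c.2) * (z.2 - c.2) = r ^+ 2].
Proof.
move=> r0 pc rp; have rn : r != 0 by rewrite gt_eqF.
have e1 : ((1, 0) : plane R).1 ^+ 2 + ((1, 0) : plane R).2 ^+ 2 = 1.
  by rewrite /= expr1n expr0n addr0.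
have frE z : frame c (1, 0) z = (c.1 + z.1, c.2 + z.2).
  by rewrite /frame /=; congr (_, _); ring.
pose z0 : plane R := (p.1 - c.1, p.2 - c.2).
have fz0 : frame c (1, 0) z0 = p by rewrite frE /= !subrKC -surjective_pairing.
have zK : conic r (r ^+ 2) z0.
  by rewrite /conic /= -mulrDl -[X in X / _]/(sqdist p c) pc divff // sqrf_eq0.
have r2 : r ^+ 2 != 0 by rewrite sqrf_eq0.
have [T _] := conic_tangent_line rn r2 zK rp.
have KC z : conic r (r ^+ 2) z -> circle c r (frame c (1, 0) z).
  rewrite /conic /= => zE; apply/(circleE _ _ (ltW r0)); rewrite frE /sqdist /=.
  rewrite !(addrC _ (- _)) !addKr -[RHS]mul1r -zE; field.
  done.
have := tangent_line_frame e1 KC T; rewrite fz0.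
rewrite (_ : _ @` _ = [set z | (p.1 - c.1) * (z.1 - c.1) +
   (p.2 - c.2) * (z.2 - c.2) = r ^+ 2]) //.
have key a b : a / r ^+ 2 + b / r ^+ 2 = 1 <-> a + b = r ^+ 2.
  rewrite -mulrDl; split=> [E|->]; last by rewrite divff.
  by rewrite -[LHS](divfK r2) E mul1r.
apply/seteqP; split=> q /=.
  move=> [z zE <-]; apply/key; rewrite frE /= !(addrC c.1, addrC c.2) !addrK.
  by move: zE; rewrite /conic_tangent /= => <-; congr (_ + _); rewrite mulrAC.
move=> /key E; exists (q.1 - c.1, q.2 - c.2).
  by rewrite /conic_tangent /= -E; congr (_ + _); rewrite mulrAC.
by rewrite frE /= !subrKC -surjective_pairing.
Qed.

End CircleTangent.

Section CirclesOfEllipse.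
Context {R : realType}.
Implicit Types (p q c z s : plane R).

Section HalfEccentricity.
Variables (c : R) (c0 : 0 < c).

(** The circle with centre (k, 0) and squared radius c ^ 2 - k ^ 2. *)
Definition bitangent_zeros (k : R) : set (plane R) :=
  [set z | z.1 ^+ 2 + z.2 ^+ 2 - c ^+ 2 - 2 * k * z.1 + 2 * k ^+ 2 = 0].

Lemma bitangent_circle k : 0 < c ^+ 2 - k ^+ 2 ->
  bitangent_zeros k = circle (k, 0) (Num.sqrt (c ^+ 2 - k ^+ 2)).
Proof.
move=> ck; apply/esym/zeros_circle; first by rewrite sqrtr_gt0.
by move=> z; rewrite sqr_sqrtr ?ltW // subr0; ring.
Qed.

(** The contact points have first coordinate 2 k; they are real and distinct for
    2 k ^ 2 < c ^ 2. *)
Lemma bitangent_doubly_tangent o e (K axis : set (plane R)) k :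
  e.1 ^+ 2 + e.2 ^+ 2 = 1 ->
  (forall z, conic (Num.sqrt 2 * c) (c ^+ 2) z -> K (frame o e z)) ->
  (forall x, axis (frame o e (x, 0))) -> 0 < k -> 2 * k ^+ 2 < c ^+ 2 ->
  in_coords o e (doubly_tangent_circles K axis) (bitangent_zeros k).
Proof.
move=> e1 KP ax k0 kc; have cn : c != 0 by rewrite gt_eqF.
have ck : 0 < c ^+ 2 - k ^+ 2 by nra.
have s2 : Num.sqrt 2 ^+ 2 = 2 :> R by rewrite sqr_sqrtr.
have s0 : 0 < Num.sqrt 2 :> R by rewrite sqrtr_gt0.
have yy : 0 < c ^+ 2 - 2 * k ^+ 2 by rewrite subr_gt0.
pose y := Num.sqrt (c ^+ 2 - 2 * k ^+ 2).
have y0 : 0 < y by rewrite sqrtr_gt0.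
have y2 : y ^+ 2 = c ^+ 2 - 2 * k ^+ 2 by rewrite sqr_sqrtr // ltW.
pose r := Num.sqrt (c ^+ 2 - k ^+ 2).
have r0 : 0 < r by rewrite sqrtr_gt0.
have r2 : r ^+ 2 = c ^+ 2 - k ^+ 2 by rewrite sqr_sqrtr // ltW.
have T (w : R) : w ^+ 2 = y ^+ 2 ->
   tangent_line_at (circle (k, 0) r) (2 * k, w)
     (conic_tangent (Num.sqrt 2 * c) (c ^+ 2) (2 * k, w)) /\
   tangent_line_at (conic (Num.sqrt 2 * c) (c ^+ 2)) (2 * k, w)
     (conic_tangent (Num.sqrt 2 * c) (c ^+ 2) (2 * k, w)).
  move=> w2; split.
    have := @circle_tangent_line _ (k, 0) r (2 * k, w) r0; rewrite /sqdist /=.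
    rewrite (_ : (2 * k - k) ^+ 2 + (w - 0) ^+ 2 = r ^+ 2); last first.
      by rewrite subr0 w2 y2 r2; ring.
    move=> /(_ erefl); rewrite (_ : 2 * k - k = k); last by ring.
    have rk : r + k != 0 by rewrite gt_eqF // addr_gt0.
    move=> /(_ rk); congr tangent_line_at; apply/seteqP; split=> z; rewrite /conic_tangent /= exprMn s2.
      move=> E; transitivity ((k * z.1 + w * z.2) / c ^+ 2); first by field.
      rewrite (_ : k * z.1 + w * z.2 = c ^+ 2) ?divff ?sqrf_eq0 //.
      transitivity (k * (z.1 - k) + (w - 0) * (z.2 - 0) + k ^+ 2); first by ring.
      by rewrite E r2; ring.
    move=> E; rewrite r2.
    transitivity (c ^+ 2 * (2 * k / (2 * c ^+ 2) * z.1 + w / c ^+ 2 * z.2) - k ^+ 2).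
      by field.
    by rewrite E mulr1.
  have h1 : Num.sqrt 2 * c != 0 by rewrite mulf_neq0 // gt_eqF.
  have h2 : c ^+ 2 != 0 by rewrite sqrf_eq0.
  have h3 : conic (Num.sqrt 2 * c) (c ^+ 2) (2 * k, w).
    by rewrite /conic /= [(_ * c) ^+ 2]exprMn s2 w2 y2; field.
  have h4 : Num.sqrt 2 * c + ((2 * k, w) : plane R).1 != 0.
    by rewrite gt_eqF //= addr_gt0 ?mulr_gt0.
  by have [] := conic_tangent_line h1 h2 h3 h4.
have [T1 T2] := T y erefl; have [T3 T4] := T (- y) (sqrrN y).
rewrite bitangent_circle //.
apply: (in_coords_doubly_tangent e1 KP r0 (ax k) _ T1 T2 T3 T4).
by move=> [E]; lra.
Qed.

Definition center_log (k : R) : R := ln (k ^+ 2 / (c ^+ 2 - k ^+ 2)).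

Definition center_log_inv (u : R) : R :=
  Num.sqrt (c ^+ 2 * expR u / (1 + expR u)).

Lemma expR_center_log k : 0 < k -> k < c ->
  expR (center_log k) = k ^+ 2 / (c ^+ 2 - k ^+ 2).
Proof.
move=> k0 kc; rewrite lnK // posrE divr_gt0 ?exprn_gt0 // subr_gt0.
by rewrite ltrXn2r // ltW.
Qed.

Lemma local_iso1_center (k0 : R) : 0 < k0 -> k0 < c ->
  local_iso1 center_log center_log_inv k0 (center_log k0).
Proof.
move=> k00 k0c; have cn : c != 0 by rewrite gt_eqF.
have gap k : 0 < k -> k < c -> 0 < c ^+ 2 - k ^+ 2.
  by move=> h1 h2; rewrite subr_gt0 ltrXn2r // ltW.
have E2 k : 0 < k -> k < c ->
    c ^+ 2 * expR (center_log k) / (1 + expR (center_log k)) = k ^+ 2.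
  move=> h1 h2; rewrite expR_center_log //; have := gap _ h1 h2 => g.
  field.
  by rewrite gt_eqF //= (_ : _ + _ = c ^+ 2) ?sqrf_eq0 //; ring.
split=> //.
- move=> h w0 ah e; rewrite /center_log; analytic; rewrite e.
    by rewrite divr_gt0 ?exprn_gt0 // gap.
  by rewrite gt_eqF // gap.
- move=> h w0 ah e; rewrite /center_log_inv; analytic; rewrite e.
    by rewrite E2 // exprn_gt0.
  by rewrite gt_eqF // addr_gt0 ?expR_gt0.
- have n1 : \forall k \near k0, 0 < k by exact: lt_nbhsr.
  have n2 : \forall k \near k0, k < c by exact: lt_nbhsl.
  by apply: filterS2 n1 n2 => k h1 h2; rewrite /center_log_inv E2 // sqrtr_sqr gtr0_norm.
- near=> u; rewrite /center_log /center_log_inv.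
  have E0 : 0 < expR u by exact: expR_gt0.
  have E1 : 1 + expR u != 0 by rewrite gt_eqF // addr_gt0.
  rewrite sqr_sqrtr; last by rewrite ltW // divr_gt0 ?mulr_gt0 ?exprn_gt0 ?addr_gt0.
  rewrite -[RHS]expRK; congr ln; field.
  by rewrite E1 /= (_ : _ - _ = c ^+ 2) ?sqrf_eq0 //; ring.
Unshelve. all: by end_near. Qed.

End HalfEccentricity.

(** For z on the circles k1 and k2, z.2 ^ 2 = c^2 - k1^2 - k2^2, and
    (c^2 - k1^2) (c^2 - k2^2) = c^2 z.2 ^ 2 + k1^2 k2^2.  The quotient
    2 k1 k2 / z.2, which is constant on the circles through the foci, is thus a
    function of exp (h k1 + h k2). *)
Lemma circles_of_ellipse_web (K : set (plane R)) F1 F2 (a : R)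
    (P : set (set (plane R))) :
  is_ellipse K F1 F2 a -> eccentricity F1 F2 a = 1 / Num.sqrt 2 ->
  elliptic_pencil P F1 F2 ->
  contains_hexagonal_web_twice (doubly_tangent_circles K (major_axis F1 F2)) P.
Proof.
move=> [aF KE] ecc /elliptic_pencil_span [f1 [f2 [PE F12 sp1 sp2]]].
have [org [e [c [e1 c0 dE F1E F2E]]]] := foci_frame F12.
have cn : c != 0 by rewrite gt_eqF.
have s0 : 0 < Num.sqrt 2 :> R by rewrite sqrtr_gt0.
have sn : Num.sqrt 2 != 0 :> R by rewrite gt_eqF.
have s2 : Num.sqrt 2 ^+ 2 = 2 :> R by rewrite sqr_sqrtr.
have a0 : 0 < a by lra.
have aE : a = Num.sqrt 2 * c.
  move: ecc; rewrite /eccentricity dE => E.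
  have analytic_near : a != 0 by rewrite gt_eqF.
  have -> : a = c / (2 * c / (2 * a)) by field; rewrite ?analytic_near ?cn.
  by rewrite E; field; rewrite ?sn ?cn.
have KP z : conic (Num.sqrt 2 * c) (c ^+ 2) z -> K (frame org e z).
  move=> zK; rewrite KE /= F1E F2E !edist_frame //.
  apply: conic_sub_ellipse => //; [exact: ltW|lra|].
  by rewrite aE (_ : (Num.sqrt 2 * c) ^+ 2 - c ^+ 2 = c ^+ 2) // exprMn s2; ring.
have ax x : major_axis F1 F2 (frame org e (x, 0)).
  exists ((c - x) / (2 * c)); rewrite F1E F2E /vec /frame /=.
  by congr (_, _); field.
set h := center_log c.
have k1c : c / 2 < c by lra.
have k2c : c / 3 < c by lra.
have k10 : 0 < c / 2 by lra.
have k20 : 0 < c / 3 by lra.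
have k21 : c / 3 < c / 2 by lra.
have i1 := local_iso1_center c0 k10 k1c.
have i2 := local_iso1_center c0 k20 k2c.
pose Phi z : plane R := (z.1, (z.1 ^+ 2 + z.2 ^+ 2 - c ^+ 2) / 2).
pose Y s : R := 2 * s.2 + c ^+ 2 - s.1 ^+ 2.
pose Psi s : plane R := (s.1, Num.sqrt (Y s)).
set s_ : plane R := (c / 2 + c / 3, c / 2 * (c / 3)).
have Y0 : 0 < Y s_.
  have -> : Y s_ = c ^+ 2 * (23 / 36) by rewrite /Y /s_ /=; field.
  by rewrite mulr_gt0 ?exprn_gt0 //; lra.
have nY : \forall s \near s_, 0 < Y s.
  by apply: (an_near_gt0 (h := Y)) => //; rewrite /Y; analytic.
have PsiK s : 0 < Y s -> Phi (Psi s) = s.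
  move=> ys; rewrite [RHS]surjective_pairing /Phi /Psi /= sqr_sqrtr ?ltW //.
  by congr (_, _); rewrite /Y; field.
have iPhi : local_iso Phi Psi (Psi s_) s_.
  split; first exact: PsiK.
  - by split=> h' k w ah ak _; rewrite /Phi /=; analytic.
  - split=> h' k w ah ak E; rewrite /Psi /Y /=; analytic.
    by move: Y0; rewrite -E.
  - have : \forall z \near Psi s_, 0 < z.2.
      by apply: (an_near_gt0 (h := snd)); [exact: an_snd|rewrite /= sqrtr_gt0].
    apply: filterS => z z0; rewrite [RHS]surjective_pairing /Phi /Psi /Y /=.
    congr (_, _); rewrite (_ : _ - z.1 ^+ 2 = z.2 ^+ 2); last by field.
    by rewrite sqrtr_sqr gtr0_norm.
  - by apply: filterS nY => s; exact: PsiK.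
pose lam (w : R) := 2 * c * Num.sqrt (expR w / (1 - expR w)).
pose S3 w := circle ((0, lam w / 2) : plane R) (Num.sqrt (c ^+ 2 + (lam w / 2) ^+ 2)).
have cc0 : 0 < c ^+ 2 by rewrite exprn_gt0.
have rho0 : 0 < c ^+ 2 / 2 by rewrite divr_gt0.
have r2 w : 0 < c ^+ 2 + (lam w / 2) ^+ 2 by rewrite ltr_wpDr // sqr_ge0.
have S3E w : S3 w = zeros (fun z => z.1 ^+ 2 + z.2 ^+ 2 - c ^+ 2 - lam w * z.2).
  apply: zeros_circle; first by rewrite sqrtr_gt0.
  by move=> z; rewrite sqr_sqrtr ?ltW // subr0; field.
have T k : 0 < k -> 2 * k ^+ 2 < c ^+ 2 -> \forall k \near k,
    in_coords org e (doubly_tangent_circles K (major_axis F1 F2)) (bitangent_zeros c k) /\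
    arc_carrier (c ^+ 2 / 2) (bitangent_zeros c k).
  move=> k0 kc.
  have n1 : \forall k \near k, 0 < k by exact: lt_nbhsr.
  have n2 : \forall k \near k, 0 < c ^+ 2 - 2 * k ^+ 2.
    by apply: (@near_gt0 _ (fun k => c ^+ 2 - 2 * k ^+ 2)); [analytic|rewrite subr_gt0].
  apply: filterS2 n1 n2 => x x0; rewrite subr_gt0 => xc.
  have cx : 0 < c ^+ 2 - x ^+ 2 by nra.
  split; first exact: bitangent_doubly_tangent.
  rewrite bitangent_circle //; left.
  exists (x, 0), (Num.sqrt (c ^+ 2 - x ^+ 2)); split=> //; first by rewrite sqrtr_gt0.
  by rewrite sqr_sqrtr ?ltW //; lra.
set w0 := h (c / 2) + h (c / 3).
have w0neg : w0 < 0.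
  rewrite -expR_lt1 expRD /h !expR_center_log //.
  rewrite (_ : _ * _ = 1 / 24); first by lra.
  by field; apply/andP; split; rewrite gt_eqF //; lra.
have nw : \forall w \near w0, w < 0 by exact: lt_nbhsl.
apply: (@symmetric_web _ org e e1 _ P (c ^+ 2 / 2) rho0 (c / 2) (c / 3) k21 Phi Psi _
  iPhi h _ _ i1 i2 (bitangent_zeros c) S3).
- by apply: T => //; nra.
- by apply: T => //; nra.
- apply: filterS nY => s ys k; rewrite /bitangent_zeros /Psi /= sqr_sqrtr ?ltW //.
  apply: iff_sym; apply: (@iff_of_factor _ 2); first by rewrite pnatr_eq0.
  by rewrite /Y; ring.
- near=> w; split; last first.
    left; exists (0, lam w / 2), (Num.sqrt (c ^+ 2 + (lam w / 2) ^+ 2)); split=> //.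
      by rewrite sqrtr_gt0.
    rewrite sqr_sqrtr; last exact: ltW.
    apply: (@le_trans _ _ (c ^+ 2)).
      by rewrite ler_pdivrMr // ler_pMr // ler1n.
    by rewrite lerDl sqr_ge0.
  apply: (@in_coords_pencil _ _ _ e1 P f1 f2 _
    (fun z => z.1 ^+ 2 + z.2 ^+ 2 - c ^+ 2 - lam w * z.2) _ PE
    (in_span_comb 1 (- (lam w / (2 * c))) sp1 sp2) _ _ (S3E w)).
    by left; exists (0, lam w / 2), (Num.sqrt (c ^+ 2 + (lam w / 2) ^+ 2));
      rewrite sqrtr_gt0.
  move=> z; rewrite F1E F2E /frame /=.
  transitivity ((z.1 ^+ 2 + z.2 ^+ 2 - c ^+ 2) * (e.1 ^+ 2 + e.2 ^+ 2) -
     lam w * z.2 * (e.1 ^+ 2 + e.2 ^+ 2)); first by rewrite e1 !mulr1.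
  by field.
- have n1 : \forall t \near c / 2, 0 < t by exact: lt_nbhsr.
  have n2 : \forall t \near c / 3, 0 < t by exact: lt_nbhsr.
  have n3 : \forall t \near ((c / 2, c / 3) : plane R), 0 < c ^+ 2 - t.1 ^+ 2 - t.2 ^+ 2.
    apply: an_near_gt0; first by analytic.
    rewrite /= (_ : _ - _ = c ^+ 2 * (23 / 36)); last by field.
    by rewrite mulr_gt0 //; lra.
  have nt : \forall t \near ((c / 2, c / 3) : plane R),
      [/\ 0 < t.1, 0 < t.2 & 0 < c ^+ 2 - t.1 ^+ 2 - t.2 ^+ 2].
    by apply: filterS3 (near_fst (c / 3) n1) (near_snd (c / 2) n2) n3.
  apply: filterS (near_product nw nt) => -[w t] /= [wneg [t1 t2 t3]].
  have g1 : 0 < c ^+ 2 - t.1 ^+ 2 by nra.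
  have g2 : 0 < c ^+ 2 - t.2 ^+ 2 by nra.
  have lt1 : t.1 < c by nra.
  have lt2 : t.2 < c by nra.
  have -> : (h t.1 + h t.2 = w) <-> (expR w = expR (h t.1 + h t.2)).
    by split=> [->//|/expR_inj ->].
  have E1 : expR w < 1 by rewrite expR_lt1.
  have E0 : 0 < expR w by exact: expR_gt0.
  rewrite expRD /h !expR_center_log // S3E /zeros /Psi /Y /sum_prod /=.
  set E := expR w in E0 E1 *.
  have YE : 2 * (t.1 * t.2) + c ^+ 2 - (t.1 + t.2) ^+ 2 = c ^+ 2 - t.1 ^+ 2 - t.2 ^+ 2.
    by ring.
  rewrite YE sqr_sqrtr ?ltW //.
  rewrite (_ : _ - c ^+ 2 - _ = 2 * (t.1 * t.2) - lam w * Num.sqrt (c ^+ 2 - t.1 ^+ 2 - t.2 ^+ 2)); last by ring.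
  set y := Num.sqrt _.
  have y0 : 0 < y by rewrite sqrtr_gt0.
  have y2 : y ^+ 2 = c ^+ 2 - t.1 ^+ 2 - t.2 ^+ 2 by rewrite sqr_sqrtr // ltW.
  have l0 : 0 < lam w.
    by rewrite /lam mulr_gt0 ?mulr_gt0 // sqrtr_gt0 divr_gt0 // subr_gt0.
  have l2 : lam w ^+ 2 = 4 * c ^+ 2 * (E / (1 - E)).
    rewrite /lam -/E exprMn sqr_sqrtr; first by ring.
    by apply: divr_ge0; rewrite ?subr_ge0 ltW.
  have -> : (2 * (t.1 * t.2) - lam w * y = 0) <-> ((2 * (t.1 * t.2)) ^+ 2 = (lam w * y) ^+ 2).
    split=> [/eqP|E2]; first by rewrite subr_eq0 => /eqP ->.
    apply/eqP; rewrite subr_eq0 -(eqrXn2 (n := 2)) ?E2 //; last by rewrite mulr_ge0 // ltW.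
    by rewrite !mulr_ge0 // ltW.
  rewrite exprMn [(lam w * y) ^+ 2]exprMn l2 y2.
  apply: (@iff_of_factor _ (- (1 - E) / (4 * (c ^+ 2 - t.1 ^+ 2) * (c ^+ 2 - t.2 ^+ 2)))).
    rewrite !mulf_neq0 ?oppr_eq0 ?invr_eq0 ?mulf_neq0 ?pnatr_eq0 ?gt_eqF //.
    by rewrite subr_gt0.
  by field; apply/and3P; split; rewrite gt_eqF // subr_gt0.
Unshelve. all: by end_near. Qed.

End CirclesOfEllipse.

(** * Tangents, focal lines and doubly tangent circles of a general conic *)

Section Continuity.
Context {R : realType}.

Lemma an_continuous1 (f : R -> R) (t0 : R) : analytic_near (fun q => f q.1) (t0, 0) ->
  {for t0, continuous f}.
Proof.
move=> af P nP; apply: (@near_axis _ (fun t => P (f t)) t0 0).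
exact: (an_continuous af nP).
Qed.

Lemma continuous_on_fst (f : R -> R) (u0 : R) (w0 : plane R) :
  {for u0, continuous f} ->
  {for ((u0, w0) : R * plane R), continuous (fun z => f z.1)}.
Proof.
move=> cf; apply: (@cvg_comp _ _ _ fst f (nbhs ((u0, w0) : R * plane R)) (nbhs u0)) cf.
exact: (@cvg_fst _ _ (nbhs u0) (nbhs w0)).
Qed.

Lemma continuous_on_snd (g : plane R -> R) (u0 : R) (w0 : plane R) :
  {for w0, continuous g} ->
  {for ((u0, w0) : R * plane R), continuous (fun z => g z.2)}.
Proof.
move=> cg; apply: (@cvg_comp _ _ _ snd g (nbhs ((u0, w0) : R * plane R)) (nbhs w0)) cg.
exact: (@cvg_snd _ _ (nbhs u0) (nbhs w0)).
Qed.

Lemma continuous_near_neq0 (H : R * plane R -> R) z0 : {for z0, continuous H} ->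
  H z0 != 0 -> \forall z \near z0, H z != 0.
Proof.
move=> cH H0; apply: (cH [set x | x != 0]); apply: open_nbhs_nbhs; split=> //.
Qed.

Lemma near_reparam2 (k : R -> R) (K : plane R -> plane R)
    (P : R * plane R -> Prop) u0 w0 :
  {for u0, continuous k} -> {for w0, continuous K} ->
  (\forall z \near ((k u0, K w0) : R * plane R), P z) ->
  \forall z \near ((u0, w0) : R * plane R), P (k z.1, K z.2).
Proof.
move=> ck cK [[A B] [/= nA nB] AB]; exists (k @^-1` A, K @^-1` B).
  by split=> //=; [exact: ck|exact: cK].
by move=> [c w] [/= Ac Bw]; exact: AB.
Qed.

Lemma local_iso1_atan (t0 : R) : local_iso1 (@atan R) (@tan R) t0 (atan t0).
Proof.
have pos : 0 < cos (atan t0).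
  by apply: cos_gt0_pihalf; rewrite atan_gtNpi2 atan_ltpi2.
split=> //.
- by move=> h w0 ah _; analytic.
- by move=> h w0 ah e; rewrite /tan; analytic; rewrite e gt_eqF.
- by near=> t; exact: atanK.
- have n1 : \forall u \near atan t0, - (pi / 2) < u by apply: lt_nbhsr; exact: atan_gtNpi2.
  have n2 : \forall u \near atan t0, u < pi / 2 by apply: lt_nbhsl; exact: atan_ltpi2.
  by apply: filterS2 n1 n2 => u u1 u2; rewrite tanK // in_itv /= u1 u2.
Unshelve. all: by end_near. Qed.

End Continuity.

Section FocalWeb.
Context {R : realType}.
Implicit Types (p q z w : plane R).

Section Chart.
Variables (a c : R) (a0 : 0 < a) (c0 : 0 < c) (ac : a != c).
Let B := a ^+ 2 - c ^+ 2.
Local Notation D t := (Num.sqrt (a ^+ 2 + B * t ^+ 2)).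

Let Bn0 : B != 0.
Proof.
rewrite /B (_ : _ - _ = (a - c) * (a + c)); last by ring.
by rewrite mulf_neq0 ?subr_eq0 // gt_eqF // addr_gt0.
Qed.

(** The intersection of the tangent z.1 + s.1 * z.2 = D s.1 with the line of slope
    - s.2 through the focus (c, 0).  With the slope negated, the circle of the
    third family depends on the sum of the arctangents of s.1 and s.2. *)
Definition focal_point (s : plane R) : plane R :=
  (c + (D s.1 - c) / (1 - s.1 * s.2), - s.2 * ((D s.1 - c) / (1 - s.1 * s.2))).

Definition focal_discr z := a ^+ 2 * z.2 ^+ 2 + B * z.1 ^+ 2 - a ^+ 2 * B.

(** The slope parameter of a tangent through z solves a quadratic equation.  It is
    taken in the form with the root in the denominator, which stays regular where
    the leading coefficient vanishes and has the value 0 at the base point. *)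
Definition focal_slopes z : plane R :=
  ((a ^+ 2 - z.1 ^+ 2) / (z.1 * z.2 + Num.sqrt (focal_discr z)),
   - z.2 / (z.1 - c)).

(* the base point lies at positive height on the tangent at the vertex (a, 0) *)
Variables (m0 : R) (m0s : 0 < - m0 * (a - c)).
Let s0 : plane R := (0, m0).

Lemma focal_D0 : D 0 = a.
Proof. by rewrite expr0n mulr0 addr0 sqrtr_sqr gtr0_norm. Qed.

Lemma focal_base : focal_point s0 = (a, - m0 * (a - c)).
Proof.
by rewrite /focal_point /s0 /= focal_D0 mul0r subr0 divr1 subrKC.
Qed.

(** The discriminant of the quadratic equation for the slope is the square of half
    its derivative at the root s.1. *)
Lemma focal_discr_root (s : plane R) : 0 < a ^+ 2 + B * s.1 ^+ 2 ->
  1 - s.1 * s.2 != 0 ->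
  let z := focal_point s in
  [/\ z.1 + s.1 * z.2 = D s.1,
     a ^+ 2 - z.1 ^+ 2 = s.1 * (s.1 * (z.2 ^+ 2 - B) + 2 * z.1 * z.2)
   & focal_discr z = (s.1 * (z.2 ^+ 2 - B) + z.1 * z.2) ^+ 2].
Proof.
move=> d0 n0 z.
have E1 : z.1 + s.1 * z.2 = D s.1 by rewrite /z /focal_point /=; field.
have E2 : (z.1 + s.1 * z.2) ^+ 2 = a ^+ 2 + B * s.1 ^+ 2.
  by rewrite E1 sqr_sqrtr // ltW.
have E3 : a ^+ 2 - z.1 ^+ 2 = s.1 * (s.1 * (z.2 ^+ 2 - B) + 2 * z.1 * z.2).
  transitivity (s.1 * (s.1 * (z.2 ^+ 2 - B) + 2 * z.1 * z.2) +
    (a ^+ 2 + B * s.1 ^+ 2 - (z.1 + s.1 * z.2) ^+ 2)); first by ring.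
  by rewrite E2 subrr addr0.
split=> //; rewrite /focal_discr.
transitivity (z.1 ^+ 2 * z.2 ^+ 2 + (z.2 ^+ 2 - B) * (a ^+ 2 - z.1 ^+ 2)); first by ring.
by rewrite E3; ring.
Qed.

Lemma local_iso_focal : local_iso focal_slopes focal_point (focal_point s0) s0.
Proof.
have an0 : a != 0 by rewrite gt_eqF.
have acn : a - c != 0 by rewrite subr_eq0.
pose y0 := - m0 * (a - c); have y00 : 0 < y0 by [].
have disc0 : focal_discr (a, y0) = (a * y0) ^+ 2 by rewrite /focal_discr /=; ring.
have sd0 : Num.sqrt (focal_discr (a, y0)) = a * y0.
  by rewrite disc0 sqrtr_sqr gtr0_norm // mulr_gt0.
have dd0 : 0 < focal_discr (a, y0) by rewrite disc0 exprn_gt0 // mulr_gt0.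
have den0 : a * y0 + Num.sqrt (focal_discr (a, y0)) != 0.
  by rewrite sd0 gt_eqF // addr_gt0 // mulr_gt0.
have af : analytic_map focal_slopes (a, y0).
  by split=> h k w ah ak E; have hE := congr1 fst E; have kE := congr1 snd E;
    rewrite /= in hE kE; rewrite /focal_slopes /focal_discr /=; analytic;
    rewrite ?hE ?kE.
have ag : analytic_map focal_point s0.
  have d1 (x : plane R) : x = s0 -> 0 < a ^+ 2 + B * x.1 ^+ 2.
    by move=> ->; rewrite /s0 /= expr0n mulr0 addr0 exprn_gt0.
  have d2 (x : plane R) : x = s0 -> 1 - x.1 * x.2 != 0.
    by move=> ->; rewrite /s0 /= mul0r subr0 oner_neq0.
  by split=> h k w ah ak E; have := d1 _ E; have := d2 _ E; move=> /= h2 h1;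
    rewrite /focal_point /=; analytic.
have near_g : \forall s \near s0, focal_slopes (focal_point s) = s.
  have n1 : \forall s \near s0, 0 < a ^+ 2 + B * s.1 ^+ 2.
    apply: (an_near_gt0 (h := fun s => a ^+ 2 + B * s.1 ^+ 2)); first by analytic.
    by rewrite /s0 /= expr0n mulr0 addr0 exprn_gt0.
  have n2 : \forall s \near s0, 1 - s.1 * s.2 != 0.
    apply: (an_near_neq0 (h := fun s => 1 - s.1 * s.2)).
      by analytic.
    by rewrite /s0 /= mul0r subr0 oner_neq0.
  pose P s := 0 < (focal_point s).1 * (focal_point s).2 /\
    0 < s.1 * ((focal_point s).2 ^+ 2 - B) + (focal_point s).1 * (focal_point s).2.
  have a1 : analytic_near (fun s => (focal_point s).1) s0 by case: ag => /analytic2_near.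
  have a2 : analytic_near (fun s => (focal_point s).2) s0 by case: ag => _ /analytic2_near.
  have n3 : \forall s \near s0, 0 < (focal_point s).1 * (focal_point s).2.
    apply: (an_near_gt0 (h := fun s => (focal_point s).1 * (focal_point s).2)).
      by analytic.
    by rewrite focal_base mulr_gt0.
  have n4 : \forall s \near s0,
      0 < s.1 * ((focal_point s).2 ^+ 2 - B) + (focal_point s).1 * (focal_point s).2.
    apply: (an_near_gt0 (h := fun s => s.1 * ((focal_point s).2 ^+ 2 - B) +
      (focal_point s).1 * (focal_point s).2)); first by analytic.
    by rewrite focal_base /s0 /= mul0r add0r mulr_gt0.
  have n5 : \forall s \near s0, (focal_point s).1 - c != 0.
    apply: (an_near_neq0 (h := fun s => (focal_point s).1 - c)).
      by analytic.
    by rewrite focal_base.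
  apply: filterS2 (filterI n1 n2) (filterI (filterI n3 n4) n5) => s [d n] [[p1 p2] p3].
  have [E1 E2 E3] := focal_discr_root d n.
  rewrite [RHS]surjective_pairing /focal_slopes E2 E3 sqrtr_sqr gtr0_norm //.
  set z := focal_point s in p1 p2 p3 *; congr (_, _).
    have p12 : z.1 * z.2 + (s.1 * (z.2 ^+ 2 - B) + z.1 * z.2) != 0.
      by rewrite gt_eqF // addr_gt0.
    by apply: (mulIf p12); rewrite divfK //; ring.
  have zE : z.2 = - s.2 * (z.1 - c) by rewrite /z /focal_point /=; field.
  by rewrite zE; field.
have near_f : \forall z \near ((a, y0) : plane R), focal_point (focal_slopes z) = z.
  pose T z := (focal_slopes z).1.
  have aT : analytic_near T (a, y0) by case: af => /analytic2_near.
  have T0 : T (a, y0) = 0 by rewrite /T /focal_slopes /= subrr mul0r.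
  have n1 : \forall z \near ((a, y0) : plane R), 0 < focal_discr z.
    by apply: an_near_gt0 => //; rewrite /focal_discr; analytic.
  have n2 : \forall z \near ((a, y0) : plane R), z.1 * z.2 + Num.sqrt (focal_discr z) != 0.
    apply: (an_near_neq0 (h := fun z => z.1 * z.2 + Num.sqrt (focal_discr z))) => //.
    by rewrite /focal_discr; analytic.
  have n3 : \forall z \near ((a, y0) : plane R), 0 < z.1 + T z * z.2.
    apply: (an_near_gt0 (h := fun z => z.1 + T z * z.2)); first by analytic.
    by rewrite T0 mul0r addr0.
  have n4 : \forall z \near ((a, y0) : plane R), z.1 - c != 0.
    apply: (an_near_neq0 (h := fun z => z.1 - c)) => //.
    by analytic.
  have n5 : \forall z \near ((a, y0) : plane R), z.1 - c + T z * z.2 != 0.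
    apply: (an_near_neq0 (h := fun z => z.1 - c + T z * z.2)).
      by analytic.
    by rewrite /= T0 mul0r addr0.
  apply: filterS3 (filterI n1 n2) n3 (filterI n4 n5) => z [d n] p [x1 x2].
  have S := sqr_sqrtr (ltW d).
  have TE : T z = (a ^+ 2 - z.1 ^+ 2) / (z.1 * z.2 + Num.sqrt (focal_discr z)) by [].
  have E2 : (z.1 + T z * z.2) ^+ 2 = a ^+ 2 + B * T z ^+ 2.
    apply/eqP; rewrite -subr_eq0; apply/eqP; rewrite TE.
    set r := Num.sqrt (focal_discr z) in S n *.
    transitivity ((a ^+ 2 - z.1 ^+ 2) / (z.1 * z.2 + r) ^+ 2 * (focal_discr z - r ^+ 2)).
      by rewrite /focal_discr; field.
    by rewrite S subrr mulr0.
  have DE : D (T z) = z.1 + T z * z.2 by rewrite -E2 sqrtr_sqr gtr0_norm.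
  have XE : (D (T z) - c) / (1 - T z * (- z.2 / (z.1 - c))) = z.1 - c.
    rewrite DE.
    have -> : 1 - T z * (- z.2 / (z.1 - c)) = (z.1 - c + T z * z.2) / (z.1 - c).
      by field.
    have -> : z.1 + T z * z.2 - c = z.1 - c + T z * z.2 by ring.
    by rewrite invf_div mulrCA divff // mulr1.
  rewrite [RHS]surjective_pairing /focal_point -/(T z) XE /=; congr (_, _).
    by rewrite subrKC.
  by field.
have fb : focal_slopes (focal_point s0) = s0 by move/nbhs_singleton: near_g.
by split=> //; rewrite focal_base.
Qed.

Definition slope_tangent (t : R) : set (plane R) := [set z | z.1 + t * z.2 = D t].

Definition focal_line (m : R) : set (plane R) := [set z | z.2 = - m * (z.1 - c)].

Definition minor_circle (K : R) : set (plane R) :=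
  circle (0, c * K) (a * Num.sqrt (1 + K ^+ 2)).

(** The addition theorem of the tangent. *)
Definition slope_sum (s : plane R) : R := (s.1 + s.2) / (1 - s.1 * s.2).

Lemma slope_tangent_line (t : R) : 0 < a ^+ 2 + B * t ^+ 2 ->
  exists p, tangent_line_at (conic a B) p (slope_tangent t) /\ is_line (slope_tangent t).
Proof.
move=> d0; have an0 : a != 0 by rewrite gt_eqF.
have D0 : 0 < D t by rewrite sqrtr_gt0.
have Dn : D t != 0 by rewrite gt_eqF.
have DD := sqr_sqrtr (ltW d0).
pose p : plane R := (a ^+ 2 / D t, B * t / D t).
exists p.
have pK : conic a B p.
  rewrite /conic /p /=; transitivity ((a ^+ 2 + B * t ^+ 2) / D t ^+ 2).
    by field; rewrite Dn Bn0 an0.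
  by rewrite DD divff // gt_eqF.
have ap : a + p.1 != 0 by rewrite gt_eqF // addr_gt0 // divr_gt0 ?exprn_gt0.
have -> : slope_tangent t = conic_tangent a B p; last exact: conic_tangent_line.
apply/seteqP; split=> z; rewrite /slope_tangent /conic_tangent /p /= => E.
  transitivity ((z.1 + t * z.2) / D t); last by rewrite E divff.
  by field; rewrite Dn Bn0 an0.
transitivity (D t * (a ^+ 2 / D t / a ^+ 2 * z.1 + B * t / D t / B * z.2)).
  by field; rewrite Dn Bn0 an0.
by rewrite E mulr1.
Qed.

Lemma focal_lineP m : is_line (focal_line m) /\ focal_line m (c, 0).
Proof.
split; last by rewrite /focal_line /= subrr mulr0.
exists (c, 0), (1, - m); split; first by apply/eqP => -[/eqP]; rewrite oner_eq0.
apply/seteqP; split=> z; rewrite /focal_line /line /=.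
  move=> zE; exists (z.1 - c); rewrite [LHS]surjective_pairing mulr1 subrKC zE.
  by congr (_, _); ring.
by move=> [t ->] /=; ring.
Qed.

Lemma minor_circle_radius K : 0 < a * Num.sqrt (1 + K ^+ 2) /\
  (a * Num.sqrt (1 + K ^+ 2)) ^+ 2 = a ^+ 2 * (1 + K ^+ 2).
Proof.
have k0 : 0 < 1 + K ^+ 2 by rewrite ltr_wpDr // sqr_ge0.
by split; rewrite ?exprMn ?sqr_sqrtr ?(ltW k0) // mulr_gt0 // sqrtr_gt0.
Qed.

(** The circle touches the conic at the points of height - B K / c.  For K = 0
    these are the vertices, one of which is not covered by
    [conic_tangent_line]. *)
Lemma minor_circle_bitangent o e (L axis : set (plane R)) K :
  e.1 ^+ 2 + e.2 ^+ 2 = 1 ->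
  (forall z, conic a B z -> L (frame o e z)) ->
  (forall y, axis (frame o e (0, y))) -> K != 0 -> 0 < 1 - B * K ^+ 2 / c ^+ 2 ->
  in_coords o e (doubly_tangent_circles L axis) (minor_circle K).
Proof.
move=> e1 LP ax K0 d0; have an0 : a != 0 by rewrite gt_eqF.
have cn0 : c != 0 by rewrite gt_eqF.
pose x := a * Num.sqrt (1 - B * K ^+ 2 / c ^+ 2).
have x0 : 0 < x by rewrite mulr_gt0 // sqrtr_gt0.
have x2 : x ^+ 2 = a ^+ 2 * (1 - B * K ^+ 2 / c ^+ 2) by rewrite exprMn sqr_sqrtr // ltW.
have [r0 r2] := minor_circle_radius K; rewrite /minor_circle.
set r := a * Num.sqrt (1 + K ^+ 2) in r0 r2 *.
pose y := - B * K / c.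
have yE : y - c * K = - K * a ^+ 2 / c by rewrite /y /B; field.
have T (w : R) : w ^+ 2 = x ^+ 2 ->
   tangent_line_at (circle (0, c * K) r) (w, y) (conic_tangent a B (w, y)) /\
   tangent_line_at (conic a B) (w, y) (conic_tangent a B (w, y)).
  move=> w2; split.
    have rw : r + w != 0.
      apply/eqP => E; have wE : w = - r by lra.
      move: w2; rewrite wE sqrrN r2 x2 => /(mulfI (expf_neq0 2 an0)) E'.
      have : (a * K / c) ^+ 2 = 0.
        transitivity ((1 + K ^+ 2) - (1 - B * K ^+ 2 / c ^+ 2)); last by rewrite E' subrr.
        by rewrite /B; field.
      by move/eqP; rewrite sqrf_eq0 !mulf_eq0 invr_eq0 (negbTE an0) (negbTE K0) (negbTE cn0).
    have := @circle_tangent_line _ (0, c * K) r (w, y) r0; rewrite /sqdist /= subr0 yE w2 x2.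
    rewrite (_ : _ + _ = r ^+ 2); last by rewrite r2 /B; field.
    move=> /(_ erefl rw); congr tangent_line_at.
    have bE b : w / a ^+ 2 * b.1 + y / B * b.2 =
        (w * (b.1 - 0) + - K * a ^+ 2 / c * (b.2 - c * K) - a ^+ 2 * K ^+ 2) / a ^+ 2 :> R.
      by rewrite /y; field; rewrite an0 cn0 Bn0.
    apply/seteqP; split=> z; rewrite /conic_tangent /= bE r2.
      by move=> ->; field.
    move=> /(congr1 (fun b => b * a ^+ 2 + a ^+ 2 * K ^+ 2)).
    by rewrite divfK ?sqrf_eq0 // subrK => ->; ring.
  have aw : a + ((w, y) : plane R).1 != 0.
    apply/eqP => /= E; have wE : w = - a by lra.
    move: w2; rewrite wE sqrrN x2 -{1}[a ^+ 2]mulr1 => /(mulfI (expf_neq0 2 an0)) E'.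
    have : B * K ^+ 2 / c ^+ 2 = 0 by lra.
    by move/eqP; rewrite !mulf_eq0 invr_eq0 !sqrf_eq0 (negbTE Bn0) (negbTE K0) (negbTE cn0).
  have wK : conic a B (w, y).
    by rewrite /conic /= w2 x2 /y; field; rewrite Bn0 cn0 an0.
  by have [] := conic_tangent_line an0 Bn0 wK aw.
have [T1 T2] := T x erefl; have [T3 T4] := T (- x) (sqrrN x).
apply: (in_coords_doubly_tangent e1 LP r0 (ax _) _ T1 T2 T3 T4).
by move=> [E]; lra.
Qed.

(** The difference of the equations for two slopes t and s.1 is (t - s.1) times a
    continuous function which does not vanish at the base point. *)
Lemma near_slope_tangent :
  \forall z \near ((0, s0) : R * plane R), slope_tangent z.1 (focal_point z.2) <-> z.2.1 = z.1.
Proof.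
have [_ _ [/analytic2_near a1 /analytic2_near a2] _ _] := local_iso_focal.
have nD : \forall t \near (0 : R), 0 < a ^+ 2 + B * t ^+ 2.
  apply: (@near_gt0 _ (fun t => a ^+ 2 + B * t ^+ 2)); first by analytic.
  by rewrite expr0n mulr0 addr0 exprn_gt0.
have aD : analytic_near (fun q => a ^+ 2 + B * q.1 ^+ 2) (0, 0) by analytic.
have p0 : 0 < a ^+ 2 + B * (0 : R) ^+ 2 by rewrite expr0n mulr0 addr0 exprn_gt0.
have n2 : \forall s \near s0, 0 < a ^+ 2 + B * s.1 ^+ 2 /\ 1 - s.1 * s.2 != 0.
  apply: filterI.
    by apply: (an_near_gt0 (h := fun s => a ^+ 2 + B * s.1 ^+ 2)); first by analytic.
  apply: (an_near_neq0 (h := fun s => 1 - s.1 * s.2)).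
    by analytic.
  by rewrite /s0 /= mul0r subr0 oner_neq0.
pose H (z : R * plane R) := (focal_point z.2).2 * D z.1 +
  ((focal_point z.2).2 * D z.2.1 - B * z.2.1) - B * z.1.
have cH : {for ((0, s0) : R * plane R), continuous H}.
  have c2 : {for ((0, s0) : R * plane R), continuous (fun z : R * plane R => (focal_point z.2).2)}.
    apply: (@continuous_on_snd _ (fun s => (focal_point s).2)); exact: an_continuous.
  have c1 : {for ((0, s0) : R * plane R), continuous (fun z : R * plane R => D z.1)}.
    apply: (@continuous_on_fst _ (fun t => D t)); apply: an_continuous1.
    by analytic.
  have c3 : {for ((0, s0) : R * plane R), continuous (fun z : R * plane R =>
      (focal_point z.2).2 * D z.2.1 - B * z.2.1)}.
    apply: (@continuous_on_snd _ (fun s => (focal_point s).2 * D s.1 - B * s.1)).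
    by apply: an_continuous; analytic.
  have c4 : {for ((0, s0) : R * plane R), continuous (fun z : R * plane R => B * z.1)}.
    apply: (@continuous_on_fst _ (fun t => B * t)); apply: an_continuous1.
    by analytic.
  apply: cvgB c4; apply: cvgD c3; exact: cvgM.
have H0 : H (0, s0) != 0.
  have -> : H (0, s0) = (focal_point s0).2 * D 0 +
    ((focal_point s0).2 * D s0.1 - B * s0.1) - B * 0 by [].
  rewrite focal_base [s0.1]/= focal_D0 !mulr0 !subr0 gt_eqF //.
  by rewrite addr_gt0 // mulr_gt0.
apply: filterS2 (near_product nD n2) (continuous_near_neq0 cH H0).
move=> [t s] /= [d1 [d2 n]] Hn.
have [E1 _ _] := focal_discr_root d2 n.
have D1 : 0 < D t by rewrite sqrtr_gt0.
have D2 : 0 < D s.1 by rewrite sqrtr_gt0.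
have Q1 := sqr_sqrtr (ltW d1); have Q2 := sqr_sqrtr (ltW d2).
have Dn : D t + D s.1 != 0 by rewrite gt_eqF // addr_gt0.
split; last by move=> <-; exact: E1.
set z := focal_point s in E1 *; move=> h; have {h}E : z.1 + t * z.2 = D t := h.
have HE : H (t, s) = z.2 * D t + (z.2 * D s.1 - B * s.1) - B * t by [].
have F : (t - s.1) * H (t, s) = 0.
  rewrite HE.
  transitivity (((z.1 + t * z.2) - (z.1 + s.1 * z.2)) * (D t + D s.1) -
     ((a ^+ 2 + B * t ^+ 2) - (a ^+ 2 + B * s.1 ^+ 2))); first by ring.
  by rewrite E E1 -subr_sqr Q1 Q2 subrr.
by move/eqP: F; rewrite mulf_eq0 (negbTE Hn) orbF subr_eq0 => /eqP ->.
Qed.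

Lemma near_focal_line :
  \forall z \near ((m0, s0) : R * plane R), focal_line z.1 (focal_point z.2) <-> z.2.2 = z.1.
Proof.
have [_ _ [/analytic2_near a1 /analytic2_near a2] _ _] := local_iso_focal.
have n : \forall s \near s0, (focal_point s).1 - c != 0.
  apply: (an_near_neq0 (h := fun s => (focal_point s).1 - c)).
    by analytic.
  by rewrite focal_base /= subr_eq0.
have nT : \forall m \near m0, True by near=> m.
apply: filterS (near_product nT n) => -[m s] /= [_ sn].
have zE : (focal_point s).2 = - s.2 * ((focal_point s).1 - c).
  by rewrite /focal_point /= [c + _]addrC addrK.
split=> [h|<-]; last exact: zE.
have {}h : (focal_point s).2 = - m * ((focal_point s).1 - c) := h.
by move: h; rewrite zE => /(mulIf sn) /oppr_inj.
Unshelve. all: by end_near. Qed.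

(** For a given point the equation of the circle is quadratic in K, with
    [slope_sum] as one of its roots; at the base point it is a simple root. *)
Lemma near_minor_circle :
  \forall z \near ((m0, s0) : R * plane R),
    minor_circle z.1 (focal_point z.2) <-> slope_sum z.2 = z.1.
Proof.
have [_ _ [/analytic2_near a1 /analytic2_near a2] _ _] := local_iso_focal.
have n2 : \forall s \near s0, 0 < a ^+ 2 + B * s.1 ^+ 2 /\ 1 - s.1 * s.2 != 0.
  apply: filterI.
    apply: (an_near_gt0 (h := fun s => a ^+ 2 + B * s.1 ^+ 2)); first by analytic.
    by rewrite /s0 /= expr0n mulr0 addr0 exprn_gt0.
  apply: (an_near_neq0 (h := fun s => 1 - s.1 * s.2)).
    by analytic.
  by rewrite /s0 /= mul0r subr0 oner_neq0.
pose H (z : R * plane R) :=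
  2 * c * ((focal_point z.2).1 - c) * z.2.2 - B * slope_sum z.2 - B * z.1.
have cH : {for ((m0, s0) : R * plane R), continuous H}.
  apply: cvgB.
    apply: (@continuous_on_snd _ (fun s =>
      2 * c * ((focal_point s).1 - c) * s.2 - B * slope_sum s)).
    apply: an_continuous; rewrite /slope_sum; analytic.
    by rewrite /s0 /= mul0r subr0 oner_neq0.
  apply: (@continuous_on_fst _ (fun t => B * t)); apply: an_continuous1.
  by analytic.
have H0 : H (m0, s0) != 0.
  have -> : H (m0, s0) = 2 * c * ((focal_point s0).1 - c) * m0 -
    B * slope_sum s0 - B * m0 by [].
  rewrite focal_base /slope_sum /s0 /= mul0r subr0 add0r divr1.
  rewrite (_ : _ - _ = 2 * a * (- m0 * (a - c))); last by rewrite /B; ring.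
  by rewrite gt_eqF // mulr_gt0 // mulr_gt0.
have nT : \forall m \near m0, True by near=> m.
apply: filterS2 (near_product nT n2) (continuous_near_neq0 cH H0).
move=> [K s] /= [_ [d2 n]] Hn.
have Q2 := sqr_sqrtr (ltW d2).
have [r0 r2] := minor_circle_radius K.
rewrite /minor_circle; set z := focal_point s in Hn *; set K1 := slope_sum s in Hn *.
(* the equation of the circle, with the origin moved to the focus *)
pose E k := (z.1 - c) ^+ 2 * (1 + s.2 ^+ 2) + 2 * c * (z.1 - c) * (1 + k * s.2)
  - B * (1 + k ^+ 2).
have z2 : z.2 = - s.2 * (z.1 - c).
  by rewrite /z /focal_point /= [c + _]addrC addrK.
have EK1 : E K1 = 0.
  have zE : z.1 - c = (D s.1 - c) / (1 - s.1 * s.2).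
    by rewrite /z /focal_point /= [c + _]addrC addrK.
  transitivity ((1 + s.2 ^+ 2) / (1 - s.1 * s.2) ^+ 2 *
    (D s.1 ^+ 2 - (a ^+ 2 + B * s.1 ^+ 2))); last by rewrite Q2 subrr mulr0.
  by rewrite /E zE /K1 /slope_sum /B; field.
have EK : E K = (K1 - K) * - H (K, s).
  have -> : H (K, s) = 2 * c * (z.1 - c) * s.2 - B * K1 - B * K by [].
  by rewrite -[LHS]subr0 -EK1 /E; ring.
have -> : circle (0, c * K) (a * Num.sqrt (1 + K ^+ 2)) z <-> E K = 0.
  have -> : E K = sqdist z (0, c * K) - (a * Num.sqrt (1 + K ^+ 2)) ^+ 2.
    by rewrite r2 /sqdist /E z2 /B /=; ring.
  by split=> [/circleE -/(_ (ltW r0)) ->|/eqP]; [rewrite subrr|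
    rewrite subr_eq0 => /eqP h; apply/circleE => //; exact: ltW].
rewrite EK; split=> [/eqP|->]; last by rewrite subrr mul0r.
by rewrite mulf_eq0 oppr_eq0 (negbTE Hn) orbF subr_eq0 => /eqP.
Unshelve. all: by end_near. Qed.

End Chart.
End FocalWeb.

Section FocalLines.
Context {R : realType}.
Implicit Types (p q z w : plane R).

Lemma general_conicC (K : set (plane R)) F1 F2 : general_conic K F1 F2 -> general_conic K F2 F1.
Proof.
have ed (x y : plane R) : edist x y = edist y x.
  by rewrite /edist -(sqrrN (x.1 - _)) -(sqrrN (x.2 - _)) !opprB.
move=> [[a [[aE KE] nK]]|[a [a0 aE KE]]]; [left|right]; exists a.
  split=> //; split; first by rewrite ed.
  by rewrite KE; apply/seteqP; split=> q /=; rewrite addrC.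
split=> //; first by rewrite ed.
by rewrite KE; apply/seteqP; split=> q /=; rewrite distrC.
Qed.

Lemma minor_axisC (F1 F2 : plane R) : minor_axis F1 F2 = minor_axis F2 F1.
Proof. by apply/seteqP; split=> q; rewrite /minor_axis /= => ->. Qed.

Lemma near_tan_inj (t0 : R) : \forall u \near atan t0, atan (tan u) = u.
Proof. by have [] := local_iso1_atan t0. Qed.

(** The base point lies on the tangent at a vertex.  The value of m0 makes the
    circle through it touch the conic at two real points, and m0 <> 0 keeps it
    away from the circle which touches at the vertices. *)
Lemma web_of_first_focus (K : set (plane R)) F1 F2 : general_conic K F1 F2 ->
  contains_web (tangent_lines K) (line_pencil F1)
    (doubly_tangent_circles K (minor_axis F1 F2)).
Proof.
move=> /general_conic_frame [org [e [a [c [e1 [a0 c0 ac] F1E F2E KP]]]]].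
have an0 : a != 0 by rewrite gt_eqF.
have cn0 : c != 0 by rewrite gt_eqF.
(* the sign of m0 puts the base point at positive height *)
have [m0 [m0s m02]] : exists m0 : R, 0 < - m0 * (a - c) /\ m0 ^+ 2 = (c / (2 * a)) ^+ 2.
  have mp : 0 < c / (2 * a) by rewrite divr_gt0 // mulr_gt0.
  have [ca|ca] := ltP c a.
    by exists (- (c / (2 * a))); rewrite opprK sqrrN mulr_gt0 // subr_gt0.
  exists (c / (2 * a)); split=> //; rewrite mulNr -mulrN opprB mulr_gt0 // subr_gt0.
  by rewrite lt_neqAle ac.
have m0n : m0 != 0 by apply: contraTneq m0s => ->; rewrite oppr0 mul0r ltxx.
set B := a ^+ 2 - c ^+ 2.
have i := local_iso_comp (local_iso_focal a0 ac m0s)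
  (local_iso_prod (local_iso1_atan 0) (local_iso1_atan m0)).
have at0 : atan 0 = 0 :> R by exact: atan0.
set w0 : plane R := (atan 0, atan m0) in i.
have l1 : lin (1, 0) w0 = atan 0 by rewrite /lin /w0 /=; ring.
have l2 : lin (0, 1) w0 = atan m0 by rewrite /lin /w0 /=; ring.
have l3 : lin (1, 1) w0 = atan m0 by rewrite /lin /w0 /= at0; ring.
have [_ _ at1 _ _] := local_iso1_atan (0 : R).
have [_ _ at2 _ _] := local_iso1_atan m0.
have ct t : {for atan t, continuous (@tan R)}.
  have [_ _ at_t _ _] := local_iso1_atan t.
  by apply: an_continuous1; exact: analytic1_near at_t.
have cK := analytic1_pair_continuous at1 at2.
have N1 : \forall w \near w0, atan (tan w.1) = w.1.
  exact: (near_fst (atan m0) (near_tan_inj 0)).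
have N2 : \forall w \near w0, atan (tan w.2) = w.2.
  exact: (near_snd (atan 0) (near_tan_inj m0)).
have rho0 : 0 < a ^+ 2 by rewrite exprn_gt0.
apply: (@web_in_frame _ org e e1 _ _ _ _ _ _ _ (a ^+ 2)
  (fun u => slope_tangent a c (tan u)) (fun v => focal_line c (tan v))
  (fun w : R => minor_circle a c (tan w)) rho0 i).
- split; rewrite l1.
    have n : \forall t \near (0 : R), 0 < a ^+ 2 + B * t ^+ 2.
      apply: (@near_gt0 _ (fun t => a ^+ 2 + B * t ^+ 2)); first by analytic.
      by rewrite expr0n mulr0 addr0.
    have : \forall u \near atan (0 : R), 0 < a ^+ 2 + B * tan u ^+ 2.
      by apply: (near_comp1 (P := fun t => 0 < a ^+ 2 + B * t ^+ 2)) => //; rewrite atanK.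
    apply: filterS => u d; have [p [T lT]] := slope_tangent_line a0 c0 ac d.
    by split; [exact: (in_coords_tangent_lines e1 KP T)|right].
  pose P (z : R * plane R) := slope_tangent a c z.1 (focal_point a c z.2) <-> z.2.1 = z.1.
  have HP : \forall z \near ((tan (atan 0), (tan (atan 0), tan (atan m0))) : R * plane R), P z.
    by rewrite !atanK; exact: near_slope_tangent.
  apply: filterS2 (near_reparam2 (P := P) (ct 0) cK HP) (near_product (near_tan_inj 0) N1).
  move=> [u w] /= Pw [E1 E2]; apply: iff_trans Pw _; rewrite /lin /= mul0r addr0 mul1r.
  by split=> [E|->//]; rewrite -E1 -E2 E.
- split; rewrite l2.
    near=> v; have [lF cF] := focal_lineP c (tan v); split; last by right.
    split; first exact: frame_is_line.
    by rewrite F1E; exists (c, 0).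
  pose P (z : R * plane R) := focal_line c z.1 (focal_point a c z.2) <-> z.2.2 = z.1.
  have HP : \forall z \near ((tan (atan m0), (tan (atan 0), tan (atan m0))) : R * plane R), P z.
    by rewrite !atanK; exact: near_focal_line.
  apply: filterS2 (near_reparam2 (P := P) (ct m0) cK HP) (near_product (near_tan_inj m0) N2).
  move=> [u w] /= Pw [E1 E2]; apply: iff_trans Pw _; rewrite /lin /= mul0r add0r mul1r.
  by split=> [E|->//]; rewrite -E1 -E2 E.
- split; rewrite l3.
    have n1 : \forall t \near m0, t != 0.
      by apply: (@near_neq0 _ (fun t => t)) => //; analytic.
    have n2 : \forall t \near m0, 0 < 1 - B * t ^+ 2 / c ^+ 2.
      apply: (@near_gt0 _ (fun t => 1 - B * t ^+ 2 / c ^+ 2)).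
        by analytic; rewrite sqrf_eq0.
      rewrite m02 (_ : _ - _ = (3 * a ^+ 2 + c ^+ 2) / (4 * a ^+ 2)).
        by rewrite divr_gt0 ?mulr_gt0 // addr_gt0 ?exprn_gt0 // mulr_gt0.
      by rewrite /B; field; rewrite an0 cn0.
    have : \forall w \near atan m0, tan w != 0 /\ 0 < 1 - B * tan w ^+ 2 / c ^+ 2.
      apply: (near_comp1 (P := fun t => t != 0 /\ 0 < 1 - B * t ^+ 2 / c ^+ 2)) => //.
      by rewrite atanK; apply: filterI.
    apply: filterS => w [d1 d2]; have [r0 r2] := minor_circle_radius a0 (tan w).
    split.
      apply: (minor_circle_bitangent a0 c0 ac e1 KP) => // y.
      rewrite /minor_axis /= F1E F2E !edist_frame // /edist /=.
      by rewrite sub0r opprK add0r sqrrN.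
    left; do 2 eexists; split; [exact: r0| |by []].
    by rewrite r2; apply: ler_peMr; [exact: ltW|rewrite lerDl sqr_ge0].
  pose P (z : R * plane R) := minor_circle a c z.1 (focal_point a c z.2) <-> slope_sum z.2 = z.1.
  have HP : \forall z \near ((tan (atan m0), (tan (atan 0), tan (atan m0))) : R * plane R), P z.
    by rewrite !atanK; exact: near_minor_circle.
  have bd (t : R) : - (pi / 2) < atan t < pi / 2 by rewrite atan_gtNpi2 atan_ltpi2.
  have NB (t : R) : \forall u \near atan t, - (pi / 2) < u < pi / 2.
    have [h1 h2] := andP (bd t).
    have n1 : \forall u \near atan t, - (pi / 2) < u by exact: lt_nbhsr.
    have n2 : \forall u \near atan t, u < pi / 2 by exact: lt_nbhsl.
    by apply: filterS2 n1 n2 => u u1 u2; rewrite u1.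
  have NS : \forall w \near w0, 0 < pi / 2 - (w.1 + w.2) /\ 0 < w.1 + w.2 + pi / 2.
    have [h1 h2] := andP (bd m0).
    apply: filterI.
      apply: (an_near_gt0 (h := fun w => pi / 2 - (w.1 + w.2))); first by analytic.
      by rewrite /w0 /= at0 add0r subr_gt0.
    apply: (an_near_gt0 (h := fun w => w.1 + w.2 + pi / 2)); first by analytic.
    by rewrite /w0 /= at0 add0r -ltrBlDr sub0r.
  have NW : \forall w \near w0, [/\ - (pi / 2) < w.1 < pi / 2, - (pi / 2) < w.2 < pi / 2
      & 0 < pi / 2 - (w.1 + w.2) /\ 0 < w.1 + w.2 + pi / 2].
    by apply: filterS3 (near_fst (atan m0) (NB 0)) (near_snd (atan 0) (NB m0)) NS.
  apply: filterS2 (near_reparam2 (P := P) (ct m0) cK HP) (near_product (NB m0) NW).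
  move=> [u w] /= Pw [bu [b1 b2 [s1 s2]]]; apply: iff_trans Pw _.
  have -> : slope_sum (tan w.1, tan w.2) = tan (w.1 + w.2).
    by rewrite tanD ?gt_eqF ?cos_gt0_pihalf.
  rewrite /lin !mul1r; split=> [E|->//].
  have bs : w.1 + w.2 \in `]- (pi / 2), pi / 2[.
    by rewrite in_itv /=; apply/andP; split; lra.
  have bu' : u \in `]- (pi / 2), pi / 2[ by rewrite in_itv.
  by rewrite -(tanK bs) E tanK.
Unshelve. all: by end_near. Qed.

Lemma focal_lines_web (K : set (plane R)) F1 F2 F : general_conic K F1 F2 ->
  F = F1 \/ F = F2 ->
  contains_hexagonal_web (tangent_lines K) (line_pencil F)
    (doubly_tangent_circles K (minor_axis F1 F2)).
Proof.
move=> gK [->|->]; apply: contains_web_hexagonal; first exact: web_of_first_focus.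
by rewrite minor_axisC; apply: web_of_first_focus; exact: general_conicC.
Qed.

End FocalLines.

(** * The five webs *)

Theorem theorem1p1 (R : realType) :
  (forall (O : plane R) (r : R) (P : set (set (plane R))),
      0 < r -> parabolic_pencil P O ->
      contains_hexagonal_web_twice (tangent_lines (circle O r)) P) /\
  (forall (K : set (plane R)) (F1 F2 : plane R) (P : set (set (plane R))),
      general_conic K F1 F2 -> hyperbolic_pencil P F1 F2 ->
      contains_hexagonal_web_twice (tangent_lines K) P) /\
  (forall (K : set (plane R)) (F1 F2 F : plane R),
      general_conic K F1 F2 -> F = F1 \/ F = F2 ->
      contains_hexagonal_web (tangent_lines K) (line_pencil F)
        (doubly_tangent_circles K (minor_axis F1 F2))) /\
  (forall (K D : set (plane R)) (F Q : plane R) (P : set (set (plane R))),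
      is_parabola K F D -> D Q -> hyperbolic_pencil P F Q ->
      contains_hexagonal_web_twice (tangent_lines K) P) /\
  (forall (K : set (plane R)) (F1 F2 : plane R) (a : R)
          (P : set (set (plane R))),
      is_ellipse K F1 F2 a ->
      eccentricity F1 F2 a = 1 / Num.sqrt 2 ->
      elliptic_pencil P F1 F2 ->
      contains_hexagonal_web_twice
        (doubly_tangent_circles K (major_axis F1 F2)) P).
Proof.
split; first by move=> O r P r0 PO; exact: tangents_of_circle_web.
split; first by move=> K F1 F2 P gK hP; exact: tangents_of_focal_conic_web gK hP.
split; first by move=> K F1 F2 F; exact: focal_lines_web.
split; first by move=> K D F Q P pK DQ hP; exact: tangents_of_parabola_web pK DQ hP.
by move=> K F1 F2 a P eK ecc eP; exact: circles_of_ellipse_web eK ecc eP.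
Qed.
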